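(* Fix $\rho\ge1$ and $\mu>0$. For each $d$, let $\boldsymbol\alpha$ be a random variable distributed as $\|x\|_2$ with $x\sim\mathcal N(0,I_d/d)$, and for $m\in\mathbb{R}$ define $$\check{\mathrm{Cross}}_d(\rho;m):=\mathbb{E}\big\|\mathbb{E}[\check u\check u^\top\mid\check M]\big\|_F^2,\qquad \check M=W+\sqrt\rho\,\check u\check u^\top,$$ where $\check u$ has i.i.d. coordinates $\check u_i\sim\mathcal N(m/\sqrt d,1/d)$ and $W$ is an independent GOE matrix as in the context. Then $$\lim_{d\to\infty}\mathbb{E}_{\boldsymbol\alpha}\big[\mathbb{I}(|\boldsymbol\alpha-1|\le d^{-1/4})\,\check{\mathrm{Cross}}_d(\rho;\mu\boldsymbol\alpha)\big]\le\Big(1+\mu^2-\frac1\rho+\frac{|\mu|}{\sqrt\rho}\Big)^2.$$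
   Context: GOE matrix: $d\times d$ symmetric with independent entries $W_{ii}\sim\mathcal N(0,2/d)$ and $W_{ij}\sim\mathcal N(0,1/d)$ for $i<j$. $\|\cdot\|_F$ is the Frobenius norm. *)

(* Defs.v *)
From HB Require Import structures.
From mathcomp Require Import all_boot all_order all_algebra.
From mathcomp Require Import all_classical all_reals all_analysis.
Unset Printing Implicit Defensive.
Import Order.TTheory GRing.Theory Num.Theory.
Local Open Scope classical_set_scope.
Local Open Scope ring_scope.

Section Defs.
Context {R : realType}.

(* gauss_iter n mean sd f = E[ f(X) ] where X : nat -> R has independent
   coordinates X_k ~ N(mean k, (sd k)^2) for k < n and X_k = 0 for k >= n.
   Computed as an iterated Lebesgue integral against the Gaussian
   probability measures normal_prob (mean, standard deviation). *)
Fixpoint gauss_iter (n : nat) (mean sd : nat -> R) (f : (nat -> R) -> R) : R :=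
  match n with
  | 0 => f (fun _ => 0)
  | k.+1 => Rintegral (normal_prob (mean k) (sd k)) setT
      (fun x => gauss_iter k mean sd
                  (fun v => f (fun i => if i == k then x else v i)))
  end.

Definition frob2 (d : nat) (A : 'M[R]_d) : R := \sum_(i < d) \sum_(j < d) A i j ^+ 2.

(* GOE: entries indexed by k = i * d + j with i <= j (coordinates with i > j
   are dummy and unused).  Variance 2/d on the diagonal, 1/d off it. *)
Definition goe_sd (d : nat) (k : nat) : R :=
  if (k %/ d)%N == (k %% d)%N then Num.sqrt (2 / d%:R) else Num.sqrt (1 / d%:R).
Definition goe_of (d : nat) (w : nat -> R) : 'M[R]_d :=
  \matrix_(i < d, j < d) w (minn i j * d + maxn i j)%N.
(* Density of a GOE matrix at a symmetric matrix A (w.r.t. Lebesgue measure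
   on the entries i <= j). *)
Definition goe_density (d : nat) (A : 'M[R]_d) : R :=
  \prod_(i < d) \prod_(j < d | (i <= j)%N)
     normal_pdf 0 (if i == j then Num.sqrt (2 / d%:R) else Num.sqrt (1 / d%:R)) (A i j).

Definition spike (d : nat) (rho : R) (u : nat -> R) : 'M[R]_d :=
  \matrix_(i < d, j < d) (Num.sqrt rho * u i * u j).

Definition u_mean (d : nat) (m : R) : nat -> R := fun _ => m / Num.sqrt d%:R.
Definition u_sd (d : nat) : nat -> R := fun _ => Num.sqrt (1 / d%:R).

(* Conditional expectation E[u u^T | M = A] given by Bayes' formula:
   the posterior mean of u u^T, where the likelihood of A given u is the
   GOE density of A - sqrt(rho) u u^T. *)
Definition post_mean (d : nat) (rho m : R) (A : 'M[R]_d) : 'M[R]_d :=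
  \matrix_(i < d, j < d)
    (gauss_iter d (u_mean d m) (u_sd d)
        (fun u => u i * u j * goe_density d (A - spike d rho u))
     / gauss_iter d (u_mean d m) (u_sd d)
        (fun u => goe_density d (A - spike d rho u))).

Definition cross_check (d : nat) (rho m : R) : R :=
  gauss_iter d (u_mean d m) (u_sd d) (fun u =>
    gauss_iter (d * d) (fun _ => 0) (goe_sd d) (fun w =>
      frob2 d (post_mean d rho m (goe_of d w + spike d rho u)))).

Definition truncated_cross (rho mu : R) (d : nat) : R :=
  gauss_iter d (fun _ => 0) (u_sd d) (fun x =>
    let alpha := Num.sqrt (\sum_(i < d) x i ^+ 2) in
    (if `|alpha - 1| <= powR (d%:R) (- (1 / 4)) then 1 else 0)
      * cross_check d rho (mu * alpha)).

End Defs.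

(* Main.v *)
(* Let b and C be the posterior mean and covariance of u given M, X = |b|^2, and let G(rho, m) be the
   expected squared norm of the posterior mean of u u^T.
   Integrating by parts in the Gaussian prior and in the Gaussian noise shows that
   E[(X - q) p(X)] is small for every constant q, where
   p(x) = rho x^2 + (1 - rho (1 + m^2)) x - m^2 = rho (x - q) (x + r) if q is the positive root,
   as soon as E|C|^2 is small and d is large; then E(X - q)^2 is small and G(rho, m) is close to q^2.
   That E|C|^2 is small holds for at least one signal strength in any window around rho: E X is bounded
   and nondecreasing in rho, and adding an observation of strength delta increases it by at least
   2 sqrt(delta) m E|C|^2 up to lower order terms, as one sees by comparing the Bayes estimator with
   b + C (W' e - sqrt(delta) m b), where W' is the new observation and e the direction of the prior mean.
   Since G is nondecreasing in rho, it is squeezed between its values at good points on both sides of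
   rho, and the limit is q^2 uniformly for m near mu. Finally q <= 1 + mu^2 - 1/rho + mu / sqrt rho. *)

Require Import Defs.
From HB Require Import structures.
From mathcomp Require Import all_boot all_order all_algebra.
From mathcomp Require Import all_classical all_reals all_analysis.
From mathcomp Require Import measurable_realfun lebesgue_integral_under.
From mathcomp Require Import ring lra.
Set Implicit Arguments.
Unset Strict Implicit.
Unset Printing Implicit Defensive.
Import Order.TTheory GRing.Theory Num.Theory numFieldNormedType.Exports.
Local Open Scope classical_set_scope.
Local Open Scope ring_scope.

(** * Gaussian integrals *)

(** The polynomial p is tested against X - q because (x - q) p(x) = rho (x - q)^2 (x + r) and X >=
    0: the identity itself then bounds rho r E(X - q)^2, and r > 0 because mu > 0. A small E|C|^2
    closes the relation, since given M the overlap of u and b has mean X and variance b^T C b <= |C|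
    X. The covariance might be large exactly at rho, so only nearby good strengths are sought, and
    monotonicity carries the result to rho. The positive mean makes the search succeed: u has a
    component close to m along e, so a new observation of strength delta applied to e shows
    sqrt(delta) m u plus noise, a signal linear in u. Cutting a window of width w^2 into N^2 steps
    gives each bad step a gain of order w / N, in total of order N w, more than the bound on E X
    allows. The quantities to be computed are iterated integrals whose inner stages are not known to
    be measurable. They are therefore identified, up to null sets, with expectations under Gaussian
    measures on a space of sequences, where Fubini's theorem, changes of measure and integration by
    parts are available. *)

Section LebesgueAffine.
Context {R : realType}.
Notation lam := (@lebesgue_measure R).

(** Lebesgue measure is [c] times its image under [x -> c x + e], because the two agree on half-open
    intervals. *)
Lemma ge0_integral_lebesgue_affine (c e : R) (f : R -> \bar R) :
  0 < c -> measurable_fun setT f -> (forall x, 0 <= f x)%E ->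
  (\int[lam]_x f x = c%:E * \int[lam]_x f (c * x + e)%R)%E.
Proof.
move=> c0 mf f0.
pose g := fun x : measurableTypeR R => (c * x + e : measurableTypeR R).
have mg : measurable_fun setT g.
  by apply: measurable_funD => //; apply: measurable_funM.
pose m : {measure set (measurableTypeR R) -> \bar R} :=
  mscale (NngNum (ltW c0)) (measure_function_pushforward__canonical__measure_function_Measure lam mg).
have mE A : measurable A -> lam A = m A.
  apply: lebesgue_measure_unique => _ [[a b] /= _ <-].
  rewrite /m /mscale/= /pushforward.
  have -> : g @^-1` `]a, b]%classic = `](a - e) / c, (b - e) / c]%classic.
    apply/seteqP; split => x /=; rewrite !in_itv/= /g;
    by rewrite ltr_pdivrMr// ler_pdivlMr// ltrBlDr lerBrDr (mulrC x).
  rewrite !lebesgue_measure_itv/= !lte_fin.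
  rewrite ltr_pM2r ?invr_gt0// ltrD2r.
  case: ifPn => ab; last by rewrite mule0.
  by rewrite -!EFinD -EFinM; congr EFin; field; rewrite gt_eqF.
rewrite (eq_measure_integral m); last by move=> A mA _; exact: mE.
by rewrite ge0_integral_mscale//= ge0_integral_pushforward//.
Qed.

End LebesgueAffine.

Section Density.
Local Open Scope ereal_scope.
Context d (T : measurableType d) (R : realType).
Variables (mu nu : {measure set T -> \bar R}) (g : T -> R).
Hypothesis g0 : forall x, (0 <= g x)%R.
Hypothesis mg : measurable_fun setT g.
Hypothesis nuE : forall A, measurable A -> nu A = \int[mu]_(x in A) (g x)%:E.

Import HBNNSimple.

Let density_nnsfun (f : {nnsfun T >-> R}) :
  \int[nu]_x (f x)%:E = \int[mu]_x ((f x)%:E * (g x)%:E).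
Proof.
under [LHS]eq_integral do rewrite fimfunE -fsumEFin//.
rewrite [LHS]ge0_integral_fsum//; last 2 first.
- by move=> r; exact/measurable_EFinP/measurableT_comp.
- by move=> n x _; rewrite EFinM nnfun_muleindic_ge0.
under [RHS]eq_integral.
  move=> x _; rewrite fimfunE -fsumEFin// muleC ge0_mule_fsumr; last first.
    by move=> r; rewrite EFinM nnfun_muleindic_ge0.
  over.
rewrite [RHS]ge0_integral_fsum//; last 2 first.
- move=> r; apply/emeasurable_funM; first exact/measurable_EFinP.
  by apply/measurable_EFinP; do 2 apply/measurableT_comp => //.
- move=> n x _; rewrite mule_ge0//; first by rewrite lee_fin.
  by rewrite EFinM nnfun_muleindic_ge0.
apply: eq_fsbigr => r _.
rewrite integralZl_indic_nnsfun// integral_indic// setIT.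
have mA : measurable (f @^-1` [set r]) by [].
rewrite nuE// integral_mkcond/=.
have [r0|r0] := ltP r 0%R.
  rewrite preimage_nnfun0//.
  under eq_integral do rewrite patchE in_set0.
  rewrite integral0 mule0.
  by under eq_integral do rewrite indicE in_set0 mulr0 mule0; rewrite integral0.
rewrite -ge0_integralZl//; last first.
- by move=> x _; rewrite patchE; case: ifPn => //; rewrite lee_fin.
- apply/(measurable_restrictT _ mA)/measurable_funTS; exact/measurable_EFinP.
apply: eq_integral => x _; rewrite patchE indicE.
by case: ifPn => xA; rewrite ?mulr1 ?mulr0 ?mule0// muleC.
Qed.

Lemma ge0_integral_density (f : T -> \bar R) :
  measurable_fun setT f -> (forall x, 0 <= f x) ->
  \int[nu]_x f x = \int[mu]_x (f x * (g x)%:E).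
Proof.
move=> mf f0.
pose f_ := nnsfun_approx measurableT mf.
transitivity (lim (\int[nu]_x (f_ n x)%:E @[n --> \oo])).
  rewrite -monotone_convergence//=.
  - apply: eq_integral => ? /[!inE] xD; apply/esym/cvg_lim => //=.
    exact: cvg_nnsfun_approx.
  - by move=> n; exact/measurable_EFinP/measurable_funTS.
  - by move=> n ? _; rewrite lee_fin.
  - by move=> ? _ ? ? mn; rewrite lee_fin; exact/lefP/nd_nnsfun_approx.
transitivity (lim (\int[mu]_x ((f_ n x)%:E * (g x)%:E) @[n --> \oo])).
  by apply: congr_lim; apply/funext => n /=; exact: density_nnsfun.
rewrite -monotone_convergence//=.
- apply: eq_integral => x _; apply/cvg_lim => //.
  apply: cvgeMr => //; exact: cvg_nnsfun_approx.
- by move=> n; apply: emeasurable_funM; apply/measurable_EFinP.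
- by move=> n x _; rewrite mule_ge0// lee_fin.
- move=> x _ a b ab; rewrite lee_wpmul2r// ?lee_fin//.
  exact/lefP/nd_nnsfun_approx.
Qed.

End Density.

Section NormalProb.
Context {R : realType}.
Notation lam := (@lebesgue_measure R).
Implicit Types (m s c e x : R).

Lemma ge0_integral_normal m s (f : measurableTypeR R -> \bar R) :
  measurable_fun setT f -> (forall x, 0 <= f x)%E ->
  (\int[normal_prob m s]_x f x = \int[lam]_x (f x * (normal_pdf m s x)%:E))%E.
Proof.
move=> mf f0; apply: (@ge0_integral_density _ _ _ lam _ (normal_pdf m s)) => //.
- by move=> x; exact: normal_pdf_ge0.
- exact: measurable_normal_pdf.
Qed.

Lemma normal_pdf_gt0E m s x : 0 < s ->
  normal_pdf m s x = (s * Num.sqrt (pi *+ 2))^-1 * expR (- (x - m) ^+ 2 / (s ^+ 2 *+ 2)).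
Proof.
move=> s0; rewrite normal_pdfE ?gt_eqF// /normal_peak /normal_fun.
by rewrite -mulrnAr sqrtrM ?sqr_ge0// sqrtr_sqr gtr0_norm.
Qed.

Lemma ge0_integral_normal_affine m s c e (f : measurableTypeR R -> \bar R) :
  0 < s -> 0 < c -> measurable_fun setT f -> (forall x, 0 <= f x)%E ->
  (\int[normal_prob m s]_x f (c * x + e)%R =
   \int[normal_prob (c * m + e)%R (c * s)%R]_x f x)%E.
Proof.
move=> s0 c0 mf f0.
have mg : measurable_fun setT (fun x : measurableTypeR R => c * x + e : measurableTypeR R).
  by apply: measurable_funD => //; apply: measurable_funM.
have mfg : measurable_fun setT (fun x : measurableTypeR R => f (c * x + e)).
  exact: (measurableT_comp mf mg).
have mp : measurable_fun setT (fun x : measurableTypeR R =>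
    (f x * (normal_pdf (c * m + e)%R (c * s)%R x)%:E)%E).
  apply: emeasurable_funM; [exact: mf|apply/measurable_EFinP].
  exact: measurable_normal_pdf.
have p0 x : (0 <= f x * (normal_pdf (c * m + e)%R (c * s)%R x)%:E)%E.
  by rewrite mule_ge0// lee_fin normal_pdf_ge0.
rewrite (ge0_integral_normal m s mfg (fun x => f0 _)).
rewrite (ge0_integral_normal _ _ mf f0).
rewrite (ge0_integral_lebesgue_affine e c0 mp p0).
have mpg := measurableT_comp mp mg.
rewrite -ge0_integralZl//.
all: try by [exact: mpg | move=> x _; exact: p0 | rewrite lee_fin ltW].
apply: eq_integral => x _; rewrite muleCA -EFinM; congr (_ * _%:E)%E.
rewrite !normal_pdf_gt0E ?mulr_gt0//.
have -> : c * ((c * s * Num.sqrt (pi *+ 2))^-1 * expR (- (c * x + e - (c * m + e)) ^+ 2 / ((c * s) ^+ 2 *+ 2))) =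
  (s * Num.sqrt (pi *+ 2))^-1 * expR (- (c * x + e - (c * m + e)) ^+ 2 / ((c * s) ^+ 2 *+ 2)).
  rewrite mulrA; congr (_ * _); rewrite -mulrA invfM mulrA divff ?mul1r//.
  by rewrite gt_eqF.
congr (_ * expR _); field.
by rewrite !gt_eqF.
Qed.

End NormalProb.

(** * Random variables with finite moments *)

Section Mom.
Context d (T : measurableType d) (R : realType) (P : probability T R).
Implicit Types f g : T -> R.

(* These functions form an algebra, so that integrability can be read off the shape of an integrand. *)
Definition mom f := measurable_fun setT f /\
  forall k, P.-integrable setT (fun x => (`|f x| ^+ k)%:E).

Lemma mom_meas f : mom f -> measurable_fun setT f. Proof. by case. Qed.

Lemma mom_le f g : measurable_fun setT f -> (forall x, `|f x| <= `|g x|) ->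
  mom g -> mom f.
Proof.
move=> mf fg [mg ig]; split => // k.
apply: le_integrable (ig k) => //.
  by apply/measurable_EFinP/measurable_funX; exact: measurableT_comp.
by move=> x _; rewrite /= lee_fin !normrX !normr_id lerXn2r ?nnegrE.
Qed.

Lemma mom_integrable f : mom f -> P.-integrable setT (EFin \o f).
Proof.
move=> [mf fi]; apply: le_integrable (fi 1) => //; first exact/measurable_EFinP.
by move=> x _; rewrite /= expr1 normr_id.
Qed.

Lemma mom_cst c : mom (cst c).
Proof.
split => // k.
have -> : (fun x : T => (`|cst c x| ^+ k)%:E) = EFin \o cst (`|c| ^+ k) by [].
exact: finite_measure_integrable_cst.
Qed.

Lemma mom_bounded f (c : R) : measurable_fun setT f -> (forall x, `|f x| <= c) -> mom f.
Proof.
by move=> mf fc; apply: mom_le (mom_cst c) => // x; rewrite (le_trans (fc x))// ler_norm.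
Qed.

Lemma momD f g : mom f -> mom g -> mom (fun x => f x + g x).
Proof.
move=> [mf fi] [mg gi]; split; first exact: measurable_funD.
move=> k; have H := integrableZl measurableT (2 ^+ k) (integrableD measurableT (fi k) (gi k)).
apply: le_integrable H => //.
  apply/measurable_EFinP/measurable_funX/measurableT_comp => //.
  exact: measurable_funD.
move=> x _; rewrite /= lee_fin normrX normr_id [leRHS]ger0_norm; last first.
  by rewrite mulr_ge0 ?exprn_ge0// addr_ge0 ?exprn_ge0.
(* The k-th power of a sum is at most [2 ^ k] times the k-th power of the larger term. *)
wlog fg : f g {mf fi mg gi} / `|f x| <= `|g x|.
  move=> H; case: (leP `|f x| `|g x|) => [|/ltW] fg; first exact: H.
  by rewrite (addrC (f x)) (addrC (`|f x| ^+ k)); exact: H.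
apply: (@le_trans _ _ ((2 * `|g x|) ^+ k)).
  rewrite lerXn2r ?nnegrE ?mulr_ge0//; apply: (le_trans (ler_normD _ _)).
  by rewrite mulrDl mul1r lerD2r.
by rewrite exprMn; apply: ler_wpM2l; rewrite ?exprn_ge0// lerDr exprn_ge0.
Qed.

Lemma momM f g : mom f -> mom g -> mom (fun x => f x * g x).
Proof.
move=> [mf fi] [mg gi]; split; first exact: measurable_funM.
move=> k; have H := integrableD measurableT (fi (k * 2)%N) (gi (k * 2)%N).
apply: le_integrable H => //.
  apply/measurable_EFinP/measurable_funX/measurableT_comp => //.
  exact: measurable_funM.
move=> x _; rewrite /= lee_fin normrX normr_id [leRHS]ger0_norm; last first.
  by rewrite addr_ge0 ?exprn_ge0.
rewrite normrM exprMn !exprM; set a := _ ^+ k; set b := _ ^+ k; nra.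
Qed.

Lemma momN f : mom f -> mom (fun x => - f x).
Proof.
move=> fi; have := momM (mom_cst (-1)) fi.
by congr mom; apply/funext => x; rewrite mulN1r.
Qed.

Lemma momB f g : mom f -> mom g -> mom (fun x => f x - g x).
Proof. by move=> mf mg; apply: momD => //; exact: momN. Qed.

Lemma momX f n : mom f -> mom (fun x => f x ^+ n).
Proof.
move=> mf; elim: n => [|n IH].
  by rewrite (_ : (fun _ => _) = cst 1)//; exact: mom_cst.
under eq_fun do rewrite exprS.
exact: momM.
Qed.

Lemma mom_norm f : mom f -> mom (fun x => `|f x|).
Proof.
move=> mf; apply: mom_le (mf) => [|x]; last by rewrite normr_id.
by apply: measurableT_comp => //; exact: mom_meas.
Qed.

Lemma mom_sum (I : Type) (r : seq I) (A : pred I) (h : I -> T -> R) :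
  (forall i, A i -> mom (h i)) -> mom (fun x => \sum_(i <- r | A i) h i x).
Proof.
move=> hi; elim: r => [|i r IH].
  under eq_fun do rewrite big_nil.
  exact: mom_cst.
under eq_fun do rewrite big_cons.
case: (boolP (A i)) => // Ai; apply: momD => //; exact: hi.
Qed.

Definition Ex f : R := \int[P]_x f x.

Lemma Ex_cst c : Ex (cst c) = c.
Proof.
rewrite /Ex /cst Rintegral_cst// (_ : fine _ = 1) ?mulr1//.
by transitivity (fine (1%E : \bar R)) => //; apply: (f_equal fine); exact: probability_setT.
Qed.

Lemma ExD f g : mom f -> mom g -> Ex (fun x => f x + g x) = Ex f + Ex g.
Proof. by move=> mf mg; rewrite /Ex RintegralD//; exact: mom_integrable. Qed.

Lemma ExB f g : mom f -> mom g -> Ex (fun x => f x - g x) = Ex f - Ex g.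
Proof. by move=> mf mg; rewrite /Ex RintegralB//; exact: mom_integrable. Qed.

Lemma ExZl c f : mom f -> Ex (fun x => c * f x) = c * Ex f.
Proof. by move=> mf; rewrite /Ex RintegralZl//; exact: mom_integrable. Qed.

Lemma ExZr c f : mom f -> Ex (fun x => f x * c) = Ex f * c.
Proof. by move=> mf; rewrite /Ex RintegralZr//; exact: mom_integrable. Qed.

Lemma Ex_sum (I : Type) (r : seq I) (A : pred I) (h : I -> T -> R) :
  (forall i, A i -> mom (h i)) ->
  Ex (fun x => \sum_(i <- r | A i) h i x) = \sum_(i <- r | A i) Ex (h i).
Proof.
move=> hi; elim: r => [|i r IH].
  rewrite big_nil; under [X in Ex X]eq_fun do rewrite big_nil.
  exact: Ex_cst.
rewrite big_cons; under [X in Ex X]eq_fun do rewrite big_cons.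
case: ifPn => // Ai; rewrite ExD ?IH//; first exact: hi.
exact: mom_sum.
Qed.

Lemma le_Ex f g : mom f -> mom g -> (forall x, f x <= g x) -> Ex f <= Ex g.
Proof.
by move=> mf mg fg; apply: le_Rintegral => //; exact: mom_integrable.
Qed.

Lemma Ex_ge0 f : (forall x, 0 <= f x) -> 0 <= Ex f.
Proof. by move=> f0; apply: Rintegral_ge0. Qed.

Lemma normr_Ex f : mom f -> `|Ex f| <= Ex (fun x => `|f x|).
Proof. by move=> mf; apply: le_normr_Rintegral => //; exact: mom_integrable. Qed.

Lemma EFin_Ex f : mom f -> (Ex f)%:E = (\int[P]_x (f x)%:E)%E.
Proof.
by move=> mf; rewrite /Ex /Rintegral fineK//; apply: integrable_fin_num => //; exact: mom_integrable.
Qed.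

End Mom.

(** Recursion on the shape of the integrand, with leaves closed by hypotheses in context. This is
    why the proofs below first bring the [mom] facts of all atoms into the context. *)
Ltac mom1 :=
  lazymatch goal with
  | |- mom _ (fun x => @?f x - @?g x) => apply: momB
  | |- mom _ (fun x => @?f x + @?g x) => apply: momD
  | |- mom _ (fun x => - (@?f x)) => apply: momN
  | |- mom _ (fun x => @?f x * @?g x) => apply: momM
  | |- mom _ (fun x => (@?f x) ^+ _) => apply: momX
  | |- mom _ (fun x => `|(@?f x)|) => apply: mom_norm
  | |- mom _ (fun x => \sum_(i <- ?r | @?A x i) (@?F x i)) => apply: mom_sum
  | |- mom _ (fun x => ?c) => exact: mom_cst
  | |- mom _ (cst _) => exact: mom_cst
  end.
Ltac mom_tac := repeat (first [solve [auto] | mom1; intros]).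

Section Image.
Context d d' (T : measurableType d) (T' : measurableType d') (R : realType).
Variables (P : probability T R) (f : T -> T') (mf : measurable_fun setT f).

(** The pushforward under a name that can carry a probability structure: the joint laws below are
    images, and their expectations are computed by pulling back. *)
Definition pimage : set T' -> \bar R := pushforward P f.

Let pimage0 : pimage set0 = 0%E.
Proof. by rewrite /pimage /pushforward preimage_set0 measure0. Qed.

Let pimage_ge0 A : (0 <= pimage A)%E. Proof. exact: measure_ge0. Qed.

Let pimage_sigma_additive : semi_sigma_additive pimage.
Proof. exact: (@measure_semi_sigma_additive _ _ _
  (measure_function_pushforward__canonical__measure_function_Measure P mf)). Qed.

HB.instance Definition _ := isMeasure.Build _ _ _ pimage
  pimage0 pimage_ge0 pimage_sigma_additive.

Let pimage_setT : pimage setT = 1%E.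
Proof. by rewrite /pimage /pushforward preimage_setT probability_setT. Qed.

HB.instance Definition _ := Measure_isProbability.Build _ _ _ pimage pimage_setT.

Definition image_prob : probability T' R := pimage.

Lemma ge0_integral_image (g : T' -> \bar R) : measurable_fun setT g ->
  (forall x, 0 <= g x)%E -> (\int[image_prob]_y g y = \int[P]_x g (f x))%E.
Proof. by move=> mg g0; rewrite /image_prob/= ge0_integral_pushforward. Qed.

Lemma mom_image (g : T' -> R) : measurable_fun setT g ->
  mom P (fun x => g (f x)) -> mom image_prob g.
Proof.
move=> mg [_ H]; split => // k; rewrite /image_prob/=.
apply: (integrable_pushforward mf) => //; last exact: H.
by apply/measurable_EFinP/measurable_funX; exact: measurableT_comp.
Qed.

Lemma mom_imageP (g : T' -> R) : mom image_prob g -> mom P (fun x => g (f x)).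
Proof.
move=> [mg H]; split; first exact: measurableT_comp.
move=> k; have := H k; move=> /integrableP[m1 i1]; apply/integrableP; split.
  exact: (measurableT_comp m1).
apply: le_lt_trans i1; rewrite ge0_integral_image//.
exact: measurableT_comp.
Qed.

Lemma Ex_image (g : T' -> R) : mom image_prob g -> Ex image_prob g = Ex P (fun x => g (f x)).
Proof.
move=> mg; rewrite /Ex /Rintegral /image_prob/= integral_pushforward//.
- exact/measurable_EFinP/(mom_meas mg).
- exact: (mom_integrable (mom_imageP mg)).
Qed.

End Image.

Section Normal1.
Context {R : realType}.
Notation lam := (@lebesgue_measure R).
Implicit Types (m s c e x : R).
Implicit Types f : measurableTypeR R -> R.

(** Cameron-Martin formula on the line: the weight is the ratio of the densities of the shifted and
    the centred normal law. Taken over all coordinates it becomes the likelihood. *)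
Lemma ge0_integral_normal_shift s c (f : measurableTypeR R -> \bar R) :
  0 < s -> measurable_fun setT f -> (forall x, 0 <= f x)%E ->
  (\int[normal_prob 0 s]_x f (x + c)%R =
   \int[normal_prob 0 s]_x (f x * (expR (x * c / s ^+ 2 - c ^+ 2 / (s ^+ 2 *+ 2)))%:E))%E.
Proof.
move=> s0 mf f0.
have -> : (\int[normal_prob 0 s]_x f (x + c)%R = \int[normal_prob c s]_x f x)%E.
  have := ge0_integral_normal_affine 0 c s0 ltr01 mf f0.
  rewrite mulr0 add0r mul1r => <-.
  by apply: eq_integral => x _; rewrite mul1r.
have me : measurable_fun setT (fun x : measurableTypeR R =>
   (f x * (expR (x * c / s ^+ 2 - c ^+ 2 / (s ^+ 2 *+ 2)))%:E)%E).
  apply: emeasurable_funM; first exact: mf.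
  apply/measurable_EFinP/measurableT_comp => //.
  by apply: measurable_funB => //; do 2 apply: measurable_funM => //.
have e0 x : (0 <= f x * (expR (x * c / s ^+ 2 - c ^+ 2 / (s ^+ 2 *+ 2)))%:E)%E.
  by rewrite mule_ge0// lee_fin expR_ge0.
rewrite (ge0_integral_normal c s mf f0) (ge0_integral_normal 0 s me e0).
apply: eq_integral => x _; rewrite -muleA -EFinM; congr (_ * _%:E)%E.
rewrite !normal_pdf_gt0E// mulrCA -expRD; congr (_ * expR _).
by field; rewrite gt_eqF.
Qed.

Lemma ge0_integral_normal_conv s (c1 c2 : R) (f : measurableTypeR R -> \bar R) :
  0 < s -> 0 < c2 -> c1 ^+ 2 + c2 ^+ 2 = 1 ->
  measurable_fun setT f -> (forall x, 0 <= f x)%E ->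
  (\int[normal_prob 0 s]_x \int[normal_prob 0 s]_y f (c1 * x + c2 * y)%R =
   \int[normal_prob 0 s]_x f x)%E.
Proof.
move=> s0 c20 c12 mf f0.
have c2s : 0 < c2 * s by rewrite mulr_gt0.
have inner x : (\int[normal_prob 0 s]_y f (c1 * x + c2 * y)%R =
    \int[lam]_z (f z * (normal_pdf (c1 * x) (c2 * s) z)%:E))%E.
  rewrite -(ge0_integral_normal _ _ mf f0).
  have := ge0_integral_normal_affine 0 (c1 * x) s0 c20 mf f0.
  rewrite mulr0 add0r => <-.
  by apply: eq_integral => y _; rewrite addrC.
under eq_integral do rewrite inner.
pose K (x z : R) := expR (- (z - c1 * x) ^+ 2 / ((c2 * s) ^+ 2 *+ 2)).
pose cK : R := (c2 * s * Num.sqrt (pi *+ 2))^-1.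
have cK0 : 0 <= cK by rewrite invr_ge0 mulr_ge0// ltW.
have pdfK x z : normal_pdf (c1 * x) (c2 * s) z = cK * K x z.
  by rewrite normal_pdf_gt0E.
have mK : measurable_fun setT (fun p : measurableTypeR R * measurableTypeR R =>
    (f p.2 * (normal_pdf (c1 * p.1) (c2 * s) p.2)%:E)%E).
  apply: emeasurable_funM; first exact: (measurableT_comp mf).
  under [X in measurable_fun _ X]eq_fun do rewrite pdfK.
  apply/measurable_EFinP/measurable_funM => //.
  apply: measurableT_comp => //; apply: measurable_funM => //.
  apply: measurableT_comp => //; apply: measurable_funX.
  apply: measurable_funB; first exact: measurable_snd.
  by apply: measurable_funM => //; exact: measurable_fst.
have K0 p : (0 <= f p.2 * (normal_pdf (c1 * p.1) (c2 * s) p.2)%:E)%E.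
  by rewrite mule_ge0// lee_fin normal_pdf_ge0.
transitivity (\int[lam]_z \int[normal_prob 0 s]_x
    (f z * (normal_pdf (c1 * x) (c2 * s) z)%:E))%E.
  exact: (@fubini_tonelli _ _ _ _ _ (normal_prob 0 s) lam
    (fun p => (f p.2 * (normal_pdf (c1 * p.1) (c2 * s) p.2)%:E)%E) mK K0).
rewrite (ge0_integral_normal 0 s mf f0).
apply: eq_integral => z _.
have mz : measurable_fun setT (fun x : measurableTypeR R =>
   (normal_pdf (c1 * x) (c2 * s) z)%:E).
  under eq_fun do rewrite pdfK.
  apply/measurable_EFinP/measurable_funM => //.
  apply: measurableT_comp => //; apply: measurable_funM => //.
  apply: measurableT_comp => //; apply: measurable_funX.
  by apply: measurable_funB => //; apply: measurable_funM.
have z0 x : (0 <= (normal_pdf (c1 * x) (c2 * s) z)%:E)%E.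
  by rewrite lee_fin normal_pdf_ge0.
rewrite ge0_integralZl//; congr (_ * _)%E.
rewrite (ge0_integral_normal 0 s mz z0).
(* Completing the square exchanges the roles of the variables: given z, the law of x is normal with
   mean [c1 * z] and deviation [c2 * s]. *)
transitivity (\int[lam]_x ((normal_pdf 0 s z)%:E * (normal_pdf (c1 * z) (c2 * s) x)%:E))%E.
  apply: eq_integral => x _; rewrite -!EFinM; congr EFin.
  rewrite !normal_pdf_gt0E//; rewrite mulrACA -expRD [RHS]mulrACA -expRD (mulrC (_^-1)).
  have c2E : c2 ^+ 2 = 1 - c1 ^+ 2 by rewrite -c12 addrC addKr.
  have E (a b : R) : (a - c1 * b) ^+ 2 = a ^+ 2 + b ^+ 2 - 2 * c1 * a * b - c2 ^+ 2 * b ^+ 2.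
    by rewrite c2E; ring.
  congr (_ * expR _); rewrite !E; field.
  by rewrite !gt_eqF.
rewrite ge0_integralZl//; last 3 first.
- by apply/measurable_EFinP; exact: measurable_normal_pdf.
- by move=> x _; rewrite lee_fin normal_pdf_ge0.
- by rewrite lee_fin normal_pdf_ge0.
by rewrite integral_normal_pdf ?mule1// gt_eqF.
Qed.

Lemma integrable_normal m s f : measurable_fun setT f ->
  lam.-integrable setT (fun x => (f x * normal_pdf m s x)%:E) ->
  (normal_prob m s).-integrable setT (EFin \o f).
Proof.
move=> mf /integrableP[_ fi]; apply/integrableP; split; first exact/measurable_EFinP.
apply: le_lt_trans fi.
have mf' : measurable_fun setT (fun x => `|(f x)%:E|%E).
  by do 2 apply: measurableT_comp => //.
have f0 x : (0 <= `|(f x)%:E|)%E by [].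
have -> := ge0_integral_normal m s mf' f0.
rewrite le_eqVlt; apply/orP; left; apply/eqP.
apply: eq_integral => x _.
by rewrite -EFinM /= normrM (ger0_norm (normal_pdf_ge0 _ _ _)).
Qed.

Lemma integral_normal m s f : measurable_fun setT f ->
  (\int[normal_prob m s]_x (f x)%:E = \int[lam]_x (f x * normal_pdf m s x)%:E)%E.
Proof.
move=> mf.
have mfE : measurable_fun setT (EFin \o f) by exact/measurable_EFinP.
have mfp := measurable_funepos mfE.
have mfn := measurable_funeneg mfE.
rewrite integralE [RHS]integralE.
have H1 x : (0 <= (EFin \o f)^\+ x)%E by exact: funepos_ge0.
have H2 x : (0 <= (EFin \o f)^\- x)%E by exact: funeneg_ge0.
rewrite (ge0_integral_normal m s mfp H1) (ge0_integral_normal m s mfn H2).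
congr (_ - _)%E; apply: eq_integral => x _.
- rewrite !funeposE /= -!EFin_max -EFinM; congr EFin.
  by rewrite maxr_pMl ?normal_pdf_ge0// mul0r.
- rewrite !funenegE /= -!EFin_max -EFinM; congr EFin.
  by rewrite maxr_pMl ?normal_pdf_ge0// mul0r mulNr.
Qed.

(** From [t / k <= expR (t / k)], raised to the power k. *)
Lemma le_expn_expR k (t : R) : 0 <= t -> t ^+ k <= k%:R ^+ k * expR t.
Proof.
case: k => [|k] t0; first by rewrite !expr0 mul1r -expR0 ler_expR.
have k0 : 0 < k.+1%:R :> R by rewrite ltr0n.
rewrite -[t in expR t](mulfVK (lt0r_neq0 k0)) expRM_natr -exprMn.
rewrite lerXn2r ?nnegrE ?mulr_ge0 ?expR_ge0//.
rewrite -ler_pdivrMl// mulrC.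
by rewrite (le_trans _ (expR_ge1Dx _))// lerDr.
Qed.

Lemma mom_normal_id m s : 0 < s -> mom (normal_prob m s) (fun x => x).
Proof.
move=> s0.
have -> : (fun x : R => x) = (fun x => (x - m) + m) by apply/funext => x; rewrite subrK.
apply: momD; last exact: mom_cst.
have mxm : measurable_fun setT (fun x : measurableTypeR R => x - m).
  by apply: measurable_funB.
split => // k.
(* The exponent grows half as fast as that of the normal density decays: up to the factor [sqrt 2],
   the product with the density is the normal density of deviation [sqrt 2 * s]. *)
pose g (x : R) := 1 + (4 * s ^+ 2) ^+ k * k%:R ^+ k * expR ((x - m) ^+ 2 / (4 * s ^+ 2)).
have s2 : 0 < Num.sqrt 2 * s by rewrite mulr_gt0.
have ig : (normal_prob m s).-integrable setT (EFin \o g).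
  have -> : EFin \o g = (fun x => (cst 1%:E x + ((4 * s ^+ 2) ^+ k * k%:R ^+ k)%:E *
      (expR ((x - m) ^+ 2 / (4 * s ^+ 2)))%:E)%E) by apply/funext.
  apply: integrableD => //.
    exact: finite_measure_integrable_cst.
  apply: integrableZl => //; apply: integrable_normal.
    apply: measurableT_comp => //; apply: measurable_funM => //.
    exact: measurable_funX.
  have -> : (fun x => (expR ((x - m) ^+ 2 / (4 * s ^+ 2)) * normal_pdf m s x)%:E) =
     (fun x => (Num.sqrt 2)%:E * (normal_pdf m (Num.sqrt 2 * s) x)%:E)%E.
    apply/funext => x; rewrite -EFinM; congr EFin.
    rewrite !normal_pdf_gt0E// mulrCA -expRD exprMn sqr_sqrtr//.
    have -> : (Num.sqrt 2 * s * Num.sqrt (pi *+ 2))^-1 =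
        (Num.sqrt 2)^-1 * (s * Num.sqrt (pi *+ 2))^-1 :> R by rewrite -mulrA invfM.
    rewrite !mulrA divff ?mul1r ?gt_eqF ?sqrtr_gt0//; congr (_ * expR _).
    by field; rewrite gt_eqF.
  by apply: integrableZl => //; exact: integrable_normal_pdf.
apply: le_integrable ig => //.
  apply/measurable_EFinP/measurable_funX/measurableT_comp => //.
move=> x _; rewrite /= lee_fin normrX normr_id [leRHS]ger0_norm; last first.
  by rewrite addr_ge0// !mulr_ge0 ?exprn_ge0 ?mulr_ge0 ?exprn_ge0 ?expR_ge0// ltW.
apply: (@le_trans _ _ (1 + (`|x - m| ^+ k) ^+ 2)).
  by set a := _ ^+ k; nra.
rewrite lerD2l -exprM mulnC exprM -normrX ger0_norm ?sqr_ge0//.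
have s4 : 0 < 4 * s ^+ 2 by rewrite mulr_gt0// exprn_gt0.
rewrite -{1}[(x - m) ^+ 2](mulfVK (lt0r_neq0 s4)) exprMn mulrC -mulrA.
apply: ler_wpM2l; first by rewrite exprn_ge0// ltW.
by apply: le_expn_expR; rewrite divr_ge0 ?sqr_ge0// ltW.
Qed.

End Normal1.

(** * Gaussian integration by parts on the line *)

Section Stein.
Context {R : realType}.
Notation lam := (@lebesgue_measure R).
Variables (m s : R) (F F' : R -> R).
Hypothesis s0 : 0 < s.
Hypothesis dF : forall x : R, is_derive x 1 F (F' x).
Hypothesis cF' : continuous F'.
Notation P := (normal_prob m s).

Let cF : continuous F.
Proof.
move=> x; apply/differentiable_continuous/derivable1_diffP.
by have := dF x.
Qed.

(** [k t] times the density is the derivative of F times the cutoff [1 - t^2 (x - m)^2] times the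
    density. The cutoff vanishes at [m - 1/t] and [m + 1/t], so the fundamental theorem of calculus
    on this interval leaves no boundary term, whatever the growth of F. *)
Let k (t x : R) := F' x * (1 - t ^+ 2 * (x - m) ^+ 2) - 2 * F x * (t ^+ 2 * (x - m))
  - F x * (1 - t ^+ 2 * (x - m) ^+ 2) * ((x - m) / s ^+ 2).

Let dpdf x : is_derive (x : R) 1 (normal_pdf m s) (- ((x - m) / s ^+ 2) * normal_pdf m s x).
Proof.
have -> : normal_pdf m s = (fun x => (s * Num.sqrt (pi *+ 2))^-1 * expR (- (x - m) ^+ 2 / (s ^+ 2 *+ 2))).
  by apply/funext => y; exact: normal_pdf_gt0E.
have d1 : is_derive x 1 (fun x : R => - (x - m) ^+ 2 / (s ^+ 2 *+ 2)) (- ((x - m) / s ^+ 2)).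
  have d0 : is_derive x 1 (fun x : R => x - m) 1.
    by rewrite -[X in is_derive _ _ _ X]subr0; apply: is_deriveB.
  have -> : (fun x : R => - (x - m) ^+ 2 / (s ^+ 2 *+ 2)) =
    (fun x => (- (s ^+ 2 *+ 2)^-1) *: ((x - m) * (x - m))).
    by apply/funext => y; rewrite /GRing.scale/= expr2 mulrC mulrN mulNr.
  have d2 : is_derive x 1 (fun x : R => (x - m) * (x - m)) ((x - m) *: 1 + (x - m) *: 1).
    exact: (is_deriveM d0 d0).
  apply: is_derive_eq (is_deriveZ _ d2) _.
  by rewrite /GRing.scale/=; field; rewrite gt_eqF.
have d2 : is_derive x 1 (fun x : R => expR (- (x - m) ^+ 2 / (s ^+ 2 *+ 2)))
   (- ((x - m) / s ^+ 2) * expR (- (x - m) ^+ 2 / (s ^+ 2 *+ 2))).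
  have d3 := is_derive_expR (- (x - m) ^+ 2 / (s ^+ 2 *+ 2)).
  pose q (x : R) := - (x - m) ^+ 2 / (s ^+ 2 *+ 2).
  change (is_derive x 1 (expR \o q) (- ((x - m) / s ^+ 2) * expR (q x))).
  have d4 := @is_derive1_comp _ _ q _ _ _ d3 d1.
  by apply: is_derive_eq d4 _; rewrite mulrC.
apply: is_derive_eq (is_deriveZ (s * Num.sqrt (pi *+ 2))^-1 d2) _.
by rewrite /GRing.scale/= mulrCA.
Qed.

Let stein_cutoff (t : R) : 0 < t ->
  (\int[lam]_(x in `[(m - t^-1)%R, (m + t^-1)%R]) (k t x * normal_pdf m s x)%:E = 0)%E.
Proof.
move=> t0.
pose H (x : R) := F x * (1 - t ^+ 2 * (x - m) ^+ 2) * normal_pdf m s x.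
have dH (x : R) : is_derive (x : R) 1 H (k t x * normal_pdf m s x).
  have d0 : is_derive x 1 (fun x : R => x - m) 1.
    by rewrite -[X in is_derive _ _ _ X]subr0; apply: is_deriveB.
  have d1 : is_derive x 1 (fun x : R => 1 - t ^+ 2 * (x - m) ^+ 2) (- 2 * t ^+ 2 * (x - m)).
    have -> : (fun x : R => 1 - t ^+ 2 * (x - m) ^+ 2) =
       (fun x : R => 1 - t ^+ 2 *: ((x - m) * (x - m))) by apply/funext => y; rewrite expr2.
    apply: is_derive_eq (is_deriveB (is_derive_cst (1 : R^o) x 1) (is_deriveZ _ (is_deriveM d0 d0))) _.
    change (0 - t ^+ 2 * ((x - m) * 1 + (x - m) * 1) = - 2 * t ^+ 2 * (x - m) :> R).
    by ring.
  apply: is_derive_eq (is_deriveM (is_deriveM (dF x) d1) (dpdf x)) _.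
  set q := 1 - t ^+ 2 * (x - m) ^+ 2; set p := normal_pdf m s x.
  change (F x * q * (- ((x - m) / s ^+ 2) * p) +
    p * (F x * (- 2 * t ^+ 2 * (x - m)) + q * F' x) = k t x * p :> R).
  by rewrite /k -/q; ring.
have cpdf : continuous (normal_pdf m s) by apply: continuous_normal_pdf; rewrite gt_eqF.
have cxm : continuous (fun x : R => x - m).
  by move=> x; apply: cvgB; [exact: cvg_id|exact: cvg_cst].
have cq : continuous (fun x : R => 1 - t ^+ 2 * (x - m) ^+ 2).
  move=> x; apply: cvgB; first exact: cvg_cst.
  apply: cvgM; first exact: cvg_cst.
  rewrite expr2; under eq_fun do rewrite expr2.
  by apply: cvgM; exact: cxm.
have ck : continuous (fun x => k t x * normal_pdf m s x).
  move=> x; apply: cvgM; last exact: cpdf.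
  apply: cvgB; [apply: cvgB|].
  - by apply: cvgM; [exact: cF'|exact: cq].
  - apply: cvgM; first by apply: cvgM; [exact: cvg_cst|exact: cF].
    by apply: cvgM; [exact: cvg_cst|exact: cxm].
  - apply: cvgM; first by apply: cvgM; [exact: cF|exact: cq].
    by apply: cvgM; [exact: cxm|exact: cvg_cst].
have cH : continuous H.
  move=> x; apply: cvgM; last exact: cpdf.
  by apply: cvgM; [exact: cF|exact: cq].
have ab : m - t^-1 < m + t^-1.
  by rewrite ltrBlDr -addrA ltrDl addr_gt0// invr_gt0.
rewrite (@continuous_FTC2 _ _ H _ _ ab).
- have tE (a : R) : a = t^-1 \/ a = - t^-1 -> 1 - t ^+ 2 * a ^+ 2 = 0.
    by case=> ->; rewrite ?sqrrN exprVn divff ?subrr// expf_neq0// gt_eqF.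
  rewrite /H (_ : m + t^-1 - m = t^-1); last by rewrite addrC addKr.
  rewrite (_ : m - t^-1 - m = - t^-1); last by rewrite addrC addKr.
  by rewrite !tE; [rewrite !mulr0 !mul0r subee|right|left].
- exact: continuous_subspaceT.
- split => [x _||]; first by have := dH x.
    by apply: cvg_at_right_filter; exact: cH.
  by apply: cvg_at_left_filter; exact: cH.
- by move=> x _; rewrite derive1E; have [] := dH x.
Qed.

Hypothesis iF : P.-integrable setT (EFin \o F).
Hypothesis ixF : P.-integrable setT (fun x => ((x - m) * F x)%:E).
Hypothesis iF' : P.-integrable setT (EFin \o F').

Lemma normal_stein :
  \int[P]_x ((x - m) * F x) = s ^+ 2 * \int[P]_x F' x.
Proof.
have mF : measurable_fun setT F by exact: continuous_measurable_fun.
have mF' : measurable_fun setT F' by exact: continuous_measurable_fun.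
pose T (x : R) := F' x - (x - m) * F x / s ^+ 2.
pose f n (x : R) := k n.+1%:R^-1 x * \1_(`[m - n.+1%:R, m + n.+1%:R]) x.
(* Dominates every [f n]: on the support [t |x - m| <= 1], so the cutoff lies between 0 and 1, and
   [t^2 |x - m| <= 1] because [t <= 1]. *)
pose g (x : R) := `|F' x| + 2 * `|F x| + `|(x - m) * F x| / s ^+ 2.
have mk t : measurable_fun setT (k t).
  apply: measurable_funB; [apply: measurable_funB|].
  - apply: measurable_funM => //; apply: measurable_funB => //.
    by apply: measurable_funM => //; apply: measurable_funX; apply: measurable_funB.
  - by apply: measurable_funM; [apply: measurable_funM|apply: measurable_funM => //; apply: measurable_funB].
  - apply: measurable_funM => //; last by apply: measurable_funM => //; apply: measurable_funB.
    apply: measurable_funM => //; apply: measurable_funB => //.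
    by apply: measurable_funM => //; apply: measurable_funX; apply: measurable_funB.
have mf n : measurable_fun setT (f n).
  by apply: measurable_funM => //; exact: measurable_indic.
have iT : P.-integrable setT (EFin \o T).
  have := integrableB measurableT iF' (integrableZl measurableT (s ^+ 2)^-1 ixF).
  by apply: eq_integrable => // x _; rewrite /= /T (mulrC _ (s ^+ 2)^-1).
have T0 : (\int[P]_x (T x)%:E = 0)%E.
  have [] := @dominated_convergence _ _ _ P setT measurableT
    (fun n => EFin \o f n) (EFin \o T) (EFin \o g).
  - by move=> n; apply/measurable_EFinP; exact: mf.
  - exact: measurable_int iT.
  - apply: aeW => x _; apply/cvg_EFin; first exact: nearW.
    have cinv : (fun n => n.+1%:R^-1 : R) @ \oo --> (0 : R) by exact: cvg_harmonic.
    have ck : (fun n => k n.+1%:R^-1 x) @ \oo --> T x.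
      have -> : T x = F' x * (1 - 0 * 0 * (x - m) ^+ 2) - 2 * F x * (0 * 0 * (x - m))
        - F x * (1 - 0 * 0 * (x - m) ^+ 2) * ((x - m) / s ^+ 2).
        by rewrite /T; field; rewrite gt_eqF.
      have c2 : (fun n => n.+1%:R^-1 * n.+1%:R^-1 : R) @ \oo --> (0 * 0 : R) by exact: cvgM.
      rewrite /k; under eq_fun do rewrite expr2.
      have c1 : (fun n => 1 - n.+1%:R^-1 * n.+1%:R^-1 * (x - m) ^+ 2 : R) @ \oo --> 1 - 0 * 0 * (x - m) ^+ 2.
        by apply: cvgB; [exact: cvg_cst|apply: cvgM => //; exact: cvg_cst].
      apply: cvgB; [apply: cvgB|].
      - by apply: cvgM => //; exact: cvg_cst.
      - by apply: cvgM; [exact: cvg_cst|apply: cvgM => //; exact: cvg_cst].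
      - by apply: cvgM; [apply: cvgM => //; exact: cvg_cst|exact: cvg_cst].
    apply: cvg_trans ck; apply: near_eq_cvg.
    near=> n; rewrite /f /= indicE mem_set ?mulr1//= in_itv/= lerBlDl -lerBlDr lerBlDl.
    have : `|x - m| <= n.+1%:R.
      by rewrite (@le_trans _ _ n%:R) ?ler_nat//; near: n; exact: nbhs_infty_ger.
    by rewrite ler_norml => /andP[H1 H2]; apply/andP; split; lra.
  - have := integrableD measurableT (integrableD measurableT (integrable_norm iF')
      (integrableZl measurableT 2 (integrable_norm iF)))
      (integrableZl measurableT (s ^+ 2)^-1 (integrable_norm ixF)).
    by apply: eq_integrable => // x _; rewrite /= /g (mulrC _ (s ^+ 2)^-1).
  - apply: aeW => x n _; rewrite /= lee_fin /f indicE.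
    have s20 : 0 < s ^+ 2 by rewrite exprn_gt0.
    case: (boolP (x \in _)) => [|_]; last first.
      rewrite mulr0 normr0 /g; apply: addr_ge0; last by apply: divr_ge0 => //; exact: ltW.
      by apply: addr_ge0 => //; exact: mulr_ge0.
    rewrite inE /= in_itv/= mulr1 => /andP[x1 x2].
    have n0 : 0 < n.+1%:R :> R by rewrite ltr0n.
    set t : R := n.+1%:R^-1.
    have t0 : 0 <= t by rewrite invr_ge0 ltW.
    have t1 : t <= 1 by rewrite invf_le1// ler1n.
    have tx : t * `|x - m| <= 1.
      by rewrite ler_pdivrMl// mulr1 ler_norml; apply/andP; split; lra.
    have tx2 : 0 <= 1 - t ^+ 2 * (x - m) ^+ 2 <= 1.
      have -> : t ^+ 2 * (x - m) ^+ 2 = (t * `|x - m|) ^+ 2 by rewrite exprMn real_normK ?num_real.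
      have := mulr_ge0 t0 (normr_ge0 (x - m)); move: tx; set a := t * _ => a1 a0.
      by apply/andP; split; nra.
    have -> : k t x = F' x * (1 - t ^+ 2 * (x - m) ^+ 2) - 2 * F x * (t * (t * (x - m)))
        - ((x - m) * F x) / s ^+ 2 * (1 - t ^+ 2 * (x - m) ^+ 2).
      by rewrite /k; field; rewrite gt_eqF.
    have nq : `|1 - t ^+ 2 * (x - m) ^+ 2| <= 1 by case/andP: tx2 => q0 q1; rewrite ger0_norm.
    apply: (le_trans (ler_normB _ _)); apply: lerD.
      apply: (le_trans (ler_normB _ _)); apply: lerD.
        by rewrite normrM ler_piMr.
      rewrite !normrM (ger0_norm (ler0n _ 2)) -[leRHS]mulr1 ler_wpM2l ?mulr_ge0//.
      rewrite (ger0_norm t0) -[leRHS]mulr1; apply: ler_pM => //.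
      by rewrite mulr_ge0.
    by rewrite normrM normf_div (gtr0_norm s20) ler_piMr// divr_ge0// ltW.
  move=> _ _ cv.
  have z n : (\int[P]_x (f n x)%:E = 0)%E.
    rewrite (integral_normal m s (mf n)).
    have n0 : 0 < n.+1%:R^-1 :> R by rewrite invr_gt0 ltr0n.
    have := stein_cutoff n0; rewrite invrK integral_mkcond => H0.
    rewrite -[RHS]H0; apply: eq_integral => x _.
    by rewrite patchE /f indicE; case: ifPn => _; rewrite ?mulr1// mulr0 mul0r.
  move: cv; under eq_fun do rewrite z.
  by move=> /(cvg_lim (@ereal_hausdorff R)) <-; rewrite lim_cst//; exact: ereal_hausdorff.
have E : \int[P]_x (T x) = \int[P]_x (F' x) - (\int[P]_x ((x - m) * F x)) / s ^+ 2.
  rewrite /T RintegralB//; last first.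
    have := integrableZl measurableT (s ^+ 2)^-1 ixF.
    by apply: eq_integrable => // x _; rewrite /= (mulrC _ (s ^+ 2)^-1).
  by rewrite RintegralZr.
have : \int[P]_x (T x) = 0 by rewrite /Rintegral T0.
rewrite E => /eqP; rewrite subr_eq0 => /eqP ->.
by field; rewrite gt_eqF.
Unshelve. all: by end_near.
Qed.

End Stein.

(** * Gaussian sequences *)

Section IntegralAnyFun.
Local Open Scope ereal_scope.
Context d (T : measurableType d) (R : realType).
Variable mu : {measure set T -> \bar R}.
Implicit Types f g : T -> \bar R.

Import HBNNSimple.

(* The library versions ask for measurability, which is not known for the inner stages of an iterated integral. *)
Lemma ge0_ae_le_integral_any f g : (forall x, 0 <= f x) -> (forall x, 0 <= g x) ->
  {ae mu, forall x, f x <= g x} -> \int[mu]_x f x <= \int[mu]_x g x.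
Proof.
move=> f0 g0 [N [mN N0 subN]].
rewrite (ge0_integralTE _ f0) (ge0_integralTE _ g0).
apply: ge_ereal_sup => _ [h hf <-].
have mNC : measurable (~` N) by exact: measurableC.
(* Setting the simple function [h] to 0 on the null set puts it below [g] everywhere and keeps its
   integral. *)
apply: le_trans; last first.
  apply: ereal_sup_ubound; exists (proj_nnsfun h mNC) => //.
  move=> x /=; rewrite mindicE.
  case: (boolP (x \in ~` N)) => xN; last by rewrite mulr0.
  rewrite mulr1; apply: (le_trans (hf x)); move: xN; rewrite inE => xN.
  by apply: contrapT => fg; apply: xN; exact: subN.
rewrite -!integralT_nnsfun le_eqVlt; apply/orP; left; apply/eqP.
apply: ge0_ae_eq_integral => //.
- exact/measurable_EFinP.
- exact/measurable_EFinP.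
- by move=> x _; rewrite lee_fin.
- by move=> x _; rewrite lee_fin.
exists N; split => // x /= H; apply: contrapT => xN; apply: H => _.
by rewrite mindicE mem_set// mulr1.
Qed.

Lemma ae_eq_integral_any f g :
  {ae mu, forall x, f x = g x} -> \int[mu]_x f x = \int[mu]_x g x.
Proof.
move=> fg; rewrite integralE [RHS]integralE; congr (_ - _); apply/eqP; rewrite eq_le;
  apply/andP; split; apply: ge0_ae_le_integral_any => //;
  by apply: filterS fg => x; rewrite ?funeposE ?funenegE => ->.
Qed.

End IntegralAnyFun.

(** A copy of [nat -> R] that carries the product sigma-algebra, so that the integrands of
    [gauss_iter] become functions on a measurable space. *)
Definition seqR (R : realType) : Type := nat -> R.

Section SeqR.
Context {R : realType}.

HB.instance Definition _ := gen_eqMixin (seqR R).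
HB.instance Definition _ := gen_choiceMixin (seqR R).
HB.instance Definition _ := isPointed.Build (seqR R) (fun _ => 0).

Definition seq_cylinders : set (set (seqR R)) :=
  [set A | exists i (B : set (measurableTypeR R)), measurable B /\ A = (fun v : seqR R => v i) @^-1` B].

Let seq0 : <<s seq_cylinders >> set0. Proof. exact: sigma_algebra0. Qed.
Let seqC A : <<s seq_cylinders >> A -> <<s seq_cylinders >> (~` A).
Proof. exact: sigma_algebraC. Qed.
Let seqU (F : _^nat) : (forall i, <<s seq_cylinders >> (F i)) ->
  <<s seq_cylinders >> (\bigcup_i F i).
Proof. exact: sigma_algebra_bigcup. Qed.

HB.instance Definition _ := @isMeasurable.Build default_measure_display
  (seqR R) <<s seq_cylinders >> seq0 seqC seqU.

Lemma measurable_coord i : measurable_fun setT (fun v : seqR R => v i : measurableTypeR R).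
Proof.
by move=> _ B mB; rewrite setTI; apply: sub_sigma_algebra; exists i, B.
Qed.

Lemma measurable_seqP d (T : measurableType d) (f : T -> seqR R) :
  (forall i, measurable_fun setT (fun x => f x i : measurableTypeR R)) -> measurable_fun setT f.
Proof.
move=> mf _ A mA; rewrite setTI.
have : <<s seq_cylinders >> `<=` [set A | measurable (f @^-1` A)].
  apply: smallest_sub => [|_ [i [B [mB ->]]]] /=.
    split => /=; first by rewrite preimage_set0.
    - by move=> B mB; rewrite setTD; rewrite -preimage_setC; exact: measurableC.
    - by move=> F mF; rewrite preimage_bigcup; exact: bigcup_measurable.
  by have := mf i measurableT B mB; rewrite setTI.
by apply.
Qed.

(** Convertible to the update inside [gauss_iter], so that the induction hypothesis of
    [gauss_iter_ae] applies directly. *)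
Definition upd k (p : seqR R * R) : seqR R := fun i => if i == k then p.2 else p.1 i.

Lemma measurable_upd k :
  measurable_fun setT (upd k : seqR R * measurableTypeR R -> seqR R).
Proof.
apply: measurable_seqP => i; rewrite /upd; case: (i == k); first exact: measurable_snd.
exact: (measurableT_comp (@measurable_coord i)).
Qed.

(** Follows the recursion of [gauss_iter]; the coordinates from [n] on stay 0. *)
Fixpoint gs (n : nat) (mean sd : nat -> R) : probability (seqR R) R :=
  match n with
  | 0 => \d_ ((fun _ => 0) : seqR R)
  | k.+1 => image_prob (gs k mean sd \x normal_prob (mean k) (sd k))%E (@measurable_upd k)
  end.

Variables mean sd : nat -> R.

Notation G n := (gs n mean sd).
Notation N k := (normal_prob (mean k) (sd k)).

Lemma ge0_integral_gsS n (f : seqR R -> \bar R) :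
  measurable_fun setT f -> (forall v, 0 <= f v)%E ->
  (\int[G n.+1]_v f v = \int[G n]_v \int[N n]_x f (upd n (v, x)))%E.
Proof.
move=> mf f0.
transitivity (\int[(G n \x N n)%E]_p f (upd n p))%E.
  exact: (ge0_integral_image _ (@measurable_upd n) mf f0).
exact: (@fubini_tonelli1 _ _ _ _ _ (G n) (N n) (f \o upd n)
  (measurableT_comp mf (@measurable_upd n)) (fun p => f0 _)).
Qed.

Lemma ge0_integral_gsS2 n (f : seqR R -> \bar R) :
  measurable_fun setT f -> (forall v, 0 <= f v)%E ->
  (\int[G n.+1]_v f v = \int[N n]_x \int[G n]_v f (upd n (v, x)))%E.
Proof.
move=> mf f0.
transitivity (\int[(G n \x N n)%E]_p f (upd n p))%E.
  exact: (ge0_integral_image _ (@measurable_upd n) mf f0).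
exact: (@fubini_tonelli2 _ _ _ _ _ (G n) (N n) (f \o upd n)
  (measurableT_comp mf (@measurable_upd n)) (fun p => f0 _)).
Qed.

Lemma updC k n v x y : k != n ->
  upd k (upd n (v, y), x) = upd n (upd k (v, x), y).
Proof.
move=> kn; apply/funext => i; rewrite /upd/=.
by case: (eqVneq i k) => [->|//]; rewrite (negbTE kn).
Qed.

Lemma updK n v x y : upd n (upd n (v, y), x) = upd n (v, x).
Proof. by apply/funext => i; rewrite /upd/=; case: eqP. Qed.

Lemma measurable_upd1 k x : measurable_fun setT (fun v : seqR R => upd k (v, x)).
Proof.
by apply: measurable_seqP => i; rewrite /upd/=; case: (i == k) => //; exact: measurable_coord.
Qed.

Lemma measurable_upd2 k v : measurable_fun setT (fun x : measurableTypeR R => upd k (v, x)).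
Proof. by apply: measurable_seqP => i; rewrite /upd/=; case: (i == k). Qed.

(** Redrawing one coordinate independently preserves the law. This brings one-dimensional facts to
    every coordinate, whereas the recursion gives access to the last one only. *)
Lemma ge0_integral_gs_resample n k (f : seqR R -> \bar R) : (k < n)%N ->
  measurable_fun setT f -> (forall v, 0 <= f v)%E ->
  (\int[G n]_v \int[N k]_x f (upd k (v, x)) = \int[G n]_v f v)%E.
Proof.
elim: n f => // n IH f kn mf f0.
have mfk : measurable_fun setT (fun v => \int[N k]_x f (upd k (v, x)))%E.
  exact: (@measurable_fun_fubini_tonelli_F _ _ _ _ _ (N k) (f \o upd k)
    (measurableT_comp mf (@measurable_upd k)) (fun p => f0 _)).
rewrite (ge0_integral_gsS2 n mfk)//; last by move=> v; apply: integral_ge0.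
case: (eqVneq k n) => [->|nk].
  rewrite (ge0_integral_gsS n mf f0).
  under eq_integral => y _ do under eq_integral => v _ do under eq_integral => x _ do rewrite updK.
  rewrite integral_cst// ?mule_ge0//=.
  by rewrite probability_setT mule1.
have {}kn : (k < n)%N by rewrite ltn_neqAle nk -ltnS.
rewrite (ge0_integral_gsS2 n mf f0).
apply: eq_integral => y _.
have mfy : measurable_fun setT (fun v => f (upd n (v, y))) := measurableT_comp mf (@measurable_upd1 n y).
rewrite -(IH _ kn mfy (fun v => f0 _)).
by apply: eq_integral => v _; apply: eq_integral => x _; rewrite updC.
Qed.

Lemma ae_section d1 d2 (T1 : measurableType d1) (T2 : measurableType d2)
  (P : probability T1 R) (Q : probability T2 R) (M : set (T1 * T2)) :
  measurable M -> (P \x Q)%E M = 0%E -> {ae Q, forall y, P (ysection M y) = 0%E}.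
Proof.
move=> mM M0.
have mi : measurable_fun setT (EFin \o \1_M : T1 * T2 -> \bar R).
  by apply/measurable_EFinP; exact: measurable_indic.
have i0 p : (0 <= (EFin \o \1_M : T1 * T2 -> \bar R) p)%E by rewrite /= lee_fin.
have H0 : (\int[(P \x Q)%E]_z (\1_M z)%:E = 0)%E.
  by rewrite integral_indic// setIT; exact: M0.
have H := etrans (esym H0) (@fubini_tonelli2 _ _ _ _ _ P Q _ mi i0).
have Gy y : fubini_G P (EFin \o \1_M) y = P (ysection M y).
  rewrite /fubini_G/= -(setIT (ysection M y)) -integral_indic//.
    by apply: eq_integral => x _; rewrite !indicE mem_ysection.
  exact: measurable_ysection.
have mG := @measurable_fun_fubini_tonelli_G _ _ _ _ _ P _ mi i0.
have : (\int[Q]_y `|fubini_G P (EFin \o \1_M) y| = 0)%E.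
  rewrite H; apply: eq_integral => y _; rewrite gee0_abs//.
  exact: integral_ge0.
move=> /(ae_eq_integral_abs _ measurableT mG); apply: filterS => y /(_ I).
by rewrite Gy.
Qed.

(** Fubini's theorem controls inner integrals only for almost every value of the outer variable, so
    the iterated integral of [f] has to be compared with an integrable function that agrees with [f]
    almost everywhere. *)
Lemma gauss_iter_ae n (f psi : seqR R -> R) :
  (G n).-integrable setT (EFin \o psi) ->
  {ae G n, forall v, f v = psi v} ->
  gauss_iter n mean sd f = \int[G n]_v psi v.
Proof.
elim: n f psi => [|n IH] f psi ipsi.
  move=> [M [mM M0 subM]] /=.
  have mpsi : measurable_fun setT (EFin \o psi) := measurable_int _ ipsi.
  (* The measure is a point mass, and a null set misses its atom. *)
  have -> : f (fun=> 0) = psi (fun=> 0).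
    apply: contrapT => /subM MM; move: M0; rewrite /= diracE mem_set//.
    by move=> /eqP; rewrite eqe oner_eq0.
  by rewrite /Rintegral /= integral_dirac//= indicT mul1r.
move=> [M [mM M0 subM]] /=.
have mpsi : measurable_fun setT (EFin \o psi) := measurable_int _ ipsi.
have mpsiu : measurable_fun setT (EFin \o psi \o upd n : seqR R * measurableTypeR R -> \bar R).
  exact: (measurableT_comp mpsi (@measurable_upd n)).
have ipu : (G n \x N n)%E.-integrable setT (EFin \o psi \o upd n).
  apply/integrableP; split => //.
  move/integrableP : ipsi => [_]; apply: le_lt_trans.
  have H := ge0_integral_image (G n \x N n)%E (@measurable_upd n)
    (measurableT_comp (@abse_measurable _ _) mpsi) (fun x => abse_ge0 _).
  by rewrite le_eqVlt; apply/orP; left; apply/eqP/esym; exact: H.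
have MM0 : (G n \x N n)%E (upd n @^-1` M) = 0%E by exact: M0.
have mMM : measurable (upd n @^-1` M : set (seqR R * measurableTypeR R)).
  by rewrite -[X in measurable X]setTI; exact: measurable_upd.
have ae1 := ae_section mMM MM0.
have ae2 := ae_integrable2 ipu.
transitivity (\int[N n]_x \int[G n]_v psi (upd n (v, x))).
  apply: (f_equal fine); apply: ae_eq_integral_any.
  apply: filterS2 ae1 ae2 => x x1 x2; congr EFin.
  apply: (IH _ (fun v => psi (upd n (v, x)))) => //.
  exists (ysection (upd n @^-1` M) x); split => //.
    exact: measurable_ysection.
  move=> v /= H; rewrite /ysection/= inE; apply: subM; exact: H.
rewrite /Rintegral /= integral_pushforward//; last exact: measurable_upd.
apply: (f_equal fine).
rewrite -(integral21_prod_meas1 ipu).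
apply: ae_eq_integral_any.
apply: filterS ae2 => x xi; rewrite fineK//.
exact: integrable_fin_num.
Qed.

Lemma gauss_iterE n (f : seqR R -> R) :
  (G n).-integrable setT (EFin \o f) -> gauss_iter n mean sd f = \int[G n]_v f v.
Proof. by move=> fi; apply: gauss_iter_ae => //; exact: aeW. Qed.

Lemma gauss_iter_ge0 n (f : seqR R -> R) : (forall v, 0 <= f v) -> 0 <= gauss_iter n mean sd f.
Proof.
by elim: n f => [|n IH] f f0 //=; apply: Rintegral_ge0 => x _; apply: IH.
Qed.

(** No measurability is assumed, so that the integrand of [truncated_cross] can be compared with
    simpler ones. The bound [c] keeps every stage finite, without which [fine] would not be
    monotone. *)
Lemma gauss_iter_le n (c : R) (f g : seqR R -> R) :
  (forall v, 0 <= f v <= g v) -> (forall v, g v <= c) ->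
  gauss_iter n mean sd f <= gauss_iter n mean sd g <= c.
Proof.
elim: n f g => [|n IH] f g fg gc /=; first by rewrite gc; have /andP[_ ->] := fg (fun=> 0).
have f0 v : 0 <= f v by have /andP[] := fg v.
have g0 v : 0 <= g v by have /andP[/le_trans h1 /h1] := fg v.
pose F h (x : R) := gauss_iter n mean sd (fun v => h (fun i => if i == n then x else v i)).
have FG x : F f x <= F g x <= c by apply: IH.
have F0 x : 0 <= F f x by exact: gauss_iter_ge0.
have G0 x : 0 <= F g x by exact: gauss_iter_ge0.
have A : (\int[N n]_x (F f x)%:E <= \int[N n]_x (F g x)%:E)%E.
  apply: ge0_ae_le_integral_any => [x|x|]; rewrite ?lee_fin//.
  by apply: aeW => x; rewrite lee_fin; case/andP: (FG x).
have c0 : 0 <= c by exact: le_trans (g0 (fun=> 0)) (gc _).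
have B : (\int[N n]_x (F g x)%:E <= c%:E)%E.
  have -> : c%:E = (\int[N n]_x (cst c%:E x))%E.
    rewrite integral_cst// (_ : _ setT = 1%E) ?mule1//; exact: probability_setT.
  apply: ge0_ae_le_integral_any => [x|x|]; rewrite ?lee_fin//.
  by apply: aeW => x; rewrite lee_fin; case/andP: (FG x).
have fin h : (forall x, 0 <= F h x) -> (\int[N n]_x (F h x)%:E <= c%:E)%E ->
    (\int[N n]_x (F h x)%:E \is a fin_num)%E.
  move=> h0 hc; rewrite ge0_fin_numE; first exact: le_lt_trans hc (ltry _).
  by apply: integral_ge0 => x _; rewrite lee_fin.
have fg' := fin g G0 B; have ff' := fin f F0 (le_trans A B).
apply/andP; split; first by apply: fine_le.
by rewrite -lee_fin fineK.
Qed.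

End SeqR.

Section ExProduct.
Context d1 d2 (T1 : measurableType d1) (T2 : measurableType d2) (R : realType).
Variables (P : probability T1 R) (Q : probability T2 R).
Implicit Type F : T1 * T2 -> R.

Definition pprod : probability (T1 * T2)%type R := (P \x Q)%E.

Lemma Ex_prod1 F : mom pprod F -> Ex pprod F = Ex P (fun x => Ex Q (fun y => F (x, y))).
Proof.
move=> /mom_integrable iF; rewrite /Ex {1}/Rintegral -(integral12_prod_meas1 iF).
apply: (f_equal fine); apply: ae_eq_integral_any; apply: filterS (ae_integrable1 iF) => x xi.
by rewrite /Rintegral fineK//; exact: integrable_fin_num.
Qed.

Lemma Ex_prod2 F : mom pprod F -> Ex pprod F = Ex Q (fun y => Ex P (fun x => F (x, y))).
Proof.
move=> /mom_integrable iF; rewrite /Ex {1}/Rintegral -(integral21_prod_meas1 iF).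
apply: (f_equal fine); apply: ae_eq_integral_any; apply: filterS (ae_integrable2 iF) => x xi.
by rewrite /Rintegral fineK//; exact: integrable_fin_num.
Qed.

Lemma integrable_pprod (f : T1 * T2 -> \bar R) : measurable_fun setT f ->
  (\int[P]_x \int[Q]_y `|f (x, y)| < +oo)%E -> pprod.-integrable setT f.
Proof.
move=> mf fi; apply/integrableP; split => //; apply: le_lt_trans fi.
rewrite (@fubini_tonelli1 _ _ _ _ _ P Q (fun p => `|f p|)%E)//.
exact: measurableT_comp.
Qed.

Lemma mom_fst (f : T1 -> R) : mom P f -> mom pprod (fun p => f p.1).
Proof.
move=> [mf fi]; split; first exact: measurableT_comp.
move=> k; apply: integrable_pprod.
  by apply/measurable_EFinP/measurable_funX/measurableT_comp => //; exact: measurableT_comp.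
have /integrableP[m1 i1] := fi k; apply: le_lt_trans i1.
apply: ge0_ae_le_integral_any => // [x|]; first exact: integral_ge0.
apply: aeW => x /=; rewrite integral_cst//.
by rewrite (_ : _ setT = 1%E) ?mule1//; exact: probability_setT.
Qed.

Lemma mom_snd (f : T2 -> R) : mom Q f -> mom pprod (fun p => f p.2).
Proof.
move=> [mf fi]; split; first exact: measurableT_comp.
move=> k; apply: integrable_pprod.
  by apply/measurable_EFinP/measurable_funX/measurableT_comp => //; exact: measurableT_comp.
have /integrableP[m1 i1] := fi k; apply: le_lt_trans i1 => /=.
rewrite integral_cst//.
by rewrite (_ : _ setT = 1%E) ?mule1//; exact: probability_setT.
Qed.

Lemma Ex_fst (f : T1 -> R) : mom P f -> Ex pprod (fun p => f p.1) = Ex P f.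
Proof.
move=> mf; rewrite (Ex_prod1 (mom_fst mf)); congr Ex; apply/funext => x.
exact: (Ex_cst Q (f x)).
Qed.

Lemma Ex_snd (f : T2 -> R) : mom Q f -> Ex pprod (fun p => f p.2) = Ex Q f.
Proof.
move=> mf; rewrite (Ex_prod2 (mom_snd mf)); congr Ex; apply/funext => x.
exact: (Ex_cst P (f x)).
Qed.

End ExProduct.

Section EqMeasure.
Context d (T : measurableType d) (R : realType) (P Q : probability T R).
Hypothesis PQ : forall f : T -> \bar R, measurable_fun setT f -> (forall x, 0 <= f x)%E ->
  (\int[P]_x f x = \int[Q]_x f x)%E.

Lemma eq_prob_integral (f : T -> \bar R) : (\int[P]_x f x = \int[Q]_x f x)%E.
Proof.
apply: eq_measure_integral => A mA _.
have i0 x : (0 <= (\1_A x : R)%:E)%E by rewrite lee_fin.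
have mi : measurable_fun setT (fun x => (\1_A x : R)%:E).
  by apply/measurable_EFinP; exact: measurable_indic.
by have := PQ mi i0; rewrite !integral_indic// !setIT.
Qed.

Lemma eq_prob_Ex (f : T -> R) : Ex P f = Ex Q f.
Proof. by rewrite /Ex /Rintegral eq_prob_integral. Qed.

Lemma eq_prob_mom (f : T -> R) : mom P f -> mom Q f.
Proof.
move=> [mf fi]; split => // k; have /integrableP[m1 i1] := fi k.
by apply/integrableP; split => //; rewrite -eq_prob_integral.
Qed.

End EqMeasure.

Section SteinProduct.
Context d (T : measurableType d) (R : realType) (P : probability T R).
Variables (m s : R) (F F' : T * measurableTypeR R -> R).
Hypothesis s0 : 0 < s.
Hypothesis dF : forall a (x : R), is_derive (x : R) 1 (fun x => F (a, x)) (F' (a, x)).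
Hypothesis cF' : forall a, continuous (fun x : R => F' (a, x)).
Notation PN := (pprod P (normal_prob m s)).
Hypotheses (mF : mom PN F) (mF' : mom PN F').

Lemma stein_pprod : Ex PN (fun p => (p.2 - m) * F p) = s ^+ 2 * Ex PN F'.
Proof.
have mx : mom PN (fun p => (p.2 - m) * F p).
  apply: momM => //; apply: momB; last exact: mom_cst.
  exact: (mom_snd P (mom_normal_id m s0)).
rewrite -ExZl// (Ex_prod1 mx) Ex_prod1; last by mom_tac.
rewrite /Ex /Rintegral; apply: (f_equal fine); apply: ae_eq_integral_any.
have i1 := ae_integrable1 (mom_integrable mF).
have i2 := ae_integrable1 (mom_integrable mx).
have i3 := ae_integrable1 (mom_integrable mF').
apply: filterS3 i1 i2 i3 => a a1 a2 a3; congr EFin.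
have := normal_stein s0 (dF a) (cF' (a := a)) a1 a2 a3.
by rewrite -RintegralZl.
Qed.

End SteinProduct.

(** * Integration by parts, shifts and rotations of Gaussian sequences *)

Section GsBasic.
Context {R : realType}.
Implicit Types (n k : nat) (mean sd : nat -> R).

Lemma gs_resample_prod d (B : measurableType d) (PB : probability B R) n k mean sd :
  (k < n)%N -> forall f : B * seqR R -> \bar R, measurable_fun setT f -> (forall x, 0 <= f x)%E ->
  (\int[pprod PB (gs n mean sd)]_p f p =
   \int[pprod (pprod PB (gs n mean sd)) (normal_prob (mean k) (sd k))]_p
     f (p.1.1, upd k (p.1.2, p.2)))%E.
Proof.
move=> kn f mf f0.
rewrite (@fubini_tonelli1 _ _ _ _ _ PB (gs n mean sd) f)//.
pose h (p : (B * seqR R) * measurableTypeR R) := f (p.1.1, upd k (p.1.2, p.2)).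
have mh : measurable_fun setT h.
  apply: (measurableT_comp mf); apply/measurable_fun_pairP; split => /=.
    exact: (measurableT_comp measurable_fst measurable_fst).
  apply: (measurableT_comp (@measurable_upd R k)).
  apply/measurable_fun_pairP; split => /=; last exact: measurable_snd.
  exact: (measurableT_comp measurable_snd measurable_fst).
rewrite (@fubini_tonelli1 _ _ _ _ _ (pprod PB (gs n mean sd)) (normal_prob (mean k) (sd k)) h)//;
  last by move=> p; exact: f0.
have h0 p : (0 <= fubini_F (normal_prob (mean k) (sd k)) h p)%E.
  by apply: integral_ge0 => x _; exact: f0.
have mF := @measurable_fun_fubini_tonelli_F _ _ _ _ _ (normal_prob (mean k) (sd k)) h mh (fun p => f0 _).
rewrite (@fubini_tonelli1 _ _ _ _ _ PB (gs n mean sd) _ mF h0).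
apply: eq_integral => b _; apply/esym.
apply: (@ge0_integral_gs_resample _ mean sd n k (fun v => f (b, v)) kn) => //.
by apply: (measurableT_comp mf); apply: measurable_fun_pair.
Qed.

(** Coordinate [k] is redrawn as an independent normal variable, and the one-dimensional formula is
    applied with everything else, including the parameter [b], held fixed. *)
Lemma gs_stein d (B : measurableType d) (PB : probability B R) n k mean sd
  (F F' : B * seqR R -> R) : (k < n)%N -> 0 < sd k ->
  (forall b v (x : R), is_derive (x : R) 1 (fun x => F (b, upd k (v, x))) (F' (b, upd k (v, x)))) ->
  (forall b v, continuous (fun x : R => F' (b, upd k (v, x)))) ->
  mom (pprod PB (gs n mean sd)) F -> mom (pprod PB (gs n mean sd)) F' ->
  Ex (pprod PB (gs n mean sd)) (fun p => (p.2 k - mean k) * F p) =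
  sd k ^+ 2 * Ex (pprod PB (gs n mean sd)) F'.
Proof.
move=> kn sk dF cF' mF mF'.
pose h (p : (B * seqR R) * measurableTypeR R) := (p.1.1, upd k (p.1.2, p.2)).
have mh : measurable_fun setT h.
  apply/measurable_fun_pairP; split => /=.
    exact: (measurableT_comp measurable_fst measurable_fst).
  apply: (measurableT_comp (@measurable_upd R k)).
  apply/measurable_fun_pairP; split => /=; last exact: measurable_snd.
  exact: (measurableT_comp measurable_snd measurable_fst).
pose PP := pprod (pprod PB (gs n mean sd)) (normal_prob (mean k) (sd k)).
have E (f : B * seqR R -> \bar R) : measurable_fun setT f -> (forall x, 0 <= f x)%E ->
    (\int[pprod PB (gs n mean sd)]_p f p = \int[image_prob PP mh]_p f p)%E.
  move=> mf f0; rewrite (ge0_integral_image PP mh mf f0).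
  exact: gs_resample_prod.
have mFh := mom_imageP (eq_prob_mom E mF).
have mFh' := mom_imageP (eq_prob_mom E mF').
have mk : mom PP (fun p => p.2 - mean k).
  apply: momB; last exact: mom_cst.
  exact: (mom_snd _ (mom_normal_id _ sk)).
have mx : mom (image_prob PP mh) (fun p => (p.2 k - mean k) * F p).
  apply: mom_image.
    apply: measurable_funM; last exact: mom_meas mF.
    by apply: measurable_funB => //; exact: (measurableT_comp (@measurable_coord R k)).
  have -> : (fun p => ((h p).2 k - mean k) * F (h p)) = (fun p => (p.2 - mean k) * F (h p)).
    by apply/funext => p; rewrite /h /upd/= eqxx.
  exact: momM.
rewrite !(eq_prob_Ex E) (Ex_image mx) (Ex_image (eq_prob_mom E mF')).
have -> : (fun p => ((h p).2 k - mean k) * F (h p)) = (fun p => (p.2 - mean k) * F (h p)).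
  by apply/funext => p; rewrite /h /upd/= eqxx.
exact: (@stein_pprod _ _ R (pprod PB (gs n mean sd)) (mean k) (sd k) (F \o h) (F' \o h)
  sk (fun a => dF a.1 a.2) (fun a => cF' a.1 a.2) mFh mFh').
Qed.

Lemma mom_gs_coord n k mean sd : (k < n)%N -> 0 < sd k -> mom (gs n mean sd) (fun v => v k).
Proof.
move=> kn sk; split; first exact: measurable_coord.
move=> j; apply/integrableP; split.
  apply/measurable_EFinP/measurable_funX/measurableT_comp => //; exact: measurable_coord.
have mf : measurable_fun setT (fun v : seqR R => `|(`|v k| ^+ j)%:E|%E).
  apply: measurableT_comp => //.
  apply/measurable_EFinP/measurable_funX/measurableT_comp => //; exact: measurable_coord.
rewrite -(@ge0_integral_gs_resample _ mean sd n k _ kn mf)//.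
have [_ /(_ j)/integrableP[_ fi]] := mom_normal_id (mean k) sk.
apply: le_lt_trans fi.
under eq_integral => v _ do under eq_integral => x _ do rewrite /upd/= eqxx.
rewrite integral_cst//.
by rewrite (_ : _ setT = 1%E) ?mule1//; exact: probability_setT.
Qed.

(** The shift is confined to the coordinates that carry noise: the others are deterministic, and a
    shifted point mass has no density with respect to the original one. *)
Definition addv n (v c : seqR R) : seqR R := fun i => if (i < n)%N then v i + c i else v i.

(** Logarithm of the density at [v] of the noise shifted by [c], relative to the noise. *)
Definition llr n sd (c v : nat -> R) : R :=
  \sum_(k < n) (v k * c k / sd k ^+ 2 - c k ^+ 2 / (sd k ^+ 2 *+ 2)).

Lemma measurable_llr d (T : measurableType d) n sd (c v : T -> seqR R) :
  measurable_fun setT c -> measurable_fun setT v ->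
  measurable_fun setT (fun x => llr n sd (c x) (v x)).
Proof.
move=> mc mv.
have mi i (f : T -> seqR R) : measurable_fun setT f -> measurable_fun setT (fun x => f x i).
  by move=> mf; exact: (measurableT_comp (@measurable_coord R i) mf).
apply: measurable_sum => k; apply: measurable_funB; apply: measurable_funM => //.
  by apply: measurable_funM; exact: mi.
by apply: measurable_funX; exact: mi.
Qed.

Lemma measurable_addv d (T : measurableType d) n (v c : T -> seqR R) :
  measurable_fun setT v -> measurable_fun setT c ->
  measurable_fun setT (fun x => addv n (v x) (c x)).
Proof.
move=> mv mc.
have mi i (f : T -> seqR R) : measurable_fun setT f -> measurable_fun setT (fun x => f x i).
  by move=> mf; exact: (measurableT_comp (@measurable_coord R i) mf).
apply: measurable_seqP => i; rewrite /addv; case: (i < n)%N; last exact: mi.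
by apply: measurable_funD; exact: mi.
Qed.

Lemma ge0_integral_gs_shift n sd (c : seqR R) (f : seqR R -> \bar R) :
  (forall k, (k < n)%N -> 0 < sd k) ->
  measurable_fun setT f -> (forall v, 0 <= f v)%E ->
  (\int[gs n (fun=> 0%R) sd]_v f (addv n v c) =
   \int[gs n (fun=> 0%R) sd]_v (f v * (expR (llr n sd c v))%:E))%E.
Proof.
elim: n f => [|n IH] f sd0 mf f0.
  by apply: eq_integral => v _; rewrite /llr big_ord0 expR0 mule1.
have sn : 0 < sd n by exact: sd0.
have mid : measurable_fun setT (fun v : seqR R => v) by exact: measurable_id.
have mcst : measurable_fun setT (fun v : seqR R => c) by exact: measurable_cst.
have ma : measurable_fun setT (fun v : seqR R => f (addv n.+1 v c)).
  by apply: (measurableT_comp mf); exact: measurable_addv.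
rewrite (ge0_integral_gsS _ _ n ma)//.
pose e (y : R) := expR (y * c n / sd n ^+ 2 - c n ^+ 2 / (sd n ^+ 2 *+ 2)).
have aE v y : addv n.+1 (upd n (v, y)) c = upd n (addv n v c, y + c n).
  apply/funext => i; rewrite /addv /upd/= ltnS leq_eqVlt.
  by case: eqP => [->|].
have step v : (\int[normal_prob 0 (sd n)]_y f (addv n.+1 (upd n (v, y)) c) =
   \int[normal_prob 0 (sd n)]_y (f (upd n (addv n v c, y)) * (e y)%:E))%E.
  under eq_integral do rewrite aE.
  have mg : measurable_fun setT (fun y : measurableTypeR R => f (upd n (addv n v c, y))).
    exact: (measurableT_comp mf (@measurable_upd2 R n _)).
  exact: (ge0_integral_normal_shift _ sn mg (fun y => f0 _)).
under eq_integral do rewrite step.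
have me : measurable_fun setT (fun p : seqR R * measurableTypeR R => (f (upd n p) * (e p.2)%:E)%E).
  apply: emeasurable_funM; first exact: (measurableT_comp mf (@measurable_upd R n)).
  apply/measurable_EFinP; apply: (measurableT_comp _ measurable_snd).
  apply: (measurableT_comp (@measurable_expR R)).
  by apply: measurable_funB => //; do 2 apply: measurable_funM => //.
have e0 p : (0 <= f (upd n p) * (e p.2)%:E)%E by rewrite mule_ge0// lee_fin expR_ge0.
have mh := @measurable_fun_fubini_tonelli_F _ _ _ _ _ (normal_prob 0 (sd n)) _ me e0.
have h0 v : (0 <= \int[normal_prob 0 (sd n)]_y (f (upd n (v, y)) * (e y)%:E))%E.
  by apply: integral_ge0 => y _; exact: (e0 (v, y)).
rewrite (IH _ (fun k kn => sd0 k (ltnW kn)) mh h0).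
have ml : measurable_fun setT (fun v : seqR R => (f v * (expR (llr n.+1 sd c v))%:E)%E).
  apply: emeasurable_funM => //; apply/measurable_EFinP/measurableT_comp => //.
  exact: (measurable_llr n.+1 sd mcst mid).
have l0 v : (0 <= f v * (expR (llr n.+1 sd c v))%:E)%E by rewrite mule_ge0// lee_fin expR_ge0.
rewrite (ge0_integral_gsS _ _ n ml l0).
apply: eq_integral => v _; have mev := measurableT_comp me (measurable_pair1 v).
rewrite muleC -ge0_integralZl//.
all: try by [exact: mev | move=> y _; exact: (e0 (v, y)) | rewrite lee_fin expR_ge0].
apply: eq_integral => y _; rewrite muleC -muleA -EFinM -expRD; congr (_ * (expR _)%:E)%E.
rewrite /llr big_ord_recr/= /upd/= eqxx addrC; congr (_ + _).
by apply: eq_bigr => k _; rewrite ltn_eqF.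
Qed.

Definition comb (c1 c2 : R) (p : seqR R * seqR R) : seqR R := fun i => c1 * p.1 i + c2 * p.2 i.

Lemma measurable_comb c1 c2 : measurable_fun setT (comb c1 c2).
Proof.
apply: measurable_seqP => i; apply: measurable_funD; apply: measurable_funM => //.
  exact: (measurableT_comp (@measurable_coord R i) measurable_fst).
exact: (measurableT_comp (@measurable_coord R i) measurable_snd).
Qed.

Lemma ge0_integral_gs_conv n sd (c1 c2 : R) (f : seqR R -> \bar R) :
  (forall k, (k < n)%N -> 0 < sd k) -> 0 < c2 -> c1 ^+ 2 + c2 ^+ 2 = 1 ->
  measurable_fun setT f -> (forall v, 0 <= f v)%E ->
  (\int[gs n (fun=> 0%R) sd]_v \int[gs n (fun=> 0%R) sd]_w f (comb c1 c2 (v, w)) =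
   \int[gs n (fun=> 0%R) sd]_v f v)%E.
Proof.
move=> + c20 c12; elim: n f => [|n IH] f sd0 mf f0.
  pose z : seqR R := fun=> 0.
  have i0 (g : seqR R -> \bar R) : measurable_fun setT g -> (\int[gs 0 (fun=> 0%R) sd]_v g v = g z)%E.
    by move=> mg; rewrite /= integral_dirac// diracT mul1e.
  have mfc := measurableT_comp mf (measurable_comb c1 c2).
  have H v := i0 _ (measurableT_comp mfc (measurable_pair1 v)).
  under eq_integral => v _ do rewrite (H v)/=.
  rewrite (i0 _ (measurableT_comp mfc (measurable_pair2 z))) i0//=; congr f.
  by apply/funext => i; rewrite /comb/= !mulr0 addr0.
have mfc : measurable_fun setT (fun p => f (comb c1 c2 p)).
  exact: measurableT_comp mf (measurable_comb c1 c2).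
set G := gs n (fun=> 0) sd; set N := normal_prob 0 (sd n).
set G' := gs n.+1 (fun=> 0) sd.
have mF := @measurable_fun_fubini_tonelli_F _ _ _ _ _ G' _ mfc (fun p => f0 _).
rewrite (ge0_integral_gsS _ _ n mF); last by move=> v; exact: integral_ge0.
have cE v y w z : comb c1 c2 (upd n (v, y), upd n (w, z)) = upd n (comb c1 c2 (v, w), c1 * y + c2 * z).
  by apply/funext => i; rewrite /comb /upd/=; case: eqP.
have mcu : measurable_fun setT (fun p : (seqR R * measurableTypeR R) * (seqR R * measurableTypeR R) =>
   f (comb c1 c2 (upd n p.1, upd n p.2))).
  apply: (measurableT_comp mfc); apply: measurable_fun_pair.
    exact: (measurableT_comp (@measurable_upd R n) measurable_fst).
  exact: (measurableT_comp (@measurable_upd R n) measurable_snd).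
transitivity (\int[G]_v \int[N]_y \int[G]_w \int[N]_z f (upd n (comb c1 c2 (v, w), (c1 * y + c2 * z)%R)))%E.
  apply: eq_integral => v _; apply: eq_integral => y _.
  have mfy : measurable_fun setT (fun w => f (comb c1 c2 (upd n (v, y), w))) :=
    measurableT_comp mfc (measurable_pair1 (upd n (v, y))).
  rewrite /fubini_F (ge0_integral_gsS _ _ n mfy (fun w => f0 _)).
  by apply: eq_integral => w _; apply: eq_integral => z _; rewrite cE.
(* Exchanging the integrals over w and y brings the two last coordinates together, where the
   one-dimensional convolution applies. *)
transitivity (\int[G]_v \int[G]_w \int[N]_y \int[N]_z f (upd n (comb c1 c2 (v, w), (c1 * y + c2 * z)%R)))%E.
  apply: eq_integral => v _.
  pose h (p : measurableTypeR R * seqR R) := (\int[N]_z f (upd n (comb c1 c2 (v, p.2), (c1 * p.1 + c2 * z)%R)))%E.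
  have mh : measurable_fun setT h.
    apply: (@measurable_fun_fubini_tonelli_F _ _ _ _ _ N
      (fun q : (measurableTypeR R * seqR R) * measurableTypeR R =>
        f (upd n (comb c1 c2 (v, q.1.2), (c1 * q.1.1 + c2 * q.2)%R)))) => //.
    have mq : measurable_fun setT (fun q : (measurableTypeR R * seqR R) * measurableTypeR R =>
        ((v, q.1.1), (q.1.2, q.2))).
      apply: measurable_fun_pair; apply: measurable_fun_pair => //.
      - exact: (measurableT_comp measurable_fst measurable_fst).
      - exact: (measurableT_comp measurable_snd measurable_fst).
    have := measurableT_comp mcu mq; congr (measurable_fun _ _).
    by apply/funext => q; rewrite /= cE.
  exact: (@fubini_tonelli _ _ _ _ _ N G h mh (fun p => integral_ge0 _ (fun z _ => f0 _))).
have inner v w : (\int[N]_y \int[N]_z f (upd n (comb c1 c2 (v, w), (c1 * y + c2 * z)%R)) =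
    \int[N]_y f (upd n (comb c1 c2 (v, w), y)))%E.
  apply: (@ge0_integral_normal_conv _ (sd n) c1 c2 (fun y => f (upd n (comb c1 c2 (v, w), y)))) => //.
    exact: sd0.
  exact: (measurableT_comp mf (@measurable_upd2 R n _)).
under eq_integral => v _ do under eq_integral => w _ do rewrite inner.
have mh : measurable_fun setT (fun v => \int[N]_y f (upd n (v, y)))%E.
  exact: (@measurable_fun_fubini_tonelli_F _ _ _ _ _ N (f \o upd n)
    (measurableT_comp mf (@measurable_upd R n)) (fun p => f0 _)).
rewrite (IH (fun v => \int[N]_y f (upd n (v, y)))%E (fun k kn => sd0 k (ltnW kn)) mh); last first.
  by move=> v; exact: integral_ge0.
by rewrite (ge0_integral_gsS _ _ n mf f0).
Qed.

End GsBasic.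

(** * Bayesian estimation in Gaussian noise *)

Section Model.
Context d (U : measurableType d) (R : realType).
Variables (Pu : probability U R) (n : nat) (sd : nat -> R) (t : U -> seqR R).
Hypothesis sd0 : forall k, (k < n)%N -> 0 < sd k.
Hypothesis mt : forall k, mom Pu (fun u => t u k).
Notation PW := (gs n (fun=> 0) sd).
Implicit Types (a : R) (h : U -> R).

(** The amplitude [a] is the square root of the signal strength; it is the strengths that add up
    over independent observations. *)
Definition sig a (u : U) : seqR R := fun k => a * t u k.
(* Density of the law of the observation given [u], with respect to the law of the noise. *)
Definition lik a (u : U) (w : seqR R) : R := expR (llr n sd (sig a u) w).

Lemma measurable_sig a : measurable_fun setT (sig a).
Proof.
by apply: measurable_seqP => k; apply: measurable_funM => //; exact: mom_meas (mt k).
Qed.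

Definition obs a (p : U * seqR R) : U * seqR R := (p.1, addv n p.2 (sig a p.1)).

Lemma measurable_obs a : measurable_fun setT (obs a).
Proof.
apply: measurable_fun_pair => //; apply: measurable_addv => //.
exact: (measurableT_comp (measurable_sig a)).
Qed.

Definition joint a : probability (U * seqR R)%type R :=
  image_prob (pprod Pu PW) (measurable_obs a).

Lemma lik_gt0 a u w : 0 < lik a u w. Proof. exact: expR_gt0. Qed.
Lemma lik_ge0 a u w : 0 <= lik a u w. Proof. exact: expR_ge0. Qed.

Lemma measurable_lik d' (T : measurableType d') a (f : T -> U) (g : T -> seqR R) :
  measurable_fun setT f -> measurable_fun setT g ->
  measurable_fun setT (fun x => lik a (f x) (g x)).
Proof.
move=> mf mg; apply: measurableT_comp => //.
by apply: measurable_llr => //; exact: (measurableT_comp (measurable_sig a)).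
Qed.

(** The likelihood at a signal equal to the observation, the largest value possible. Being free of
    [u] and [a], it makes all likelihood-weighted prior integrals finite and later serves as
    dominating function. *)
Definition liksup (w : nat -> R) : R := expR (\sum_(k < n) w k ^+ 2 / (sd k ^+ 2 *+ 2)).

Lemma lik_le a u w : lik a u w <= liksup w.
Proof.
rewrite ler_expR; apply: ler_sum => k _.
have s2 : 0 < sd k ^+ 2 by rewrite exprn_gt0// sd0.
rewrite -subr_ge0; set x := w k; set y := sig a u k.
have -> : x ^+ 2 / (sd k ^+ 2 *+ 2) - (x * y / sd k ^+ 2 - y ^+ 2 / (sd k ^+ 2 *+ 2)) =
   (x - y) ^+ 2 / (sd k ^+ 2 *+ 2) by field; rewrite gt_eqF// sd0.
by rewrite divr_ge0 ?sqr_ge0// mulrn_wge0// ltW.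
Qed.

Lemma mom_lik a h w : mom Pu h -> mom Pu (fun u => h u * lik a u w).
Proof.
move=> mh; apply: momM => //; apply: (@mom_bounded _ _ _ _ _ (liksup w)).
  by apply: measurable_lik.
by move=> u; rewrite ger0_norm ?lik_ge0// lik_le.
Qed.

(** The joint law has density [lik] relative to prior times noise. With the observation outside, the
    inner integral is an unnormalised posterior average. *)
Lemma ge0_integral_joint a (f : U * seqR R -> \bar R) :
  measurable_fun setT f -> (forall p, 0 <= f p)%E ->
  (\int[joint a]_p f p = \int[PW]_w \int[Pu]_u (f (u, w) * (lik a u w)%:E))%E.
Proof.
move=> mf f0; rewrite (ge0_integral_image _ (measurable_obs a) mf f0).
have mfo := measurableT_comp mf (measurable_obs a).
rewrite (@fubini_tonelli1 _ _ _ _ _ Pu PW (fun x => f (obs a x)) mfo (fun p => f0 _)).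
pose g (p : U * seqR R) := (f p * (lik a p.1 p.2)%:E)%E.
have mg : measurable_fun setT g.
  by apply: emeasurable_funM => //; apply/measurable_EFinP; exact: measurable_lik.
have g0 p : (0 <= g p)%E by rewrite mule_ge0// lee_fin lik_ge0.
transitivity (\int[Pu]_u \int[PW]_w g (u, w))%E.
  apply: eq_integral => u _.
  exact: (@ge0_integral_gs_shift _ n sd (sig a u) (fun w => f (u, w)) sd0
    (measurableT_comp mf (measurable_pair1 u)) (fun w => f0 _)).
exact: (@fubini_tonelli _ _ _ _ _ Pu PW g mg g0).
Qed.

Lemma Ex_joint a (F : U * seqR R -> R) : mom (joint a) F ->
  Ex (joint a) F = \int[PW]_w \int[Pu]_u (F (u, w) * lik a u w).
Proof.
move=> mF; have iF := mom_integrable mF.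
pose g (p : U * seqR R) := F p * lik a p.1 p.2.
have mg : measurable_fun setT g.
  by apply: measurable_funM; [exact: mom_meas mF|exact: measurable_lik].
have mFE : measurable_fun setT (EFin \o F) by apply/measurable_EFinP; exact: mom_meas mF.
have ig : (pprod Pu PW).-integrable setT (EFin \o g).
  apply/integrableP; split; first exact/measurable_EFinP.
  have /integrableP[_] := iF; apply: le_lt_trans.
  have mF' := measurableT_comp (@abse_measurable _ setT) mFE.
  rewrite (ge0_integral_joint a mF' (fun p => abse_ge0 _)).
  rewrite (@fubini_tonelli2 _ _ _ _ _ Pu PW (fun p => `|(g p)%:E|%E))//; last first.
    by apply: measurableT_comp => //; exact/measurable_EFinP.
  rewrite le_eqVlt; apply/orP; left; apply/eqP; apply: eq_integral => w _.
  apply: eq_integral => u _; rewrite /g /= -EFinM normrM.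
  by rewrite (ger0_norm (lik_ge0 _ _ _)).
transitivity (\int[pprod Pu PW]_p g p).
  apply: (f_equal fine); apply: (etrans (integralE _ _ _)); apply/esym.
  apply: (etrans (integralE _ _ _)); apply/esym.
  have mFp := measurable_funepos mFE; have mFn := measurable_funeneg mFE.
  have mgE : measurable_fun setT (EFin \o g) by exact/measurable_EFinP.
  rewrite (ge0_integral_joint a mFp (fun p => funepos_ge0 _ p)).
  rewrite (ge0_integral_joint a mFn (fun p => funeneg_ge0 _ p)).
  rewrite (@fubini_tonelli2 _ _ _ _ _ Pu PW _ (measurable_funepos mgE) (fun p => funepos_ge0 _ p)).
  rewrite (@fubini_tonelli2 _ _ _ _ _ Pu PW _ (measurable_funeneg mgE) (fun p => funeneg_ge0 _ p)).
  apply: (f_equal2 (fun x y : \bar R => x - y)%E); apply: eq_integral => w _; apply: eq_integral => u _.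
  - rewrite !funeposE /= -!EFin_max -EFinM; congr EFin.
    by rewrite /g maxr_pMl ?lik_ge0// mul0r.
  - rewrite !funenegE /= -!EFin_max -EFinM; congr EFin.
    by rewrite /g maxr_pMl ?lik_ge0// mul0r mulNr.
rewrite {1}/Rintegral -(integral21_prod_meas1 ig).
apply: (f_equal fine); apply: ae_eq_integral_any; apply: filterS (ae_integrable2 ig) => x xi.
by rewrite /Rintegral fineK//; exact: integrable_fin_num.
Qed.

Definition num a h (w : seqR R) : R := Ex Pu (fun u => h u * lik a u w).
Definition Zn a (w : seqR R) : R := Ex Pu (fun u => lik a u w).
(* By Bayes' formula, the posterior mean of [h] given the observation [w]. *)
Definition avg a h (w : seqR R) : R := num a h w / Zn a w.

Lemma momlik a w : mom Pu (fun u => lik a u w).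
Proof.
by have := mom_lik a w (mom_cst Pu 1); congr mom; apply/funext => u; rewrite /= mul1r.
Qed.

Lemma Zn_gt0 a w : 0 < Zn a w.
Proof.
rewrite lt_neqAle Ex_ge0 ?andbT; last by move=> u; exact: lik_ge0.
apply/negP => /eqP/esym Z0.
have ml : measurable_fun setT (fun u => (lik a u w)%:E).
  by apply/measurable_EFinP; exact: mom_meas (momlik a w).
have : (\int[Pu]_u `|(lik a u w)%:E| = 0)%E.
  rewrite -[RHS]/(0%R%:E) -Z0 (EFin_Ex (momlik a w)).
  by apply: eq_integral => u _; rewrite gee0_abs// lee_fin lik_ge0.
move/(ae_eq_integral_abs _ measurableT ml) => [N [mN N0 sub]].
have : (Pu setT <= Pu N)%E.
  apply: le_measure; rewrite ?inE// => u _; apply: sub => /= H.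
  have := H I => -[] /eqP; rewrite gt_eqF//; exact: lik_gt0.
by rewrite N0 probability_setT lee_fin ler10.
Qed.

Lemma Zn_num a w : Zn a w = num a (cst 1) w.
Proof. by congr Ex; apply/funext => u; rewrite /= mul1r. Qed.

Lemma avg_cst a c w : avg a (cst c) w = c.
Proof.
rewrite /avg /num (ExZl c (momlik a w)) -/(Zn a w) mulfK//.
by rewrite gt_eqF// Zn_gt0.
Qed.

Lemma avgD a h g w : mom Pu h -> mom Pu g ->
  avg a (fun u => h u + g u) w = avg a h w + avg a g w.
Proof.
move=> mh mg; rewrite /avg /num -mulrDl -ExD; [|exact: mom_lik..].
by congr (Ex _ _ / _); apply/funext => u; rewrite mulrDl.
Qed.

Lemma avgZ a c h w : mom Pu h -> avg a (fun u => c * h u) w = c * avg a h w.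
Proof.
move=> mh; rewrite /avg /num mulrA -ExZl; last exact: mom_lik.
by congr (Ex _ _ / _); apply/funext => u; rewrite mulrA.
Qed.

Lemma avgB a h g w : mom Pu h -> mom Pu g ->
  avg a (fun u => h u - g u) w = avg a h w - avg a g w.
Proof.
move=> mh mg; rewrite /avg /num -mulrBl -ExB; [|exact: mom_lik..].
by congr (Ex _ _ / _); apply/funext => u; rewrite mulrBl.
Qed.

Lemma avg_sum a (I : Type) (r : seq I) (A : pred I) (h : I -> U -> R) w :
  (forall i, A i -> mom Pu (h i)) ->
  avg a (fun u => \sum_(i <- r | A i) h i u) w = \sum_(i <- r | A i) avg a (h i) w.
Proof.
move=> mh; rewrite /avg -mulr_suml; congr (_ / _); rewrite /num.
rewrite -Ex_sum; last by move=> i Ai; apply: mom_lik; exact: mh.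
by congr Ex; apply/funext => u; rewrite mulr_suml.
Qed.

Lemma le_avg a h g w : mom Pu h -> mom Pu g -> (forall u, h u <= g u) ->
  avg a h w <= avg a g w.
Proof.
move=> mh mg hg; rewrite /avg ler_pM2r ?invr_gt0 ?Zn_gt0//.
by apply: le_Ex => [||u]; [exact: mom_lik..|rewrite ler_pM2r ?lik_gt0].
Qed.

Lemma avg_ge0 a h w : (forall u, 0 <= h u) -> 0 <= avg a h w.
Proof.
move=> h0; rewrite divr_ge0//; last exact/ltW/Zn_gt0.
by apply: Ex_ge0 => u; rewrite mulr_ge0// lik_ge0.
Qed.

Lemma avg_var a h c w : mom Pu h ->
  avg a (fun u => (h u - c) ^+ 2) w = avg a (fun u => h u ^+ 2) w - 2 * c * avg a h w + c ^+ 2.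
Proof.
move=> mh; have -> : (fun u => (h u - c) ^+ 2) = (fun u => (h u ^+ 2 - 2 * c * h u) + cst (c ^+ 2) u).
  by apply/funext => u /=; ring.
by rewrite avgD ?avgB ?avgZ ?avg_cst//; mom_tac.
Qed.

Lemma sqr_avg a h w : mom Pu h -> avg a h w ^+ 2 <= avg a (fun u => h u ^+ 2) w.
Proof.
move=> mh; have : 0 <= avg a (fun u => (h u - avg a h w) ^+ 2) w.
  by apply: avg_ge0 => u; exact: sqr_ge0.
by rewrite avg_var//; nra.
Qed.

(** Jensen's inequality for powers of two, by iterating [sqr_avg]. The other exponents are dominated
    by these in [mom_avg]. *)
Lemma avg_exp2 a h w j : mom Pu h ->
  `|avg a h w| ^+ (2 ^ j) <= avg a (fun u => `|h u| ^+ (2 ^ j)) w.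
Proof.
move=> mh; elim: j => [|j IH].
  rewrite expn0 expr1 ler_norml; apply/andP; split.
    rewrite -mulN1r -avgZ; last by mom_tac.
    by apply: le_avg => //; [mom_tac|move=> u; rewrite mulN1r expr1 lerNl -normrN ler_norm].
  by apply: le_avg => //; [mom_tac|move=> u; rewrite expr1 ler_norm].
rewrite expnSr exprM.
apply: (@le_trans _ _ (avg a (fun u => `|h u| ^+ (2 ^ j)) w ^+ 2)).
  by rewrite lerXn2r ?nnegrE ?exprn_ge0// avg_ge0// => u; rewrite exprn_ge0.
apply: (le_trans (sqr_avg _ _ _)); first by mom_tac.
by under [in leRHS]eq_fun do rewrite exprM.
Qed.

Lemma measurable_num a h : mom Pu h -> measurable_fun setT (num a h).
Proof.
move=> mh.
have mhl : measurable_fun setT (fun p : U * seqR R => h p.1 * lik a p.1 p.2).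
  apply: measurable_funM; last exact: measurable_lik.
  exact: (measurableT_comp (mom_meas mh)).
have mE : measurable_fun setT (EFin \o (fun p : U * seqR R => h p.1 * lik a p.1 p.2)).
  exact/measurable_EFinP.
have mp := @measurable_fun_fubini_tonelli_G _ _ _ _ _ Pu _ (measurable_funepos mE) (fun p => funepos_ge0 _ p).
have mn := @measurable_fun_fubini_tonelli_G _ _ _ _ _ Pu _ (measurable_funeneg mE) (fun p => funeneg_ge0 _ p).
rewrite /num /Ex /Rintegral; apply: (measurableT_comp (fine_measurable _)) => //.
have := emeasurable_funB mp mn; congr measurable_fun; apply/funext => w.
by rewrite [RHS]integralE; congr (_ - _)%E; apply: eq_integral => u _;
  rewrite ?funeposE ?funenegE.
Qed.

Lemma measurable_avg a h : mom Pu h -> measurable_fun setT (avg a h).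
Proof.
move=> mh; apply: measurable_funM; first exact: measurable_num.
under eq_fun do rewrite Zn_num.
have -> : (fun w => (num a (cst 1) w)^-1) = (fun w => powR (num a (cst 1) w) (-1)).
  by apply/funext => w; rewrite powR_inv1// -Zn_num ltW// Zn_gt0.
apply: (measurableT_comp (measurable_powR (-1))); apply: measurable_num; exact: mom_cst.
Qed.

Lemma mom_joint_fst a h : mom Pu h -> mom (joint a) (fun p => h p.1).
Proof.
move=> mh; apply: mom_image; last exact: mom_fst.
exact: (measurableT_comp (mom_meas mh)).
Qed.

Lemma Ex_joint_fst a h : mom Pu h -> Ex (joint a) (fun p => h p.1) = Ex Pu h.
Proof.
move=> mh; rewrite (Ex_image (mom_joint_fst a mh)) /=.
exact: Ex_fst.
Qed.

Lemma mom_joint_obs a k : (k < n)%N -> mom (joint a) (fun p => p.2 k).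
Proof.
move=> kn; apply: mom_image.
  exact: (measurableT_comp (@measurable_coord R k)).
rewrite /obs /addv/= kn; apply: momD.
  exact: (mom_snd Pu (@mom_gs_coord _ n k (fun=> 0) sd kn (sd0 kn))).
rewrite /sig; apply: momM; first exact: mom_cst.
exact: (mom_fst PW (mt k)).
Qed.

(** By Jensen's inequality under the posterior, the moments of a posterior mean are controlled by
    those of [h] under the prior. *)
Lemma mom_avg a h : mom Pu h -> mom (joint a) (fun p => avg a h p.2).
Proof.
move=> mh; have mav := measurable_avg a mh.
have mav2 : measurable_fun setT (fun p : U * seqR R => avg a h p.2) by exact: measurableT_comp.
have pow2 j : (joint a).-integrable setT (fun p => (`|avg a h p.2| ^+ (2 ^ j))%:E).
  have mm : measurable_fun setT (fun p : U * seqR R => (`|avg a h p.2| ^+ (2 ^ j))%:E).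
    by apply/measurable_EFinP/measurable_funX; apply: measurableT_comp.
  apply/integrableP; split => //.
  have m2 := measurableT_comp (@abse_measurable _ setT) mm.
  rewrite (ge0_integral_joint a m2 (fun p => abse_ge0 _)).
  have mh2 : mom Pu (fun u => `|h u| ^+ (2 ^ j)) by mom_tac.
  have /integrableP[m3 i3] := mom_integrable (mom_joint_fst a mh2).
  apply: le_lt_trans i3.
  have m4 := measurableT_comp (@abse_measurable _ setT) m3.
  rewrite (ge0_integral_joint a m4 (fun p => abse_ge0 _)).
  apply: ge0_ae_le_integral_any.
  - move=> w; apply: integral_ge0 => u _; apply: mule_ge0; first exact: abse_ge0.
    by rewrite lee_fin lik_ge0.
  - move=> w; apply: integral_ge0 => u _; apply: mule_ge0; first exact: abse_ge0.
    by rewrite lee_fin lik_ge0.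
  apply: aeW => w /=; have E (c : R) : 0 <= c ->
      (\int[Pu]_u (c%:E * (lik a u w)%:E) = (c * Zn a w)%:E)%E.
    move=> c0; rewrite ge0_integralZl//.
    - by rewrite EFinM (EFin_Ex (momlik a w)).
    - by apply/measurable_EFinP; exact: mom_meas (momlik a w).
    - by move=> u _; rewrite lee_fin lik_ge0.
  rewrite E ?normr_ge0//.
  have -> : (\int[Pu]_u (`| `|h u| ^+ (2 ^ j)|%:E * (lik a u w)%:E) =
      (num a (fun u => `|h u| ^+ (2 ^ j)) w)%:E)%E.
    rewrite (EFin_Ex (mom_lik a w mh2)); apply: eq_integral => u _.
    by rewrite ger0_norm ?exprn_ge0.
  rewrite lee_fin ger0_norm ?exprn_ge0// -ler_pdivlMr ?Zn_gt0//.
  exact: avg_exp2.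
split => // k.
have := integrableD measurableT (mom_integrable (mom_cst (joint a) 1)) (pow2 k).
apply: le_integrable => //.
  by apply/measurable_EFinP/measurable_funX; apply: measurableT_comp.
move=> p _; rewrite /= lee_fin normrX normr_id [leRHS]ger0_norm; last first.
  by rewrite addr_ge0 ?exprn_ge0.
set y := `|avg a h p.2|; have y0 : 0 <= y by exact: normr_ge0.
have [y1|/ltW y1] := leP y 1.
  by rewrite (@le_trans _ _ 1) ?exprn_ile1// lerDl exprn_ge0.
rewrite (@le_trans _ _ (y ^+ (2 ^ k)))//; last by rewrite lerDr.
by rewrite ler_weXn2l// ltnW// ltn_expl.
Qed.

(* Under the joint law, the signal is a posterior sample given the observation. *)
Lemma nishimori a (f : seqR R -> R) h : mom (joint a) (fun p => f p.2) -> mom Pu h ->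
  Ex (joint a) (fun p => f p.2 * h p.1) = Ex (joint a) (fun p => f p.2 * avg a h p.2).
Proof.
move=> mf mh; rewrite !Ex_joint; last 2 first.
- by apply: momM => //; exact: mom_avg.
- by apply: momM => //; exact: mom_joint_fst.
apply: (f_equal fine); apply: eq_integral => w _; congr EFin => /=.
transitivity (f w * num a h w).
  rewrite -(ExZl _ (mom_lik a w mh)); congr Ex; apply/funext => u.
  by rewrite mulrA.
transitivity (f w * avg a h w * Zn a w); last by rewrite -(ExZl _ (momlik a w)).
by rewrite -mulrA /avg divfK// gt_eqF// Zn_gt0.
Qed.

Lemma nishimori1 a h : mom Pu h -> Ex (joint a) (fun p => avg a h p.2) = Ex Pu h.
Proof.
move=> mh; have := @nishimori a (fun=> 1) h (mom_cst (joint a) 1) mh => /=.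
have -> : (fun p : U * seqR R => 1 * h p.1) = (fun p => h p.1) by apply/funext => p; rewrite mul1r.
have -> : (fun p : U * seqR R => 1 * avg a h p.2) = (fun p => avg a h p.2).
  by apply/funext => p; rewrite mul1r.
by rewrite Ex_joint_fst.
Qed.

End Model.

(** * Partial derivatives and the calculus of posterior means *)

Section Coordinate.
Context {R : realType}.
Implicit Types (f g : seqR R -> R) (k : nat).

(** [f'] is the partial derivative of [f] in coordinate [k], expressed along the lines
    [upd k (w, x)] because [gs_stein] consumes it in this shape. *)
Definition dcoord k f f' :=
  forall w (x : R), is_derive (x : R) 1 (fun x : R => f (upd k (w, x))) (f' (upd k (w, x))).

Definition ccoord k f := forall w, continuous (fun x : R => f (upd k (w, x))).

Lemma dcoord_ccoord k f f' : dcoord k f f' -> ccoord k f.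
Proof.
move=> df w x; apply/differentiable_continuous/derivable1_diffP.
by have := df w x.
Qed.

Lemma dcoordD k f f' g g' : dcoord k f f' -> dcoord k g g' ->
  dcoord k (fun w => f w + g w) (fun w => f' w + g' w).
Proof. by move=> df dg w x; exact: (is_deriveD (df w x) (dg w x)). Qed.

Lemma dcoordB k f f' g g' : dcoord k f f' -> dcoord k g g' ->
  dcoord k (fun w => f w - g w) (fun w => f' w - g' w).
Proof. by move=> df dg w x; exact: (is_deriveB (df w x) (dg w x)). Qed.

Lemma dcoord_cst k (c : R) : dcoord k (fun=> c) (fun=> 0).
Proof. by move=> w x; exact: (is_derive_cst (c : R^o) x 1). Qed.

Lemma dcoordM k f f' g g' : dcoord k f f' -> dcoord k g g' ->
  dcoord k (fun w => f w * g w) (fun w => f' w * g w + f w * g' w).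
Proof.
move=> df dg w x; apply: is_derive_eq (is_deriveM (df w x) (dg w x)) _.
by rewrite /GRing.scale/= addrC mulrC.
Qed.

Lemma dcoord_sum k (I : Type) (r : seq I) (f f' : I -> seqR R -> R) :
  (forall i, dcoord k (f i) (f' i)) ->
  dcoord k (fun w => \sum_(i <- r) f i w) (fun w => \sum_(i <- r) f' i w).
Proof.
move=> df; elim: r => [|i r IH].
  have := @dcoord_cst k 0; congr dcoord; apply/funext => w; rewrite ?big_nil//.
have := dcoordD (df i) IH; congr dcoord; apply/funext => w; rewrite ?big_cons//.
Qed.

Lemma dcoordV k f f' : (forall w, f w != 0) -> dcoord k f f' ->
  dcoord k (fun w => (f w)^-1) (fun w => - f' w / f w ^+ 2).
Proof.
move=> f0 df w x; apply: is_derive_eq (is_deriveV (f0 _) (df w x)) _.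
by rewrite /GRing.scale/= mulNr mulrC mulNr.
Qed.

Lemma ccoordD k f g : ccoord k f -> ccoord k g -> ccoord k (fun w => f w + g w).
Proof. by move=> cf cg w x; apply: cvgD; [exact: cf|exact: cg]. Qed.

Lemma ccoordB k f g : ccoord k f -> ccoord k g -> ccoord k (fun w => f w - g w).
Proof. by move=> cf cg w x; apply: cvgB; [exact: cf|exact: cg]. Qed.

Lemma ccoordM k f g : ccoord k f -> ccoord k g -> ccoord k (fun w => f w * g w).
Proof. by move=> cf cg w x; apply: cvgM; [exact: cf|exact: cg]. Qed.

Lemma ccoord_cst k (c : R) : ccoord k (fun=> c).
Proof. by move=> w x; exact: cvg_cst. Qed.

Lemma ccoord_sum k (I : Type) (r : seq I) (f : I -> seqR R -> R) :
  (forall i, ccoord k (f i)) -> ccoord k (fun w => \sum_(i <- r) f i w).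
Proof.
move=> cf; elim: r => [|i r IH].
  by have := @ccoord_cst k 0; congr ccoord; apply/funext => w; rewrite big_nil.
by have := ccoordD (cf i) IH; congr ccoord; apply/funext => w; rewrite big_cons.
Qed.

End Coordinate.

Section ModelCalculus.
Context d (U : measurableType d) (R : realType).
Variables (Pu : probability U R) (n : nat) (sd : nat -> R) (t : U -> seqR R).
Hypothesis sd0 : forall k, (k < n)%N -> 0 < sd k.
Hypothesis mt : forall k, mom Pu (fun u => t u k).
Notation PW := (gs n (fun=> 0) sd).
Notation lik := (lik n sd t).
Notation num := (num Pu n sd t).
Notation avg := (avg Pu n sd t).
Notation Zn := (Zn Pu n sd t).
Notation joint a := (joint n sd mt a).
Implicit Types (a : R) (h : U -> R).

Lemma llr_upd (c : nat -> R) k w x : (k < n)%N ->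
  llr n sd c (upd k (w, x)) = llr n sd c (upd k (w, 0)) + x * (c k / sd k ^+ 2).
Proof.
move=> kn; rewrite /llr (bigD1 (Ordinal kn))//= [in RHS](bigD1 (Ordinal kn))//=.
have -> : \sum_(i < n | i != Ordinal kn) (upd k (w, x) i * c i / sd i ^+ 2 - c i ^+ 2 / (sd i ^+ 2 *+ 2)) =
    \sum_(i < n | i != Ordinal kn) (upd k (w, 0) i * c i / sd i ^+ 2 - c i ^+ 2 / (sd i ^+ 2 *+ 2)).
  apply: eq_bigr => i ik; congr (_ * _ / _ - _).
  by rewrite /upd/=; case: eqP => // /eqP; rewrite (negbTE (ik : val i != k)).
by rewrite /upd/= eqxx; ring.
Qed.

Lemma liksup_upd k w (x y : R) : (k < n)%N -> `|x| <= `|y| ->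
  liksup n sd (upd k (w, x)) <= liksup n sd (upd k (w, y)).
Proof.
move=> kn xy; rewrite ler_expR; apply: ler_sum => i _.
rewrite ler_wpM2r ?invr_ge0 ?mulrn_wge0 ?sqr_ge0// /upd/=.
by case: eqP => // _; rewrite -(real_normK (num_real x)) -(real_normK (num_real y)) lerXn2r ?nnegrE.
Qed.

Lemma dcoord_num a h k : (k < n)%N -> mom Pu h ->
  dcoord k (num a h) (num a (fun u => h u * (sig t a u k / sd k ^+ 2))).
Proof.
move=> kn mh w x0.
pose B u := sig t a u k / sd k ^+ 2.
have mB : mom Pu B by rewrite /B /sig; mom_tac.
pose f (x : R) u := h u * lik a u (upd k (w, x)).
have df u (x : R) : is_derive (x : R) 1 (f ^~ u) (h u * B u * lik a u (upd k (w, x))).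
  have -> : f ^~ u = (fun x => h u * expR (llr n sd (sig t a u) (upd k (w, 0)) + x * B u)).
    by apply/funext => y; rewrite /f /lik llr_upd.
  pose g (x : R) : R := llr n sd (sig t a u) (upd k (w, 0)) + x * B u.
  have dg : is_derive x 1 g (B u).
    have -> : g = (fun x => llr n sd (sig t a u) (upd k (w, 0)) + B u *: x).
      by apply/funext => y; rewrite /g mulrC.
    apply: is_derive_eq (is_deriveD (is_derive_cst _ x 1) (is_deriveZ (B u) (is_derive_id x 1))) _.
    by rewrite add0r /GRing.scale/= mulr1.
  have d3 := is_derive1_comp (is_derive_expR (g x)) dg.
  apply: is_derive_eq (is_deriveZ (h u) d3) _.
  by rewrite /GRing.scale/= /lik llr_upd// -/(g x) -mulrA (mulrC (B u)).
(* Dominating function on the interval of radius 1 about [x0]: [liksup] grows with the absolute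
   value of each coordinate, and here this value stays below [|x0| + 1]. *)
pose G u := `|h u * B u| * liksup n sd (upd k (w, `|x0| + 1)).
have I0 : (`]x0 - 1, x0 + 1[%classic : set R) x0 by rewrite /= in_itv/=; apply/andP; split; lra.
have intf (x : R) : (`]x0 - 1, x0 + 1[%classic : set R) x -> Pu.-integrable setT (EFin \o f x).
  by move=> _; apply: mom_integrable; exact: mom_lik.
have derf (x : R) u : (`]x0 - 1, x0 + 1[%classic : set R) x -> setT u -> derivable (f ^~ u) x 1.
  by move=> _ _; have := df u x.
have G0 u : 0 <= G u by rewrite mulr_ge0// expR_ge0.
have iG : Pu.-integrable setT (EFin \o G).
  by apply: mom_integrable; rewrite /G; mom_tac.
have Gub (x : R) u : (`]x0 - 1, x0 + 1[%classic : set R) x -> setT u -> `|partial1of2 f x u| <= G u.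
  rewrite /= in_itv/= => /andP[x1 x2] _.
  rewrite partial1of2E; have [_ ->] := df u x.
  rewrite normrM ler_wpM2l// ger0_norm ?lik_ge0//.
  apply: (le_trans (lik_le t sd0 _ _ _)); apply: liksup_upd => //.
  rewrite [leRHS]ger0_norm ?addr_ge0// ler_norml; apply/andP; split.
    by have := ler_norm (- x0); rewrite normrN; lra.
  by have := ler_norm x0; lra.
have D1 := derivable_under_integral measurableT I0 intf derf G0 iG Gub.
have D2 := differentiation_under_integral measurableT I0 intf derf G0 iG Gub.
apply: DeriveDef; first exact: D1.
rewrite -derive1E [LHS]D2; apply: (f_equal fine); apply: eq_integral => u _; congr EFin.
by rewrite partial1of2E; have [_ ->] := df u x0.
Qed.

(** Linear response: differentiating the exponential weight inserts the signal, and the quotient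
    rule subtracts the product of means, which leaves a posterior covariance. *)
Lemma dcoord_avg a h k : (k < n)%N -> mom Pu h ->
  dcoord k (avg a h) (fun w => (avg a (fun u => h u * sig t a u k) w
     - avg a h w * avg a (fun u => sig t a u k) w) / sd k ^+ 2).
Proof.
move=> kn mh.
have ms : mom Pu (fun u => sig t a u k) by rewrite /sig; mom_tac.
have sk : sd k != 0 by rewrite gt_eqF// sd0.
have dZ : dcoord k (Zn a) (num a (fun u => sig t a u k / sd k ^+ 2)).
  have := dcoord_num a kn (mom_cst Pu 1); congr dcoord; apply/funext => w.
    by rewrite Zn_num.
  by congr Ex; apply/funext => u; rewrite mul1r.
have Z0 w : Zn a w != 0 by rewrite gt_eqF// Zn_gt0.
have := dcoordM (dcoord_num a kn mh) (dcoordV Z0 dZ).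
congr dcoord; apply/funext => w.
have E (g : U -> R) : mom Pu g -> num a (fun u => g u / sd k ^+ 2) w = avg a g w * Zn a w / sd k ^+ 2.
  move=> mg; rewrite /avg divfK//.
  rewrite /num -[RHS]mulrC -ExZl; last exact: mom_lik.
  by congr Ex; apply/funext => u; rewrite mulrAC mulrC.
have -> : (fun u => h u * (sig t a u k / sd k ^+ 2)) = (fun u => (h u * sig t a u k) / sd k ^+ 2).
  by apply/funext => u; rewrite mulrA.
rewrite !E//; last by mom_tac.
have -> : num a h w = avg a h w * Zn a w by rewrite /avg divfK.
by field; rewrite Z0 sk.
Qed.

(** The noise coordinate is the observation minus the signal, and for a fixed signal a function of
    the observation has the same derivative in the noise as in the observation. *)
Lemma joint_stein a k (phi phi' : seqR R -> R) : (k < n)%N ->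
  dcoord k phi phi' -> ccoord k phi' ->
  mom (joint a) (fun p => phi p.2) -> mom (joint a) (fun p => phi' p.2) ->
  Ex (joint a) (fun p => p.2 k * phi p.2) =
  Ex (joint a) (fun p => sig t a p.1 k * phi p.2) + sd k ^+ 2 * Ex (joint a) (fun p => phi' p.2).
Proof.
move=> kn df cf mf mf'.
have mk := mom_joint_obs sd0 mt a kn.
have ms : mom (joint a) (fun p => sig t a p.1 k).
  by rewrite /sig; apply: momM; [exact: mom_cst|exact: (mom_joint_fst n sd mt a (mt k))].
have mko : mom (joint a) (fun p => p.2 k * phi p.2) by exact: momM.
have mso : mom (joint a) (fun p => sig t a p.1 k * phi p.2) by exact: momM.
suff : Ex (joint a) (fun p => (p.2 k - sig t a p.1 k) * phi p.2) = sd k ^+ 2 * Ex (joint a) (fun p => phi' p.2).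
  move=> <-; rewrite -ExD//; last by mom_tac.
  by congr Ex; apply/funext => p; ring.
have mxo : mom (joint a) (fun p => (p.2 k - sig t a p.1 k) * phi p.2) by mom_tac.
rewrite (Ex_image mxo) (Ex_image mf') /=.
pose F (q : U * seqR R) := phi (addv n q.2 (sig t a q.1)).
pose F' (q : U * seqR R) := phi' (addv n q.2 (sig t a q.1)).
have mF : mom (pprod Pu PW) F := mom_imageP mf.
have mF' : mom (pprod Pu PW) F' := mom_imageP mf'.
have aE b v x : addv n (upd k (v, x)) (sig t a b) = upd k (addv n v (sig t a b), x + sig t a b k).
  by apply/funext => i; rewrite /addv /upd/=; case: eqP => // ->; rewrite kn.
have dF b v (x : R) : is_derive (x : R) 1 (fun x => F (b, upd k (v, x))) (F' (b, upd k (v, x))).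
  have -> : (fun x => F (b, upd k (v, x))) =
     (fun x => phi (upd k (addv n v (sig t a b), x))) \o (fun x => x + sig t a b k).
    by apply/funext => y; rewrite /F/= aE.
  have dg : is_derive x 1 (fun x : R => x + sig t a b k) 1.
    by apply: is_derive_eq (is_deriveD (is_derive_id x 1) (is_derive_cst _ x 1)) _; rewrite addr0.
  apply: is_derive_eq (is_derive1_comp (df _ _) dg) _.
  by rewrite mulr1 /F' aE.
have cF' b v : continuous (fun x : R => F' (b, upd k (v, x))).
  have -> : (fun x => F' (b, upd k (v, x))) =
     (fun x => phi' (upd k (addv n v (sig t a b), x))) \o (fun x => x + sig t a b k).
    by apply/funext => y; rewrite /F'/= aE.
  move=> x; apply: continuous_comp; last exact: cf.
  by apply: cvgD; [exact: cvg_id|exact: cvg_cst].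
rewrite -(gs_stein (PB := Pu) (mean := fun=> 0) kn (sd0 kn) dF cF' mF mF').
congr Ex; apply/funext => q; rewrite /F /obs/= {1}/addv kn subr0.
by rewrite addrK.
Qed.

(** By [nishimori] the mean of [avg a h * h] equals that of the squared posterior mean. *)
Lemma mse_joint a h : mom Pu h ->
  Ex (joint a) (fun p => (h p.1 - avg a h p.2) ^+ 2) =
  Ex Pu (fun u => h u ^+ 2) - Ex (joint a) (fun p => avg a h p.2 ^+ 2).
Proof.
move=> mh.
have mav : mom (joint a) (fun p => avg a h p.2) by exact: mom_avg.
have mh1 : mom (joint a) (fun p => h p.1) := mom_joint_fst n sd mt a mh.
have mh2 : mom Pu (fun u => h u ^+ 2) by mom_tac.
rewrite -(Ex_joint_fst n sd mt a mh2).
have E := nishimori sd0 mav mh.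
have -> : (fun p : U * seqR R => (h p.1 - avg a h p.2) ^+ 2) =
  (fun p => (h p.1 ^+ 2 - 2 * (avg a h p.2 * h p.1)) + avg a h p.2 ^+ 2).
  by apply/funext => p; ring.
have m1 : mom (joint a) (fun p => h p.1 ^+ 2) by mom_tac.
rewrite ExD ?ExB ?ExZl ?E//; try by mom_tac.
have -> : (fun p : U * seqR R => avg a h p.2 * avg a h p.2) = (fun p => avg a h p.2 ^+ 2).
  by apply/funext => p; rewrite expr2.
by ring.
Qed.

End ModelCalculus.

(** * Two independent observations of the same signal *)

Section Improvement.
Context d (U : measurableType d) (R : realType).
Variables (Pu : probability U R) (n : nat) (sd : nat -> R) (t : U -> seqR R).
Hypothesis sd0 : forall k, (k < n)%N -> 0 < sd k.
Hypothesis mt : forall k, mom Pu (fun u => t u k).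
Notation PW := (gs n (fun=> 0) sd).
Notation lik := (lik n sd t).
Notation num := (num Pu n sd t).
Notation avg := (avg Pu n sd t).
Notation Zn := (Zn Pu n sd t).
Notation joint a := (joint n sd mt a).
Implicit Types (a : R) (h : U -> R).

Definition obs2 a2 (p : (U * seqR R) * seqR R) : (U * seqR R) * seqR R :=
  (p.1, addv n p.2 (sig t a2 p.1.1)).

Lemma measurable_obs2 a2 : measurable_fun setT (obs2 a2).
Proof.
apply: measurable_fun_pair => //; apply: measurable_addv => //.
apply: (measurableT_comp (measurable_sig mt a2)).
exact: (measurableT_comp measurable_fst measurable_fst).
Qed.

Definition joint2 a1 a2 : probability ((U * seqR R) * seqR R)%type R :=
  image_prob (pprod (joint a1) PW) (measurable_obs2 a2).

Lemma llr_comb a1 a2 a u w1 w2 : 0 < a -> a ^+ 2 = a1 ^+ 2 + a2 ^+ 2 ->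
  llr n sd (sig t a u) (comb (a1 / a) (a2 / a) (w1, w2)) =
  llr n sd (sig t a1 u) w1 + llr n sd (sig t a2 u) w2.
Proof.
move=> a0 aa; rewrite /llr -big_split/=; apply: eq_bigr => k _.
have sk : sd k != 0 by rewrite gt_eqF// sd0.
rewrite /comb /sig/= !exprMn aa; field.
by rewrite sk gt_eqF.
Qed.

(* Under the noise law, (a1 w1 + a2 w2) / a is again noise, and it is a sufficient statistic
   for the two observations. *)
Lemma bayes_improve a1 a2 a h (phi : seqR R * seqR R -> R) :
  0 < a2 -> 0 < a -> a ^+ 2 = a1 ^+ 2 + a2 ^+ 2 -> mom Pu h -> measurable_fun setT phi ->
  mom (joint2 a1 a2) (fun p => (h p.1.1 - phi (p.1.2, p.2)) ^+ 2) ->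
  Ex (joint a) (fun p => (h p.1 - avg a h p.2) ^+ 2) <=
  Ex (joint2 a1 a2) (fun p => (h p.1.1 - phi (p.1.2, p.2)) ^+ 2).
Proof.
move=> a20 a0 aa mh mphi mF.
have mav : mom (joint a) (fun p => avg a h p.2) by exact: mom_avg.
have mh1 : mom (joint a) (fun p => h p.1) := mom_joint_fst n sd mt a mh.
have mE : mom (joint a) (fun p => (h p.1 - avg a h p.2) ^+ 2) by mom_tac.
rewrite -lee_fin (EFin_Ex mE) (EFin_Ex mF).
have mEE : measurable_fun setT (fun p : U * seqR R => ((h p.1 - avg a h p.2) ^+ 2)%:E).
  by apply/measurable_EFinP; exact: mom_meas mE.
have E0 p : (0 <= ((h p.1 - avg a h p.2) ^+ 2)%:E)%E by rewrite lee_fin sqr_ge0.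
rewrite (ge0_integral_joint sd0 mt a mEE E0).
have mFE : measurable_fun setT (fun p : (U * seqR R) * seqR R =>
   ((h p.1.1 - phi (p.1.2, p.2)) ^+ 2)%:E).
  by apply/measurable_EFinP; exact: mom_meas mF.
have F0 p : (0 <= ((h p.1.1 - phi (p.1.2, p.2)) ^+ 2)%:E)%E by rewrite lee_fin sqr_ge0.
pose F (p : (U * seqR R) * seqR R) : \bar R := ((h p.1.1 - phi (p.1.2, p.2)) ^+ 2)%:E.
rewrite (ge0_integral_image _ (measurable_obs2 a2) mFE F0).
have mFo := measurableT_comp mFE (measurable_obs2 a2).
rewrite (@fubini_tonelli1 _ _ _ _ _ (joint a1) PW _ mFo (fun p => F0 _)).
pose F1 (q : U * seqR R) := (\int[PW]_w (F (q, w) * (lik a2 q.1 w)%:E))%E.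
have mFl : measurable_fun setT (fun p : (U * seqR R) * seqR R => (F p * (lik a2 p.1.1 p.2)%:E)%E).
  apply: emeasurable_funM => //; apply/measurable_EFinP.
  apply: (measurable_lik n sd mt a2); last exact: measurable_snd.
  exact: (measurableT_comp measurable_fst measurable_fst).
have Fl0 p : (0 <= F p * (lik a2 p.1.1 p.2)%:E)%E.
  by apply: mule_ge0; [exact: F0|rewrite lee_fin lik_ge0].
have mF1 : measurable_fun setT F1.
  exact: (@measurable_fun_fubini_tonelli_F _ _ _ _ _ PW _ mFl Fl0).
have F10 q : (0 <= F1 q)%E by apply: integral_ge0 => w _; exact: (Fl0 (q, w)).
have -> : (\int[joint a1]_q fubini_F PW
    ((fun p => ((h p.1.1 - phi (p.1.2, p.2)) ^+ 2)%:E) \o obs2 a2) q = \int[joint a1]_q F1 q)%E.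
  apply: eq_integral => q _.
  exact: (@ge0_integral_gs_shift _ n sd (sig t a2 q.1) (fun w => F (q, w)) sd0
    (measurableT_comp mFE (measurable_pair1 q)) (fun w => F0 _)).
rewrite (ge0_integral_joint sd0 mt a1 mF1 F10).
pose V (z : seqR R) := (\int[Pu]_u (((h u - avg a h z) ^+ 2)%:E * (lik a u z)%:E))%E.
have V0 z : (0 <= V z)%E.
  by apply: integral_ge0 => u _; rewrite mule_ge0 ?lee_fin ?sqr_ge0 ?lik_ge0.
have mV : measurable_fun setT V.
  apply: (@measurable_fun_fubini_tonelli_G _ _ _ _ _ Pu
    (fun p : U * seqR R => (((h p.1 - avg a h p.2) ^+ 2)%:E * (lik a p.1 p.2)%:E)%E)).
    apply: emeasurable_funM => //; apply/measurable_EFinP.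
    exact: (measurable_lik n sd mt a).
  by move=> p; rewrite mule_ge0 ?lee_fin ?sqr_ge0 ?lik_ge0.
have c1c2 : (a1 / a) ^+ 2 + (a2 / a) ^+ 2 = 1.
  by rewrite !expr_div_n -mulrDl -aa divff// expf_neq0// gt_eqF.
have c20 : 0 < a2 / a by rewrite divr_gt0.
(* The noise of the single observation is written as a combination of two independent copies; it
   remains to compare the integrands for fixed [w1] and [w2]. *)
rewrite -(@ge0_integral_gs_conv _ n sd (a1 / a) (a2 / a) V sd0 c20 c1c2 mV V0).
apply: ge0_ae_le_integral_any.
- by move=> w1; apply: integral_ge0 => w2 _; exact: V0.
- move=> w1; apply: integral_ge0 => u _; apply: mule_ge0; first exact: F10.
  by rewrite lee_fin lik_ge0.
apply: aeW => w1.
pose H (p : U * seqR R) := (F ((p.1, w1), p.2) * (lik a2 p.1 p.2)%:E * (lik a1 p.1 w1)%:E)%E.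
have H0 p : (0 <= H p)%E by rewrite mule_ge0 ?(Fl0 ((p.1, w1), p.2))// lee_fin lik_ge0.
have mH : measurable_fun setT H.
  apply: emeasurable_funM.
    have mq : measurable_fun setT (fun p : U * seqR R => ((p.1, w1), p.2)).
      by apply: measurable_fun_pair => //; exact: measurable_fun_pair.
    exact: (measurableT_comp mFl mq).
  by apply/measurable_EFinP; exact: (measurable_lik n sd mt a1).
have -> : (\int[Pu]_u (F1 (u, w1) * (lik a1 u w1)%:E) = \int[Pu]_u \int[PW]_w H (u, w))%E.
  apply: eq_integral => u _; rewrite muleC -ge0_integralZl//.
  all: try by [exact: (measurableT_comp mFl (measurable_pair1 (u, w1)))
    | move=> w _; exact: (Fl0 ((u, w1), w)) | rewrite lee_fin lik_ge0].
  by apply: eq_integral => w _; rewrite /H muleC.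
rewrite (@fubini_tonelli _ _ _ _ _ Pu PW H mH H0).
apply: ge0_ae_le_integral_any.
- by move=> w2; exact: V0.
- by move=> w2; apply: integral_ge0 => u _; exact: H0.
apply: aeW => w2.
set z := comb (a1 / a) (a2 / a) (w1, w2); set c := phi (w1, w2).
have -> : (\int[Pu]_u H (u, w2) = \int[Pu]_u (((h u - c) ^+ 2)%:E * (lik a u z)%:E))%E.
  apply: eq_integral => u _; rewrite /H /F/= -!EFinM; congr (_%:E); rewrite -mulrA; congr (_ * _).
  by rewrite /lik -expRD /z llr_comb// addrC.
have mc (e : R) : mom Pu (fun u => (h u - e) ^+ 2).
  by apply: momX; apply: momB => //; exact: mom_cst.
have numE (e : R) : (\int[Pu]_u (((h u - e) ^+ 2)%:E * (lik a u z)%:E) =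
    (num a (fun u => (h u - e) ^+ 2) z)%:E)%E.
  by rewrite (EFin_Ex (mom_lik sd0 mt a z (mc e))).
rewrite /V !numE lee_fin.
have navg (g : U -> R) : num a g z = avg a g z * Zn a z.
  by rewrite /avg divfK// gt_eqF// (Zn_gt0 sd0 mt).
(* Both sides are now quadratic losses under one and the same posterior, minimal at the posterior
   mean. *)
rewrite !navg ler_pM2r ?(Zn_gt0 sd0 mt)// !(avg_var sd0 mt)//.
by have := sqr_ge0 (avg a h z - c); nra.
Qed.

(** [bayes_improve] for the estimator that ignores the second observation. *)
Lemma avg2_mono a1 a2 a h : 0 < a2 -> 0 < a -> a ^+ 2 = a1 ^+ 2 + a2 ^+ 2 -> mom Pu h ->
  Ex (joint a1) (fun p => avg a1 h p.2 ^+ 2) <= Ex (joint a) (fun p => avg a h p.2 ^+ 2).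
Proof.
move=> a20 a0 aa mh.
have mE : mom (joint a1) (fun p => (h p.1 - avg a1 h p.2) ^+ 2).
  have := mom_avg sd0 mt a1 mh; have := mom_joint_fst n sd mt a1 mh.
  by move=> m1 m2; mom_tac.
have mphi : measurable_fun setT (fun q : seqR R * seqR R => avg a1 h q.1).
  apply: (measurableT_comp _ measurable_fst); exact: (measurable_avg sd0 mt a1 mh).
have mE2 : mom (joint2 a1 a2) (fun p => (h p.1.1 - avg a1 h p.1.2) ^+ 2).
  apply: mom_image; last exact: (mom_fst PW mE).
  exact: (measurableT_comp (mom_meas mE) measurable_fst).
have E : Ex (joint2 a1 a2) (fun p => (h p.1.1 - avg a1 h p.1.2) ^+ 2) =
    Ex (joint a1) (fun p => (h p.1 - avg a1 h p.2) ^+ 2).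
  by rewrite (Ex_image mE2); exact: (Ex_fst PW mE).
have H : Ex (joint a) (fun p => (h p.1 - avg a h p.2) ^+ 2) <=
    Ex (joint a1) (fun p => (h p.1 - avg a1 h p.2) ^+ 2).
  by rewrite -E; exact: (bayes_improve a20 a0 aa mh mphi mE2).
move: H; rewrite (mse_joint sd0 mt a mh) (mse_joint sd0 mt a1 mh).
by rewrite lerD2l lerN2.
Qed.

End Improvement.

(** * The spiked matrix *)

Section Indices.
Context {R : realType}.

Lemma sum_mul_ord (e d : nat) (F : nat -> R) :
  \sum_(k < e * d) F k = \sum_(i < e) \sum_(j < d) F (i * d + j)%N.
Proof.
elim: e F => [|e IH] F; first by rewrite !big_ord0.
rewrite mulSn big_split_ord/= [RHS]big_ord_recl/=; congr (_ + _).
rewrite (IH (fun k => F (d + k)%N)); apply: eq_bigr => i _; apply: eq_bigr => j _.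
by rewrite /bump/= add1n mulSn addnA.
Qed.

(** The weight 1/2 on the diagonal is the effect of the doubled variance of the diagonal GOE
    entries; it is what turns the sum over [i <= j] into half of the full sum, and so the
    log-likelihood into quadratic forms. *)
Lemma sum_upper (d : nat) (S : 'I_d -> 'I_d -> R) : (forall i j, S i j = S j i) ->
  \sum_(i < d) \sum_(j < d) (if (i <= j)%N then (if i == j then 2^-1 else 1) * S i j else 0) =
  2^-1 * \sum_(i < d) \sum_(j < d) S i j.
Proof.
move=> Ssym; set T := fun i j : 'I_d => if (i <= j)%N then (if i == j then 2^-1 else 1) * S i j else 0.
have TT i j : T i j + T j i = S i j.
  rewrite /T (eq_sym j i); case: (eqVneq i j) => [->|ij].
    by rewrite leqnn; field.
  case: (ltngtP i j) => [ij'|ij'|/val_inj ij'].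
  - by rewrite mul1r addr0.
  - by rewrite mul1r add0r Ssym.
  - by rewrite ij' eqxx in ij.
have E : \sum_i \sum_j T i j + \sum_i \sum_j T i j = \sum_i \sum_j S i j.
  rewrite [X in _ + X = _]exchange_big /= -big_split/=; apply: eq_bigr => i _.
  by rewrite -big_split/=; apply: eq_bigr => j _; exact: TT.
by rewrite -E -[LHS]/(\sum_i \sum_j T i j); field.
Qed.

Variable d : nat.
Hypothesis d0 : (0 < d)%N.

Definition idx (i j : nat) : nat := (minn i j * d + maxn i j)%N.

Lemma idxC i j : idx i j = idx j i. Proof. by rewrite /idx minnC maxnC. Qed.

Lemma idx_div (i j : 'I_d) : (idx i j %/ d)%N = minn i j.
Proof. by rewrite /idx divnMDl// divn_small ?addn0// gtn_max !ltn_ord. Qed.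

Lemma idx_mod (i j : 'I_d) : (idx i j %% d)%N = maxn i j.
Proof. by rewrite /idx modnMDl modn_small// gtn_max !ltn_ord. Qed.

Lemma idx_lt (i j : 'I_d) : (idx i j < d * d)%N.
Proof.
rewrite -(ltn_divLR _ _ d0) idx_div.
exact: leq_ltn_trans (geq_minl i j) (ltn_ord i).
Qed.

(* Upper triangular part of [u u^T], in the coordinates of the GOE matrix. *)
Definition rank1 (u : seqR R) : seqR R := fun k =>
  if (k < d * d)%N && (k %/ d <= k %% d)%N then u (k %/ d)%N * u (k %% d)%N else 0.

Lemma rank1_idx u (i j : 'I_d) : rank1 u (idx i j) = u i * u j.
Proof.
rewrite /rank1 idx_lt idx_div idx_mod.
have -> : (minn i j <= maxn i j)%N by rewrite (leq_trans (geq_minl i j))// leq_maxl.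
by rewrite /=; case: (leqP i j) => // _; rewrite mulrC.
Qed.

Lemma goe_sd_gt0 k : 0 < goe_sd d k :> R.
Proof. by rewrite /goe_sd; case: ifP => _; rewrite sqrtr_gt0 divr_gt0// ltr0n. Qed.

Lemma goe_sd2 k : goe_sd d k ^+ 2 = (if (k %/ d)%N == (k %% d)%N then 2 else 1) / d%:R :> R.
Proof. by rewrite /goe_sd; case: ifP => _; rewrite sqr_sqrtr// divr_ge0// ler0n. Qed.

Definition nrm2 (u : nat -> R) : R := \sum_(i < d) u i ^+ 2.
Definition qform (w u : nat -> R) : R := \sum_(i < d) \sum_(j < d) w (idx i j) * u i * u j.

Lemma llr_rank1 (a : R) (u w : seqR R) :
  llr (d * d) (goe_sd d) (sig rank1 a u) w =
  d%:R * a / 2 * qform w u - d%:R * a ^+ 2 / 4 * nrm2 u ^+ 2.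
Proof.
have dR : d%:R != 0 :> R by rewrite pnatr_eq0 -lt0n.
rewrite /llr (@sum_mul_ord d d (fun k => w k * sig rank1 a u k / goe_sd d k ^+ 2 -
   sig rank1 a u k ^+ 2 / (goe_sd d k ^+ 2 *+ 2))).
pose S (i j : 'I_d) := d%:R * (a * (w (idx i j) * u i * u j) - a ^+ 2 / 2 * (u i ^+ 2 * u j ^+ 2)).
have E (i j : 'I_d) : w (i * d + j)%N * sig rank1 a u (i * d + j)%N / goe_sd d (i * d + j)%N ^+ 2 -
    sig rank1 a u (i * d + j)%N ^+ 2 / (goe_sd d (i * d + j)%N ^+ 2 *+ 2) =
    if (i <= j)%N then (if i == j then 2^-1 else 1) * S i j else 0.
  have q1 : ((i * d + j) %/ d)%N = i by rewrite divnMDl// divn_small ?addn0.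
  have q2 : ((i * d + j) %% d)%N = j by rewrite modnMDl modn_small.
  have kl : (i * d + j < d * d)%N by rewrite -(ltn_divLR _ _ d0) q1.
  rewrite goe_sd2 /sig /rank1 q1 q2 kl /=; case: (leqP i j) => ij; last first.
    by rewrite !mulr0 expr0n/= !mul0r subr0.
  have -> : (i * d + j)%N = idx i j by rewrite /idx (minn_idPl ij) (maxn_idPr ij).
  rewrite -(inj_eq val_inj i j) /S; case: eqP => _; by field.
under eq_bigr => i _ do under eq_bigr => j _ do rewrite E.
rewrite sum_upper; last first.
  by move=> i j; rewrite /S idxC; ring.
under eq_bigr => i _ do rewrite -mulr_sumr sumrB -!mulr_sumr.
rewrite -mulr_sumr sumrB -!mulr_sumr.
have -> : \sum_(i < d) (u i ^+ 2 * \sum_(j < d) u j ^+ 2) = nrm2 u ^+ 2.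
  by rewrite -mulr_suml expr2.
by rewrite /qform; field.
Qed.

End Indices.

Section CoordExtra.
Context {R : realType}.

Lemma dcoord_coord k i : dcoord k (fun u : seqR R => u i) (fun=> (i == k)%:R).
Proof.
move=> w x; rewrite /upd/=; case: (i == k).
  exact: (is_derive_id x 1).
exact: (is_derive_cst _ x 1).
Qed.

Lemma dcoord_expR k (f f' : seqR R -> R) : dcoord k f f' ->
  dcoord k (fun w => expR (f w)) (fun w => f' w * expR (f w)).
Proof.
move=> df w x.
apply: is_derive_eq (is_derive1_comp (is_derive_expR (f (upd k (w, x)))) (df w x)) _.
by rewrite mulrC.
Qed.

Lemma dcoordZ k (c : R) f f' : dcoord k f f' -> dcoord k (fun w => c * f w) (fun w => c * f' w).
Proof.
move=> df; have := dcoordM (dcoord_cst k c) df; congr dcoord; apply/funext => w.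
by rewrite mul0r add0r.
Qed.

End CoordExtra.

(** * Integration by parts in the prior and in the noise *)

Section Spiked.
Context {R : realType}.
Variables (d : nat) (m a : R).
Hypothesis d0 : (0 < d)%N.

Notation Pu := (gs d (u_mean d m) (u_sd d)).
Notation n := (d * d)%N.
Notation sd := (goe_sd d).
Notation t := (@rank1 R d).

Let sd0 k : (k < n)%N -> 0 < sd k :> R. Proof. by move=> _; exact: goe_sd_gt0. Qed.

Lemma u_sd_gt0 k : 0 < u_sd d k :> R.
Proof. by rewrite /u_sd sqrtr_gt0 divr_gt0// ltr0n. Qed.

Lemma u_sd2 k : u_sd d k ^+ 2 = d%:R^-1 :> R.
Proof. by rewrite /u_sd sqr_sqrtr ?mul1r// mul1r invr_ge0 ler0n. Qed.

Lemma mom_u (i : 'I_d) : mom Pu (fun u => u i).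
Proof. by apply: mom_gs_coord => //; exact: u_sd_gt0. Qed.

Lemma mom_rank1 k : mom Pu (fun u => t u k).
Proof.
rewrite /rank1; case: (ltnP k n) => [kn|_]; last exact: mom_cst.
case: (leqP (k %/ d) (k %% d)) => _ /=; last exact: mom_cst.
have k1 : (k %/ d < d)%N by rewrite ltn_divLR.
have k2 : (k %% d < d)%N by rewrite ltn_mod.
by apply: momM; [exact: (mom_u (Ordinal k1))|exact: (mom_u (Ordinal k2))].
Qed.

Definition Jt : probability (seqR R * seqR R)%type R := joint n sd mom_rank1 a.
Notation J := Jt.
Definition post (h : seqR R -> R) (w : seqR R) : R := avg Pu n sd t a h w.

Lemma lik_rank1 u w : lik n sd t a u w =
  expR (d%:R * a / 2 * qform d w u - d%:R * a ^+ 2 / 4 * nrm2 d u ^+ 2).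
Proof. by rewrite /lik llr_rank1. Qed.

Lemma mom_nrm2 : mom Pu (nrm2 d).
Proof. by have := mom_u; rewrite /nrm2 => mu; mom_tac. Qed.

(** Integration by parts in [u i] under the prior, applied to the likelihood. The derivative of the
    log-likelihood is [H'], and the prior variance [1 / d] cancels its factor [d]. *)
Lemma post_stein w (i : 'I_d) :
  post (fun u => u i) w - m / Num.sqrt d%:R =
  a * (\sum_(j < d) w (idx d i j) * post (fun u => u j) w) - a ^+ 2 * post (fun u => nrm2 d u * u i) w.
Proof.
have mu := mom_u; have mn := mom_nrm2.
have dR : d%:R != 0 :> R by rewrite pnatr_eq0 -lt0n.
pose H' (u : seqR R) := d%:R * a * (\sum_(j < d) w (idx d i j) * u j) - d%:R * a ^+ 2 * (nrm2 d u * u i).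
have sumd (F : 'I_d -> R) : \sum_(j < d) F j * (j == i :> nat)%:R = F i.
  rewrite (bigD1 i)//= eqxx mulr1 big1 ?addr0// => j ji.
  by rewrite (negbTE (ji : val j != val i)) mulr0.
have dnrm : dcoord i (nrm2 d : seqR R -> R) (fun u => 2 * u i).
  have := @dcoord_sum R i 'I_d (index_enum 'I_d) (fun j u => u j * u j) _
     (fun j => dcoordM (dcoord_coord i j) (dcoord_coord i j)).
  congr dcoord; apply/funext => u.
  rewrite -[RHS](sumd (fun j => 2 * u j)); apply: eq_bigr => j _; ring.
have dq : dcoord i (fun u : seqR R => qform d w u) (fun u => 2 * \sum_(j < d) w (idx d i j) * u j).
  have := @dcoord_sum R i 'I_d (index_enum 'I_d) _ _ (fun j => @dcoord_sum R i 'I_d (index_enum 'I_d)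
     (fun l u => w (idx d j l) * u j * u l) _
     (fun l => dcoordM (dcoordZ (w (idx d j l)) (dcoord_coord i j)) (dcoord_coord i l))).
  congr dcoord; apply/funext => u.
  under eq_bigr => j _ do rewrite big_split/= sumd.
  rewrite big_split/= mulr2n mulrDl mul1r; congr (_ + _).
    under eq_bigr => j _.
      rewrite (_ : \sum_(l < d) _ = (\sum_(l < d) w (idx d j l) * u l) * (j == i :> nat)%:R); last first.
        rewrite [RHS]mulr_suml; apply: eq_bigr => l _; ring.
      over.
    by rewrite sumd.
  by apply: eq_bigr => j _; rewrite idxC.
pose L (u : seqR R) := lik n sd t a u w.
have dL : dcoord i L (fun u => H' u * L u).
  have := dcoord_expR (dcoordB (dcoordZ (d%:R * a / 2) dq)
    (dcoordZ (d%:R * a ^+ 2 / 4) (dcoordM dnrm dnrm))).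
  congr dcoord; apply/funext => u; rewrite /L lik_rank1 expr2//.
  by congr (_ * _); rewrite /H'; field.
have cH : ccoord i H'.
  apply: ccoordB; apply: ccoordM; try exact: ccoord_cst.
    apply: ccoord_sum => j; apply: ccoordM; first exact: ccoord_cst.
    exact: dcoord_ccoord (dcoord_coord i j).
  apply: ccoordM; first exact: dcoord_ccoord dnrm.
  exact: dcoord_ccoord (dcoord_coord i i).
have cL : ccoord i (fun u => H' u * L u) by apply: ccoordM => //; exact: dcoord_ccoord dL.
have mH : mom Pu H' by rewrite /H'; mom_tac.
have mL := momlik sd0 mom_rank1 a w.
have mHL := mom_lik sd0 mom_rank1 a w mH.
have mxL : mom Pu (fun u => (u i - m / Num.sqrt d%:R) * L u).
  have mx : mom Pu (fun u => u i - m / Num.sqrt d%:R) by mom_tac.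
  exact: (mom_lik sd0 mom_rank1 a w mx).
have := gs_stein (PB := Pu) (F := fun p => L p.2) (F' := fun p => H' p.2 * L p.2)
  (ltn_ord i) (u_sd_gt0 i) (fun _ => dL) (fun _ => cL) (mom_snd Pu mL) (mom_snd Pu mHL).
rewrite (Ex_snd Pu mHL) u_sd2.
have -> : Ex (pprod Pu Pu) (fun p => (p.2 i - u_mean d m i) * L p.2) =
    Ex Pu (fun u => (u i - m / Num.sqrt d%:R) * L u) := Ex_snd Pu mxL.
move=> E.
have E2 : post (fun u => u i - m / Num.sqrt d%:R) w = d%:R^-1 * post H' w.
  by rewrite /post /avg mulrA; congr (_ / _); exact: E.
move: E2; rewrite /post.
have -> : avg Pu n sd t a (fun u => u i - m / Num.sqrt d%:R) w =
    avg Pu n sd t a (fun u => u i) w - m / Num.sqrt d%:R.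
  rewrite (avgB sd0 mom_rank1 a w (mu i) (mom_cst Pu (m / Num.sqrt d%:R))).
  by rewrite (avg_cst sd0 mom_rank1).
move=> ->; rewrite /H' (avgB sd0 mom_rank1); [|by mom_tac..].
rewrite !(avgZ sd0 mom_rank1); [|by mom_tac..].
rewrite (avg_sum sd0 mom_rank1); last by move=> j _; mom_tac.
under eq_bigr => j _ do rewrite (avgZ sd0 mom_rank1)//.
by field.
Qed.

End Spiked.

Section SpikedIdentity.
Context {R : realType}.
Variables (d : nat) (m a : R).
Hypothesis d0 : (0 < d)%N.

Notation Pu := (gs d (u_mean d m) (u_sd d)).
Notation n := (d * d)%N.
Notation sd := (goe_sd d).
Notation t := (@rank1 R d).
Notation J := (Jt m a d0).
Notation post := (post d m a).
Notation mt := (mom_rank1 m d0).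

Let sd0 k : (k < n)%N -> 0 < sd k :> R. Proof. by move=> _; exact: goe_sd_gt0. Qed.

Definition pm (i : nat) (w : seqR R) : R := post (fun u => u i) w.
Definition pmsq (w : seqR R) : R := \sum_(i < d) pm i w ^+ 2.
(** Overlap of the posterior mean with the signal. Its conditional mean given the observation is
    [pmsq]. *)
Definition ovl (p : seqR R * seqR R) : R := \sum_(i < d) pm i p.2 * p.1 i.

Lemma mom_pm (i : 'I_d) : mom J (fun p => pm i p.2).
Proof. exact: (mom_avg sd0 mt a (mom_u m d0 i)). Qed.

Lemma mom_J1 (i : 'I_d) : mom J (fun p => p.1 i).
Proof. exact: (mom_joint_fst n sd mt a (mom_u m d0 i)). Qed.

Lemma mom_J2 (i j : 'I_d) : mom J (fun p => p.2 (idx d i j)).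
Proof. exact: (mom_joint_obs sd0 mt a (idx_lt d0 i j)). Qed.

Lemma mom_pmsq : mom J (fun p => pmsq p.2).
Proof. by have := mom_pm; rewrite /pmsq => mb; mom_tac. Qed.

Lemma mom_ovl : mom J ovl.
Proof. by have := mom_pm; have := mom_J1; rewrite /ovl => mb mu; mom_tac. Qed.

Lemma mom_Jnrm2 : mom J (fun p => nrm2 d p.1).
Proof. exact: (mom_joint_fst n sd mt a (mom_nrm2 m d0)). Qed.

Lemma nishi (f h : seqR R -> R) : mom J (fun p => f p.2) -> mom Pu h ->
  Ex J (fun p => f p.2 * post h p.2) = Ex J (fun p => f p.2 * h p.1).
Proof. by move=> mf mh; rewrite (nishimori sd0 mf mh). Qed.

(** Differentiating posterior means in the observation produces the posterior averages [A] and [S].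
    They appear multiplied by functions of the observation only, so [nishi] replaces them by the
    signal, and a polynomial in signal and posterior mean remains. *)
Lemma stein_entry (q : R) (i j : 'I_d) :
  Ex J (fun p => p.2 (idx d i j) * (pm i p.2 * pm j p.2 * (pmsq p.2 - q))) =
  Ex J (fun p => a * (p.1 i * p.1 j) * (pm i p.2 * pm j p.2 * (pmsq p.2 - q) +
     pm j p.2 * (pmsq p.2 - q) * p.1 i + pm i p.2 * (pmsq p.2 - q) * p.1 j +
     2 * (pm i p.2 * pm j p.2) * ovl p - 2 * (pm i p.2 * pm j p.2) * (pmsq p.2 - q)
     - 2 * (pm i p.2 * pm j p.2) * pmsq p.2)).
Proof.
set k := idx d i j; have kn : (k < n)%N := idx_lt d0 i j.
have mb := mom_pm; have mX := mom_pmsq; have mu1 := mom_J1; have mR := mom_ovl.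
have mu := mom_u m d0.
pose s u := sig t a u k.
have sE u : s u = a * (u i * u j) by rewrite /s /sig rank1_idx.
have ms : mom Pu s by rewrite /s /sig; apply: momM; [exact: mom_cst|exact: (mt k)].
have ms1 : mom J (fun p => s p.1) := mom_joint_fst n sd mt a ms.
pose A (l : nat) w := post (fun u => u l * s u) w.
pose S w := post s w.
have mus (l : 'I_d) : mom Pu (fun u => u l * s u) by apply: momM.
have mA (l : 'I_d) : mom J (fun p => A l p.2) := mom_avg sd0 mt a (mus l).
have mS : mom J (fun p => S p.2) := mom_avg sd0 mt a ms.
pose B (l : nat) w := (A l w - pm l w * S w) / sd k ^+ 2.
have dpm (l : 'I_d) : dcoord k (pm l) (B l) := dcoord_avg sd0 mt a kn (mu l).
have cA (l : 'I_d) : ccoord k (A l) := dcoord_ccoord (dcoord_avg sd0 mt a kn (mus l)).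
have cS : ccoord k S := dcoord_ccoord (dcoord_avg sd0 mt a kn ms).
have cpm (l : 'I_d) : ccoord k (pm l) := dcoord_ccoord (dpm l).
have cB (l : 'I_d) : ccoord k (B l).
  by apply: ccoordM; [apply: ccoordB => //; exact: ccoordM|exact: ccoord_cst].
have mB (l : 'I_d) : mom J (fun p => B l p.2) by rewrite /B; mom_tac.
have dX : dcoord k pmsq (fun w => \sum_(l < d) (B l w * pm l w + pm l w * B l w)).
  have := @dcoord_sum R k 'I_d (index_enum 'I_d) _ _ (fun l => dcoordM (dpm l) (dpm l)).
  by congr dcoord; apply/funext => w; rewrite /pmsq; apply: eq_bigr => l _; rewrite expr2.
pose phi w := pm i w * pm j w * (pmsq w - q).
pose phi' w := (B i w * pm j w + pm i w * B j w) * (pmsq w - q) +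
  pm i w * pm j w * (\sum_(l < d) (B l w * pm l w + pm l w * B l w) - 0).
have dphi : dcoord k phi phi' :=
  dcoordM (dcoordM (dpm i) (dpm j)) (dcoordB dX (dcoord_cst k q)).
have cphi : ccoord k phi'.
  apply: ccoordD; apply: ccoordM.
  - by apply: ccoordD; exact: ccoordM.
  - by apply: ccoordB; [exact: dcoord_ccoord dX|exact: ccoord_cst].
  - exact: ccoordM.
  - apply: ccoordB; last exact: ccoord_cst.
    by apply: ccoord_sum => l; apply: ccoordD; exact: ccoordM.
have mphi : mom J (fun p => phi p.2) by rewrite /phi; mom_tac.
have mphi' : mom J (fun p => phi' p.2) by rewrite /phi'; mom_tac.
apply: (etrans (joint_stein sd0 kn dphi cphi mphi mphi')).
rewrite -ExZl//.
have sk : sd k != 0 :> R by rewrite gt_eqF// goe_sd_gt0.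
(* Collects the subtracted halves of all the covariances: the first term comes from differentiating
   [pm i] and [pm j], the second from differentiating [pmsq]. *)
pose G w := 2 * (pm i w * pm j w) * (pmsq w - q) + 2 * (pm i w * pm j w) * pmsq w.
have mG : mom J (fun p => G p.2) by rewrite /G; mom_tac.
have -> : (fun p : seqR R * seqR R => sd k ^+ 2 * phi' p.2) =
   (fun p => ((pm j p.2 * (pmsq p.2 - q)) * A i p.2 + (pm i p.2 * (pmsq p.2 - q)) * A j p.2 +
     \sum_(l < d) (2 * (pm i p.2 * pm j p.2) * pm l p.2) * A l p.2) - G p.2 * S p.2).
  apply/funext => p; set w := p.2.
  have E : \sum_(l < d) (B l w * pm l w + pm l w * B l w) =
     (2 * (\sum_(l < d) pm l w * A l w) - 2 * pmsq w * S w) / sd k ^+ 2.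
    rewrite mulr_sumr -mulrA mulr_suml mulr_sumr -sumrB mulr_suml.
    by apply: eq_bigr => l _; rewrite /B; ring.
  have E2 : \sum_(l < d) (2 * (pm i w * pm j w) * pm l w) * A l w =
     2 * (pm i w * pm j w) * (\sum_(l < d) pm l w * A l w).
    by rewrite mulr_sumr; apply: eq_bigr => l _; ring.
  by rewrite /phi' E E2 /G /B; field.
have mf1 : mom J (fun p => pm j p.2 * (pmsq p.2 - q)) by mom_tac.
have mf2 : mom J (fun p => pm i p.2 * (pmsq p.2 - q)) by mom_tac.
have mf3 (l : 'I_d) : mom J (fun p => 2 * (pm i p.2 * pm j p.2) * pm l p.2) by mom_tac.
have mus1 (l : 'I_d) : mom J (fun p => p.1 l * s p.1) := mom_joint_fst n sd mt a (mus l).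
have N1 := nishi (f := fun w => pm j w * (pmsq w - q)) mf1 (mus i).
have N2 := nishi (f := fun w => pm i w * (pmsq w - q)) mf2 (mus j).
have N3 (l : 'I_d) := nishi (f := fun w => 2 * (pm i w * pm j w) * pm l w) (mf3 l) (mus l).
have N4 := nishi mG ms.
rewrite ExB; [|by mom_tac..]; rewrite ExD; [|by mom_tac..]; rewrite ExD; [|by mom_tac..].
rewrite Ex_sum; last by move=> l _; mom_tac.
rewrite N1 N2 N4; under eq_bigr => l _ do rewrite N3.
rewrite -Ex_sum; last by move=> l _; mom_tac.
rewrite -ExD; [|by mom_tac..]; rewrite -ExD; [|by mom_tac..]; rewrite -ExB; [|by mom_tac..].
rewrite -ExD; [|by mom_tac..].
congr Ex; apply/funext => p; set w := p.2.
have E2 : \sum_(l < d) (2 * (pm i w * pm j w) * pm l w) * (p.1 l * s p.1) =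
   2 * (pm i w * pm j w) * ovl p * s p.1.
  rewrite /ovl -mulrA mulr_suml mulr_sumr; apply: eq_bigr => l _.
  by rewrite -/w; ring.
by rewrite E2 /G /phi -/(s p.1) !sE; ring.
Qed.

Lemma sum2_mul (al be : 'I_d -> R) : \sum_(i < d) \sum_(j < d) al i * be j = (\sum_(i < d) al i) * (\sum_(j < d) be j).
Proof. by rewrite mulr_suml; apply: eq_bigr => i _; rewrite mulr_sumr. Qed.

Lemma stein_quadratic (q : R) :
  Ex J (fun p => (\sum_(i < d) \sum_(j < d) p.2 (idx d i j) * pm i p.2 * pm j p.2) * (pmsq p.2 - q)) =
  a * Ex J (fun p => (2 * (nrm2 d p.1 * ovl p) - ovl p ^+ 2) * (pmsq p.2 - q)
     + 2 * (ovl p ^+ 3 - pmsq p.2 * ovl p ^+ 2)).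
Proof.
have mb := mom_pm; have mX := mom_pmsq; have mu1 := mom_J1; have mR := mom_ovl.
have mw := mom_J2; have mn := mom_Jnrm2.
transitivity (\sum_(i < d) \sum_(j < d) Ex J (fun p => p.2 (idx d i j) * (pm i p.2 * pm j p.2 * (pmsq p.2 - q)))).
  under eq_bigr => i _.
    rewrite -Ex_sum; last by move=> j _; mom_tac.
    over.
  rewrite -Ex_sum; last by move=> i _; mom_tac.
  congr Ex; apply/funext => p; rewrite mulr_suml; apply: eq_bigr => i _.
  by rewrite mulr_suml; apply: eq_bigr => j _; rewrite !mulrA.
under eq_bigr => i _ do under eq_bigr => j _ do rewrite stein_entry.
under eq_bigr => i _.
  rewrite -Ex_sum; last by move=> j _; mom_tac.
  over.
rewrite -Ex_sum; last by move=> i _; mom_tac.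
rewrite -ExZl; last by mom_tac.
congr Ex; apply/funext => p; set w := p.2; set u := p.1.
pose c1 := a * (pmsq w - q); pose c2 := a * (2 * ovl p - (pmsq w - q) - 2 * pmsq w).
transitivity (c1 * (nrm2 d u * ovl p) + c1 * (ovl p * nrm2 d u) + c2 * (ovl p * ovl p)); last first.
  by rewrite /c1 /c2; ring.
rewrite /nrm2 /ovl -!sum2_mul -/w -/u !mulr_sumr -!big_split/=; apply: eq_bigr => i _.
rewrite !mulr_sumr -!big_split/=; apply: eq_bigr => j _.
by rewrite /c1 /c2 /ovl -/w -/u; ring.
Qed.

(* Integration by parts in the noise, against b b^T (|b|^2 - q), and in the prior, contracted with b:
   eliminating the quadratic form b^T W b leaves a relation between overlaps. *)
Lemma schwinger_dyson (q : R) :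
  Ex J (fun p => (pmsq p.2 - q) * (pmsq p.2 - m * (\sum_(i < d) p.1 i / Num.sqrt d%:R)
     - a ^+ 2 * (nrm2 d p.1 * ovl p) + a ^+ 2 * ovl p ^+ 2)) =
  2 * a ^+ 2 * Ex J (fun p => ovl p ^+ 3 - pmsq p.2 * ovl p ^+ 2).
Proof.
have mb := mom_pm; have mX := mom_pmsq; have mu1 := mom_J1; have mR := mom_ovl.
have mw := mom_J2; have mn := mom_Jnrm2; have mu := mom_u m d0; have mnu := mom_nrm2 m d0.
pose D w := pmsq w - q.
have mD : mom J (fun p => D p.2) by rewrite /D; mom_tac.
pose N3 (i : nat) w := post (fun u => nrm2 d u * u i) w.
have mnui (i : 'I_d) : mom Pu (fun u => nrm2 d u * u i) by mom_tac.
have mN3 (i : 'I_d) : mom J (fun p => N3 i p.2) := mom_avg sd0 mt a (mnui i).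
pose W (p : seqR R * seqR R) := \sum_(i < d) \sum_(j < d) p.2 (idx d i j) * pm i p.2 * pm j p.2.
have mW : mom J W by rewrite /W; mom_tac.
(* [post_stein] multiplied by [pm i w] and summed over [i]: the form of the prior identity in which
   the quadratic form appears. *)
have E w : pmsq w = \sum_(i < d) pm i w * (m / Num.sqrt d%:R) +
   a * (\sum_(i < d) \sum_(j < d) w (idx d i j) * pm i w * pm j w) -
   a ^+ 2 * \sum_(i < d) pm i w * N3 i w.
  rewrite !mulr_sumr -big_split/= -sumrB; apply: eq_bigr => i _.
  have := post_stein m a d0 w i; rewrite -/(pm i w) -/(N3 i w) => H.
  have {}H : pm i w = m / Num.sqrt d%:R + a * (\sum_(j < d) w (idx d i j) * pm j w) - a ^+ 2 * N3 i w.
    by rewrite -addrA -H addrC subrK.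
  rewrite expr2 {1}H mulrC.
  have -> : a * (\sum_(j < d) w (idx d i j) * pm i w * pm j w) =
     a * (\sum_(j < d) w (idx d i j) * pm j w) * pm i w.
    by rewrite -mulrA mulr_suml; congr (_ * _); apply: eq_bigr => j _; ring.
  by ring.
(* Under the expectation, [nishi] turns the remaining posterior averages back into the signal. *)
have E1 : Ex J (fun p => D p.2 * pmsq p.2) =
   m * Ex J (fun p => D p.2 * (\sum_(i < d) p.1 i / Num.sqrt d%:R)) + a * Ex J (fun p => W p * D p.2)
   - a ^+ 2 * Ex J (fun p => D p.2 * (nrm2 d p.1 * ovl p)).
  have -> : Ex J (fun p => D p.2 * (\sum_(i < d) p.1 i / Num.sqrt d%:R)) =
      Ex J (fun p => D p.2 * (\sum_(i < d) pm i p.2 / Num.sqrt d%:R)).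
    under [X in Ex _ X = _]eq_fun do rewrite mulr_sumr.
    under [X in _ = Ex _ X]eq_fun do rewrite mulr_sumr.
    rewrite !Ex_sum; try by move=> i _; mom_tac.
    apply: eq_bigr => i _.
    have mDs : mom J (fun p => D p.2 / Num.sqrt d%:R) by mom_tac.
    have := nishi (f := fun w => D w / Num.sqrt d%:R) mDs (mu i) => H.
    transitivity (Ex J (fun p => D p.2 / Num.sqrt d%:R * p.1 i)).
      by congr Ex; apply/funext => p; ring.
    by rewrite -H; congr Ex; apply/funext => p; rewrite /pm; ring.
  have -> : Ex J (fun p => D p.2 * (nrm2 d p.1 * ovl p)) =
      Ex J (fun p => D p.2 * \sum_(i < d) pm i p.2 * N3 i p.2).
    transitivity (Ex J (fun p => \sum_(i < d) (D p.2 * pm i p.2) * (nrm2 d p.1 * p.1 i))).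
      congr Ex; apply/funext => p; rewrite /ovl !mulr_sumr; apply: eq_bigr => i _; ring.
    under [X in _ = Ex _ X]eq_fun do rewrite mulr_sumr.
    rewrite !Ex_sum; try by move=> i _; mom_tac.
    apply: eq_bigr => i _.
    have mDs : mom J (fun p => D p.2 * pm i p.2) by mom_tac.
    rewrite -(nishi (f := fun w => D w * pm i w) mDs (mnui i)).
    by congr Ex; apply/funext => p; rewrite -/(N3 i p.2) mulrA.
  rewrite -!ExZl; [|by mom_tac..].
  rewrite -ExD; [|by mom_tac..]; rewrite -ExB; [|by mom_tac..].
  congr Ex; apply/funext => p; rewrite E -/(W p).
  have -> : m * (D p.2 * (\sum_(i < d) pm i p.2 / Num.sqrt d%:R)) =
     D p.2 * (\sum_(i < d) pm i p.2 * (m / Num.sqrt d%:R)).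
    by rewrite mulrCA mulr_sumr; congr (_ * _); apply: eq_bigr => i _; ring.
  by ring.
have E2 := stein_quadratic q; rewrite -/W in E2.
pose Y1 (p : seqR R * seqR R) := D p.2 * (\sum_(i < d) p.1 i / Num.sqrt d%:R).
pose Y2 (p : seqR R * seqR R) := D p.2 * (nrm2 d p.1 * ovl p).
pose Y3 (p : seqR R * seqR R) := D p.2 * ovl p ^+ 2.
pose Y4 (p : seqR R * seqR R) := ovl p ^+ 3 - pmsq p.2 * ovl p ^+ 2.
have mY1 : mom J Y1 by rewrite /Y1; mom_tac.
have mY2 : mom J Y2 by rewrite /Y2; mom_tac.
have mY3 : mom J Y3 by rewrite /Y3; mom_tac.
have mY4 : mom J Y4 by rewrite /Y4; mom_tac.
have {}E2 : Ex J (fun p => W p * D p.2) = a * (2 * Ex J Y2 - Ex J Y3 + 2 * Ex J Y4).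
  rewrite E2 -!ExZl; [|by mom_tac..].
  rewrite -ExB; [|by mom_tac..]; rewrite -ExD; [|by mom_tac..].
  rewrite -ExZl; last by mom_tac.
  by congr Ex; apply/funext => p; rewrite /Y2 /Y3 /Y4 /D; ring.
have -> : Ex J (fun p => (pmsq p.2 - q) * (pmsq p.2 - m * (\sum_(i < d) p.1 i / Num.sqrt d%:R)
     - a ^+ 2 * (nrm2 d p.1 * ovl p) + a ^+ 2 * ovl p ^+ 2)) =
   Ex J (fun p => D p.2 * pmsq p.2) - m * Ex J Y1 - a ^+ 2 * Ex J Y2 + a ^+ 2 * Ex J Y3.
  rewrite -!ExZl; [|by mom_tac..].
  rewrite -ExB; [|by mom_tac..]; rewrite -ExB; [|by mom_tac..]; rewrite -ExD; [|by mom_tac..].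
  by congr Ex; apply/funext => p; rewrite /Y1 /Y2 /Y3 /D; ring.
rewrite E1 E2 -/Y1 -/Y2; ring.
Qed.

End SpikedIdentity.

Section FiniteSums.
Context {R : realType}.

Lemma CS_sum (I : finType) (x y : I -> R) :
  (\sum_i x i * y i) ^+ 2 <= (\sum_i x i ^+ 2) * (\sum_i y i ^+ 2).
Proof.
set A := \sum_i x i ^+ 2; set B := \sum_i y i ^+ 2; set C := \sum_i x i * y i.
have H (s t : R) : 0 <= s ^+ 2 * A - 2 * s * t * C + t ^+ 2 * B.
  have -> : s ^+ 2 * A - 2 * s * t * C + t ^+ 2 * B = \sum_i (s * x i - t * y i) ^+ 2.
    by rewrite !mulr_sumr -sumrB -big_split/=; apply: eq_bigr => i _; ring.
  by apply: sumr_ge0 => i _; exact: sqr_ge0.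
have A0 : 0 <= A by apply: sumr_ge0 => i _; exact: sqr_ge0.
have B0 : 0 <= B by apply: sumr_ge0 => i _; exact: sqr_ge0.
have [B1|B1] := ltP 0 B.
  rewrite -subr_ge0 -(pmulr_rge0 _ B1).
  by have -> : B * (A * B - C ^+ 2) = B ^+ 2 * A - 2 * B * C * C + C ^+ 2 * B by ring.
have B2 : B = 0 by apply/le_anti/andP.
have := H C (A + 1); rewrite B2 mulr0 mulr0 addr0.
have -> : C ^+ 2 * A - 2 * C * (A + 1) * C = - (C ^+ 2 * (A + 2)) by ring.
rewrite oppr_ge0 pmulr_lle0//.
by rewrite ltr_wpDl.
Qed.

Lemma CS_quad (d : nat) (M : 'I_d -> 'I_d -> R) (x y : 'I_d -> R) :
  (\sum_(i < d) \sum_(j < d) x i * M i j * y j) ^+ 2 <=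
  (\sum_(i < d) \sum_(j < d) M i j ^+ 2) * ((\sum_(i < d) x i ^+ 2) * (\sum_(j < d) y j ^+ 2)).
Proof.
have := CS_sum (fun p : 'I_d * 'I_d => M p.1 p.2) (fun p => x p.1 * y p.2).
rewrite -(pair_bigA _ (fun i j => M i j * (x i * y j)))/=.
rewrite -(pair_bigA _ (fun i j => M i j ^+ 2))/=.
rewrite -(pair_bigA _ (fun i j => (x i * y j) ^+ 2))/=.
have -> : \sum_(i < d) \sum_(j < d) (x i * y j) ^+ 2 = (\sum_(i < d) x i ^+ 2) * (\sum_(j < d) y j ^+ 2).
  by rewrite mulr_suml; apply: eq_bigr => i _; rewrite mulr_sumr; apply: eq_bigr => j _; rewrite exprMn.
congr (_ ^+ 2 <= _); apply: eq_bigr => i _; apply: eq_bigr => j _; ring.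
Qed.

Lemma sum_ord_cst (d : nat) (c : R) : \sum_(i < d) c = c * d%:R.
Proof. by rewrite sumr_const card_ord mulr_natr. Qed.

Lemma sqr_sum_mul (d : nat) (C : 'I_d -> 'I_d -> R) (v : 'I_d -> R) :
  \sum_(i < d) (\sum_(j < d) C i j * v j) ^+ 2 <=
  (\sum_(i < d) \sum_(j < d) C i j ^+ 2) * (\sum_(j < d) v j ^+ 2).
Proof. by rewrite mulr_suml; apply: ler_sum => i _; exact: CS_sum. Qed.

End FiniteSums.

(** * Moments of the prior *)

Section Prior.
Context {R : realType}.
Variables (d : nat) (m : R).
Hypothesis d0 : (0 < d)%N.
Notation Pu := (gs d (u_mean d m) (u_sd d)).

Let dR : d%:R != 0 :> R. Proof. by rewrite pnatr_eq0 -lt0n. Qed.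
Let sq0 : Num.sqrt d%:R != 0 :> R. Proof. by rewrite gt_eqF// sqrtr_gt0 ltr0n. Qed.
Let sq2 : Num.sqrt d%:R ^+ 2 = d%:R :> R. Proof. by rewrite sqr_sqrtr// ler0n. Qed.

Lemma prior_stein (i : 'I_d) F F' : dcoord i F F' -> ccoord i F' -> mom Pu F -> mom Pu F' ->
  Ex Pu (fun u => u i * F u) = m / Num.sqrt d%:R * Ex Pu F + d%:R^-1 * Ex Pu F'.
Proof.
move=> dF cF mF mF'; have mu := mom_u m d0.
have := gs_stein (PB := Pu) (F := fun p => F p.2) (F' := fun p => F' p.2)
  (ltn_ord i) (u_sd_gt0 d0 i) (fun _ => dF) (fun _ => cF) (mom_snd Pu mF) (mom_snd Pu mF').
rewrite (Ex_snd Pu mF') u_sd2.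
have mx : mom Pu (fun u => (u i - m / Num.sqrt d%:R) * F u) by mom_tac.
rewrite [X in X = _ -> _](Ex_snd Pu mx) => <-.
rewrite -ExZl// -ExD//; try by mom_tac.
by congr Ex; apply/funext => u; ring.
Qed.

(** Component of [u] along the unit vector with equal coordinates, the direction of the prior mean.
    It has mean [m] and variance [1 / d]. *)
Definition dir (u : nat -> R) : R := \sum_(i < d) u i / Num.sqrt d%:R.

Lemma mom_dir : mom Pu dir.
Proof. by have := mom_u m d0; rewrite /dir => mu; mom_tac. Qed.

Lemma sumd (i : 'I_d) (F : 'I_d -> R) : \sum_(j < d) F j * (j == i :> nat)%:R = F i.
Proof.
rewrite (bigD1 i)//= eqxx mulr1 big1 ?addr0// => j ji.
by rewrite (negbTE (ji : val j != val i)) mulr0.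
Qed.

Lemma dcoord_nrm2 (i : 'I_d) : dcoord i (nrm2 d : seqR R -> R) (fun u => 2 * u i).
Proof.
have := @dcoord_sum R i 'I_d (index_enum 'I_d) (fun j u => u j * u j) _
   (fun j => dcoordM (dcoord_coord i j) (dcoord_coord i j)).
congr dcoord; apply/funext => u.
rewrite -[RHS](sumd i (fun j => 2 * u j)); apply: eq_bigr => j _; ring.
Qed.

Lemma dcoord_dir (i : 'I_d) : dcoord i (dir : seqR R -> R) (fun=> (Num.sqrt d%:R)^-1).
Proof.
have := @dcoord_sum R i 'I_d (index_enum 'I_d) (fun j u => u j * (Num.sqrt d%:R)^-1) _
   (fun j => dcoordM (dcoord_coord i j) (dcoord_cst i _)).
congr dcoord; apply/funext => u.
rewrite -[RHS](sumd i (fun j => (Num.sqrt d%:R)^-1)); apply: eq_bigr => j _; ring.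
Qed.

Lemma dcoordX k (f f' : seqR R -> R) j : dcoord k f f' ->
  dcoord k (fun u => f u ^+ j) (fun u => j%:R * f u ^+ j.-1 * f' u).
Proof.
move=> df; elim: j => [|j IH].
  have := @dcoord_cst R k 1; congr dcoord; apply/funext => u; rewrite ?mul0r//.
have := dcoordM df IH; congr dcoord; apply/funext => u; first by rewrite exprS.
case: j {IH} => [|j]/=; first by rewrite mulr0n mulr1n !expr0; ring.
by rewrite -[in RHS](natr1 j.+1) exprS; ring.
Qed.

Lemma dir_nrm2 (u : nat -> R) : dir u ^+ 2 <= nrm2 d u.
Proof.
have := CS_sum (fun i : 'I_d => u i) (fun i : 'I_d => (Num.sqrt d%:R)^-1).
rewrite -/(dir u) -/(nrm2 d u) => /le_trans; apply.
by rewrite sum_ord_cst exprVn sq2 mulVf// mulr1.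
Qed.

Lemma nrm2_ge0 (u : nat -> R) : 0 <= nrm2 d u.
Proof. by apply: sumr_ge0 => i _; exact: sqr_ge0. Qed.

Lemma Ex_dir_var : Ex Pu (fun u => (dir u - m) ^+ 2) = d%:R^-1.
Proof.
have mu := mom_u m d0; have mr := mom_dir.
have mF : mom Pu (fun u => dir u - m) by mom_tac.
have dF (i : 'I_d) : dcoord i (fun u : seqR R => dir u - m) (fun=> (Num.sqrt d%:R)^-1 - 0).
  exact: dcoordB (dcoord_dir i) (dcoord_cst i m).
have H (i : 'I_d) := prior_stein (dF i) (@ccoord_cst R i _) mF (mom_cst Pu _).
have -> : (fun u : seqR R => (dir u - m) ^+ 2) =
    (fun u => (\sum_(i < d) (u i * (dir u - m)) * (Num.sqrt d%:R)^-1) - m * (dir u - m)).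
  apply/funext => u; rewrite expr2 {1}/dir mulrBl; congr (_ - _).
  by rewrite mulr_suml; apply: eq_bigr => i _; ring.
rewrite ExB; [|by mom_tac..]; rewrite ExZl// Ex_sum; last by move=> i _; mom_tac.
have mFi (i : 'I_d) : mom Pu (fun u => u i * (dir u - m)) by mom_tac.
under eq_bigr => i _ do rewrite (ExZr _ (mFi i)) H.
rewrite (Ex_cst Pu) sum_ord_cst subr0.
set E := Ex Pu _; set s := Num.sqrt d%:R.
have -> : d%:R = s ^+ 2 :> R by rewrite /s sq2.
by field; exact: sq0.
Qed.

Lemma Ex_nrm2 : Ex Pu (nrm2 d) = 1 + m ^+ 2.
Proof.
have mu := mom_u m d0; have mn := mom_nrm2 m d0.
have H (i : 'I_d) := prior_stein (dcoord_cst i 1) (@ccoord_cst R i _) (mom_cst Pu _) (mom_cst Pu _).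
have H2 (i : 'I_d) := prior_stein (dcoord_coord i i) (@ccoord_cst R i _) (mu i) (mom_cst Pu _).
have E1 (i : 'I_d) : Ex Pu (fun u => u i) = m / Num.sqrt d%:R.
  have := H i; rewrite !(Ex_cst Pu) mulr0 addr0 mulr1 => <-.
  by congr Ex; apply/funext => u; rewrite mulr1.
have -> : (nrm2 d : seqR R -> R) = (fun u => \sum_(i < d) u i * u i).
  by apply/funext => u; apply: eq_bigr => i _; rewrite expr2.
rewrite Ex_sum; last by move=> i _; mom_tac.
under eq_bigr => i _ do rewrite H2 E1 (Ex_cst Pu) eqxx [true%:R]mulr1n.
rewrite sum_ord_cst; set s := Num.sqrt d%:R.
have -> : d%:R = s ^+ 2 :> R by rewrite /s sq2.
by field; exact: sq0.
Qed.

(** Integration by parts for the vector field [|u|^(2k) u], whose divergence is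
    [(d + 2k) |u|^(2k)]. *)
Lemma Ex_nrm2_step k : Ex Pu (fun u => nrm2 d u ^+ k.+1) =
  m * Ex Pu (fun u => dir u * nrm2 d u ^+ k) + (1 + 2 * k%:R / d%:R) * Ex Pu (fun u => nrm2 d u ^+ k).
Proof.
have mu := mom_u m d0; have mn := mom_nrm2 m d0; have mr := mom_dir.
have dF (i : 'I_d) := dcoordM (dcoord_coord i i) (dcoordX k (dcoord_nrm2 i)).
have cF (i : 'I_d) : ccoord i (fun u : seqR R => (i == i :> nat)%:R * nrm2 d u ^+ k +
    u i * (k%:R * nrm2 d u ^+ k.-1 * (2 * u i))).
  have c1 := dcoord_ccoord (dcoord_coord i i).
  have c2 j := dcoord_ccoord (dcoordX j (dcoord_nrm2 i)).
  apply: ccoordD; apply: ccoordM => //; try exact: ccoord_cst.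
  apply: ccoordM; last by apply: ccoordM => //; exact: ccoord_cst.
  by apply: ccoordM => //; exact: ccoord_cst.
have mF (i : 'I_d) : mom Pu (fun u => u i * nrm2 d u ^+ k) by mom_tac.
have mF' (i : 'I_d) : mom Pu (fun u => (i == i :> nat)%:R * nrm2 d u ^+ k +
    u i * (k%:R * nrm2 d u ^+ k.-1 * (2 * u i))) by mom_tac.
have H (i : 'I_d) := prior_stein (dF i) (cF i) (mF i) (mF' i).
have -> : (fun u : seqR R => nrm2 d u ^+ k.+1) = (fun u => \sum_(i < d) u i * (u i * nrm2 d u ^+ k)).
  apply/funext => u; rewrite exprS mulr_suml; apply: eq_bigr => i _; ring.
rewrite Ex_sum; last by move=> i _; mom_tac.
under eq_bigr => i _ do rewrite H eqxx [true%:R]mulr1n.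
rewrite big_split/= -!mulr_sumr -Ex_sum; last by move=> i _; mom_tac.
rewrite -Ex_sum; last by move=> i _; mom_tac.
rewrite -!ExZl; [|by mom_tac..]; rewrite -!ExD; [|by mom_tac..].
congr Ex; apply/funext => u.
have -> : \sum_(i < d) u i * nrm2 d u ^+ k = Num.sqrt d%:R * (dir u * nrm2 d u ^+ k).
  rewrite mulrA -mulr_suml; congr (_ * _); rewrite /dir mulr_sumr.
  by apply: eq_bigr => i _; field; exact: sq0.
have -> : \sum_(i < d) (1 * nrm2 d u ^+ k + u i * (k%:R * nrm2 d u ^+ k.-1 * (2 * u i))) =
   (d%:R + 2 * k%:R) * nrm2 d u ^+ k.
  rewrite big_split/= sum_ord_cst mul1r.
  have -> : \sum_(i < d) u i * (k%:R * nrm2 d u ^+ k.-1 * (2 * u i)) = 2 * k%:R * (nrm2 d u ^+ k.-1 * nrm2 d u).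
    by rewrite mulrA {2}/nrm2 mulr_sumr; apply: eq_bigr => i _; ring.
  by case: k {dF cF mF mF' H} => [|k]/=; [rewrite expr0; ring|rewrite -exprSr; ring].
set s := Num.sqrt d%:R.
have -> : d%:R = s ^+ 2 :> R by rewrite /s sq2.
by field; exact: sq0.
Qed.

Lemma Ex_nrm2_var : Ex Pu (fun u => (nrm2 d u - (1 + m ^+ 2)) ^+ 2) = (2 + 4 * m ^+ 2) / d%:R.
Proof.
have mu := mom_u m d0; have mn := mom_nrm2 m d0; have mr := mom_dir.
have E2 := Ex_nrm2_step 1.
have E1 : Ex Pu (fun u => dir u * nrm2 d u ^+ 1) = m * Ex Pu (nrm2 d) + 2 / d%:R * m.
  have H (i : 'I_d) := prior_stein (dcoord_nrm2 i)
    (ccoordM (@ccoord_cst R i 2) (dcoord_ccoord (dcoord_coord i i))) mn (momM (mom_cst Pu 2) (mu i)).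
  have H1 (i : 'I_d) := prior_stein (dcoord_cst i 1) (@ccoord_cst R i _) (mom_cst Pu _) (mom_cst Pu _).
  have E1 (i : 'I_d) : Ex Pu (fun u => u i) = m / Num.sqrt d%:R.
    have := H1 i; rewrite !(Ex_cst Pu) mulr0 addr0 mulr1 => <-.
    by congr Ex; apply/funext => u; rewrite mulr1.
  have -> : (fun u : seqR R => dir u * nrm2 d u ^+ 1) =
     (fun u => \sum_(i < d) (u i * nrm2 d u) * (Num.sqrt d%:R)^-1).
    by apply/funext => u; rewrite /dir expr1 mulr_suml; apply: eq_bigr => i _; ring.
  rewrite Ex_sum; last by move=> i _; mom_tac.
  have mFi (i : 'I_d) : mom Pu (fun u => u i * nrm2 d u) by mom_tac.
  under eq_bigr => i _ do rewrite (ExZr _ (mFi i)) H (ExZl 2 (mu i)) E1.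
  rewrite sum_ord_cst; set s := Num.sqrt d%:R.
  have -> : d%:R = s ^+ 2 :> R by rewrite /s sq2.
  by field; exact: sq0.
have -> : (fun u : seqR R => (nrm2 d u - (1 + m ^+ 2)) ^+ 2) =
   (fun u => nrm2 d u ^+ 2 - 2 * (1 + m ^+ 2) * nrm2 d u + cst ((1 + m ^+ 2) ^+ 2) u).
  by apply/funext => u /=; ring.
rewrite ExD; [|by mom_tac..]; rewrite ExB; [|by mom_tac..].
rewrite ExZl// E2 E1 (Ex_cst Pu).
have -> : (fun u : seqR R => nrm2 d u ^+ 1) = nrm2 d by apply/funext => u; rewrite expr1.
rewrite Ex_nrm2; field.
exact: dR.
Qed.

(** In each step [m * dir] is at most [m^2 / 2 + dir^2 / 2], and since [dir^2 <= nrm2] half of the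
    left side absorbs the second part. This leaves the factor [m^2 + 2 + 4 j / d], bounded uniformly
    in [d]. *)
Lemma Ex_nrm2_pow k : Ex Pu (fun u => nrm2 d u ^+ k) <= (m ^+ 2 + 2 + 4 * k%:R) ^+ k.
Proof.
have mn := mom_nrm2 m d0; have mr := mom_dir.
have d1 : 1 <= d%:R :> R by rewrite ler1n.
have step j : Ex Pu (fun u => nrm2 d u ^+ j.+1) <= (m ^+ 2 + 2 + 4 * j%:R) * Ex Pu (fun u => nrm2 d u ^+ j).
  set A := Ex Pu (fun u => nrm2 d u ^+ j); set B := Ex Pu (fun u => nrm2 d u ^+ j.+1).
  have A0 : 0 <= A by apply: Ex_ge0 => u; rewrite exprn_ge0// nrm2_ge0.
  have H : m * Ex Pu (fun u => dir u * nrm2 d u ^+ j) <= m ^+ 2 / 2 * A + 2^-1 * B.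
    rewrite -!ExZl; [|by mom_tac..]; rewrite -ExD; [|by mom_tac..].
    apply: le_Ex => [||u]; try by mom_tac.
    rewrite [nrm2 d u ^+ j.+1]exprS; have := dir_nrm2 u; have := exprn_ge0 j (nrm2_ge0 u).
    move: (dir u) (nrm2 d u) => r s; move: (s ^+ j) => p p0 rs.
    have h1 := mulr_ge0 p0 (sqr_ge0 (m - r)).
    have h2 : 0 <= p * (s - r ^+ 2) by rewrite mulr_ge0// subr_ge0.
    by lra.
  have E := Ex_nrm2_step j; rewrite -/A -/B in E.
  have q0 : (0 <= j%:R / d%:R :> R) && (j%:R / d%:R <= j%:R :> R).
    rewrite divr_ge0//= ler_pdivrMr ?ltr0n//.
    by have := ler0n R j; nra.
  case/andP: q0 => q0 q1; have qA := ler_wpM2r A0 q1.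
  have {}E : B = m * Ex Pu (fun u => dir u * nrm2 d u ^+ j) + A + 2 * (j%:R / d%:R * A).
    by rewrite E; ring.
  by move: H qA; rewrite E; set y := m * _; set z := j%:R / d%:R * A; move=> *; lra.
have mono j : 0 <= m ^+ 2 + 2 + 4 * j%:R by have := sqr_ge0 m; have := ler0n R j; lra.
suff : forall j, (j <= k)%N -> Ex Pu (fun u => nrm2 d u ^+ j) <= (m ^+ 2 + 2 + 4 * k%:R) ^+ j by apply.
elim=> [_|j IH jk].
  have -> : (fun u : seqR R => nrm2 d u ^+ 0) = cst 1 by apply/funext => u; rewrite expr0.
  by rewrite (Ex_cst Pu) expr0.
apply: (le_trans (step j)); rewrite [X in _ <= X]exprS; apply: ler_pM => //.
- by apply: Ex_ge0 => u; rewrite exprn_ge0// nrm2_ge0.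
- by rewrite lerD2l ler_pM2l// ler_nat ltnW.
- exact/IH/ltnW.
Qed.

End Prior.

(** * Concentration of the overlap *)

Section Overlap.
Context {R : realType}.
Variables (d : nat) (m a : R).
Hypothesis d0 : (0 < d)%N.

Notation Pu := (gs d (u_mean d m) (u_sd d)).
Notation n := (d * d)%N.
Notation sd := (goe_sd d).
Notation t := (@rank1 R d).
Notation J := (Jt m a d0).
Notation post := (post d m a).
Notation mt := (mom_rank1 m d0).
Notation pm := (pm d m a).
Notation pmsq := (pmsq d m a).
Notation ovl := (ovl d m a).

Let sd0 k : (k < n)%N -> 0 < sd k :> R. Proof. by move=> _; exact: goe_sd_gt0. Qed.

Definition pm2 (i j : nat) (w : seqR R) : R := post (fun u => u i * u j) w.
Definition cov (i j : nat) (w : seqR R) : R := pm2 i j w - pm i w * pm j w.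
(** In the notation of the overview, [cov2] is |C|^2 and [pmcov] below is b^T C b. *)
Definition cov2 (w : seqR R) : R := \sum_(i < d) \sum_(j < d) cov i j w ^+ 2.
Definition pmcov (w : seqR R) : R := \sum_(i < d) \sum_(j < d) pm i w * cov i j w * pm j w.
Definition pm2sq (w : seqR R) : R := \sum_(i < d) \sum_(j < d) pm2 i j w ^+ 2.

Let muij (i j : 'I_d) : mom Pu (fun u => u i * u j).
Proof. by apply: momM; exact: mom_u. Qed.

Lemma mom_pm2 (i j : 'I_d) : mom J (fun p => pm2 i j p.2).
Proof. exact: (mom_avg sd0 mt a (muij i j)). Qed.

Lemma mom_cov (i j : 'I_d) : mom J (fun p => cov i j p.2).
Proof. by have := mom_pm2; have := mom_pm m a d0; rewrite /cov => mb mc; mom_tac. Qed.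

Lemma mom_cov2 : mom J (fun p => cov2 p.2).
Proof. by have := mom_cov; rewrite /cov2 => mb; mom_tac. Qed.

Lemma mom_pmcov : mom J (fun p => pmcov p.2).
Proof. by have := mom_cov; have := mom_pm m a d0; rewrite /pmcov => mb mc; mom_tac. Qed.

Lemma mom_pm2sq : mom J (fun p => pm2sq p.2).
Proof. by have := mom_pm2; rewrite /pm2sq => mb; mom_tac. Qed.

Lemma pmsq_ge0 w : 0 <= pmsq w.
Proof. by apply: sumr_ge0 => i _; exact: sqr_ge0. Qed.

Lemma cov2_ge0 w : 0 <= cov2 w.
Proof. by apply: sumr_ge0 => i _; apply: sumr_ge0 => j _; exact: sqr_ge0. Qed.

(** Expansion of the squared norm of C + b b^T. *)
Lemma pm2sqE w : pm2sq w = pmsq w ^+ 2 + 2 * pmcov w + cov2 w.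
Proof.
rewrite expr2 /pmsq -sum2_mul mulr_sumr -!big_split/=; apply: eq_bigr => i _.
rewrite mulr_sumr -!big_split/=; apply: eq_bigr => j _; rewrite /cov; ring.
Qed.

Lemma pmcov_le w : pmcov w ^+ 2 <= cov2 w * pmsq w ^+ 2.
Proof. by rewrite [pmsq w ^+ 2]expr2; exact: CS_quad. Qed.

Lemma pmsq_le w : pmsq w <= post (nrm2 d) w.
Proof.
have mu := mom_u m d0.
rewrite /post (avg_sum sd0 mt) => [|i _]; last by mom_tac.
by apply: ler_sum => i _; exact: (sqr_avg sd0 mt).
Qed.

(** It is the posterior variance of the inner product of [u] with the posterior mean. *)
Lemma pmcov_ge0 w : 0 <= pmcov w.
Proof.
have mu := mom_u m d0.
have -> : pmcov w = post (fun u => (\sum_(i < d) pm i w * u i) ^+ 2) w -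
   post (fun u => \sum_(i < d) pm i w * u i) w ^+ 2.
  have -> : (fun u : seqR R => (\sum_(i < d) pm i w * u i) ^+ 2) =
     (fun u => \sum_(i < d) \sum_(j < d) (pm i w * pm j w) * (u i * u j)).
    apply/funext => u; rewrite expr2 -sum2_mul; apply: eq_bigr => i _.
    by apply: eq_bigr => j _; ring.
  rewrite /post (avg_sum sd0 mt) => [|i _]; last by mom_tac.
  rewrite (avg_sum sd0 mt) => [|i _]; last by mom_tac.
  rewrite expr2 -sum2_mul -sumrB; apply: eq_bigr => i _.
  rewrite (avg_sum sd0 mt) => [|j _]; last by mom_tac.
  rewrite -sumrB; apply: eq_bigr => j _.
  rewrite !(avgZ sd0 mt) //.
  rewrite /cov /pm2 -/(pm i w) -/(pm j w) /post /pm /post; ring.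
by rewrite subr_ge0; apply: (sqr_avg sd0 mt); mom_tac.
Qed.

Lemma pm2sq_le w : pm2sq w <= post (fun u => nrm2 d u ^+ 2) w.
Proof.
have mu := mom_u m d0.
have -> : (fun u : seqR R => nrm2 d u ^+ 2) =
     (fun u => \sum_(i < d) \sum_(j < d) (u i * u j) ^+ 2).
  apply/funext => u; rewrite expr2 /nrm2 -sum2_mul; apply: eq_bigr => i _.
  by apply: eq_bigr => j _; rewrite exprMn.
rewrite /post (avg_sum sd0 mt) => [|i _]; last by mom_tac.
apply: ler_sum => i _; rewrite (avg_sum sd0 mt) => [|j _]; last by mom_tac.
by apply: ler_sum => j _; apply: (sqr_avg sd0 mt); mom_tac.
Qed.

Lemma cov2_le w : cov2 w <= post (fun u => nrm2 d u ^+ 2) w.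
Proof.
apply: le_trans (pm2sq_le w); rewrite pm2sqE.
by rewrite lerDr addr_ge0 ?sqr_ge0// mulr_ge0// pmcov_ge0.
Qed.

Lemma Ex_post_pow k h : mom Pu h ->
  Ex J (fun p => post h p.2 ^+ (2 ^ k)) <= Ex Pu (fun u => `|h u| ^+ (2 ^ k)).
Proof.
move=> mh; have mh2 : mom Pu (fun u => `|h u| ^+ (2 ^ k)) by apply/momX/mom_norm.
rewrite -(nishimori1 sd0 mt a mh2); apply: le_Ex => [||p].
- by apply: momX; exact: (mom_avg sd0 mt a mh).
- exact: (mom_avg sd0 mt a mh2).
- by apply: le_trans (avg_exp2 sd0 mt a p.2 k mh); rewrite -normrX ler_norm.
Qed.

Lemma Ex_pmsq_pow k : Ex J (fun p => pmsq p.2 ^+ (2 ^ k)) <= (m ^+ 2 + 2 + 4 * (2 ^ k)%:R) ^+ (2 ^ k).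
Proof.
have mn := mom_nrm2 m d0; have mX := mom_pmsq m a d0.
apply: le_trans (Ex_nrm2_pow m d0 (2 ^ k)).
have -> : (fun u : seqR R => nrm2 d u ^+ (2 ^ k)) = (fun u => `|nrm2 d u| ^+ (2 ^ k)).
  by apply/funext => u; rewrite ger0_norm// nrm2_ge0.
apply: le_trans (Ex_post_pow k mn); apply: le_Ex => [||p].
- exact: momX.
- by apply: momX; exact: (mom_avg sd0 mt a mn).
- by rewrite lerXn2r ?nnegrE ?pmsq_ge0 ?pmsq_le// (le_trans (pmsq_ge0 _) (pmsq_le _)).
Qed.

Lemma ovl_le p : ovl p ^+ 2 <= pmsq p.2 * nrm2 d p.1.
Proof. exact: CS_sum. Qed.

Definition dev p : R := ovl p - pmsq p.2.

Lemma mom_dev : mom J dev.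
Proof. by have mX := mom_pmsq m a d0; have mR := mom_ovl m a d0; rewrite /dev; mom_tac. Qed.

(** [dev] is the overlap minus its conditional mean, hence orthogonal to functions of the
    observation. *)
Lemma Ex_dev0 (f : seqR R -> R) : mom J (fun p => f p.2) -> Ex J (fun p => f p.2 * dev p) = 0.
Proof.
move=> mf; have mX := mom_pmsq m a d0; have mR := mom_ovl m a d0.
have mb := mom_pm m a d0; have mu := mom_u m d0; have mu1 := mom_J1 m a d0.
have -> : (fun p : seqR R * seqR R => f p.2 * dev p) =
   (fun p => \sum_(i < d) (f p.2 * pm i p.2) * p.1 i - \sum_(i < d) (f p.2 * pm i p.2) * pm i p.2).
  apply/funext => p; rewrite /dev mulrBr /ovl !mulr_sumr; congr (_ - _).
    by apply: eq_bigr => i _; rewrite mulrA.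
  by apply: eq_bigr => i _; rewrite expr2 mulrA.
rewrite ExB; [|by mom_tac..].
rewrite !Ex_sum; [|by move=> i _; mom_tac..].
have mfi (i : 'I_d) : mom J (fun p => f p.2 * pm i p.2) by mom_tac.
under eq_bigr => i _ do rewrite -(nishi (f := fun w => f w * pm i w) (mfi i) (mu i)).
by rewrite subrr.
Qed.

(** Given the observation the signal is a posterior sample, so the conditional variance of the
    overlap is b^T C b. This is how a small |C|^2 forces the overlap to be close to [pmsq]. *)
Lemma Ex_dev2 : Ex J (fun p => dev p ^+ 2) = Ex J (fun p => pmcov p.2).
Proof.
have mX := mom_pmsq m a d0; have mR := mom_ovl m a d0; have mD := mom_dev.
have mb := mom_pm m a d0; have mu1 := mom_J1 m a d0; have m2 := mom_pm2; have mC := mom_pmcov.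
have E : Ex J (fun p => ovl p ^+ 2) = Ex J (fun p => pmsq p.2 ^+ 2 + pmcov p.2).
  transitivity (\sum_(i < d) \sum_(j < d) Ex J (fun p => (pm i p.2 * pm j p.2) * (p.1 i * p.1 j))).
    under eq_bigr => i _.
      rewrite -Ex_sum; last by move=> j _; mom_tac.
      over.
    rewrite -Ex_sum; last by move=> i _; mom_tac.
    congr Ex; apply/funext => p; rewrite expr2 /ovl -sum2_mul.
    by apply: eq_bigr => i _; apply: eq_bigr => j _; ring.
  have mbb (i j : 'I_d) : mom J (fun p => pm i p.2 * pm j p.2) by mom_tac.
  under eq_bigr => i _ do under eq_bigr => j _ do
    rewrite -(nishi (f := fun w => pm i w * pm j w) (mbb i j) (muij i j)) -/(pm2 i j _).
  have mbc (i j : 'I_d) : mom J (fun p => pm i p.2 * pm j p.2 * post (fun u => u i * u j) p.2).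
    by have := m2; rewrite /pm2 => m2'; mom_tac.
  under eq_bigr => i _.
    rewrite -Ex_sum; last by move=> j _; exact: mbc.
    over.
  rewrite -Ex_sum; last by move=> i _; mom_tac.
  congr Ex; apply/funext => p; rewrite expr2 /pmsq -sum2_mul /pmcov -big_split/=.
  apply: eq_bigr => i _; rewrite -big_split/=; apply: eq_bigr => j _.
  by rewrite /cov /pm2; ring.
have E0 := Ex_dev0 mX.
have -> : (fun p : seqR R * seqR R => dev p ^+ 2) =
   (fun p => ovl p ^+ 2 - 2 * (pmsq p.2 * dev p) - pmsq p.2 ^+ 2).
  by apply/funext => p; rewrite /dev; ring.
rewrite ExB; [|by mom_tac..]; rewrite ExB; [|by mom_tac..].
rewrite ExZl; last by mom_tac.
rewrite E0 mulr0 subr0 E ExD; [|by mom_tac..].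
by rewrite addrAC subrr add0r.
Qed.

End Overlap.

(** * Pointwise inequalities, and concentration of the squared norm *)

Section RealBounds.
Context {R : realType}.
Implicit Types x y tau : R.

Lemma young x y tau : 0 < tau -> x * y <= (tau * x ^+ 2 + y ^+ 2 / tau) / 2.
Proof.
move=> t0; rewrite -subr_ge0.
have -> : (tau * x ^+ 2 + y ^+ 2 / tau) / 2 - x * y = (tau * x - y) ^+ 2 / tau / 2.
  by field; rewrite gt_eqF.
by rewrite !divr_ge0 ?sqr_ge0// ltW.
Qed.

Lemma ler_norm_sqr x y : `|x| <= y -> x ^+ 2 <= y ^+ 2.
Proof. by move=> xy; rewrite -real_normK ?num_real// lerXn2r ?nnegrE// (le_trans _ xy). Qed.

(** With exact coefficients the polynomial is [p2 (X - q) (X + r)], and [X >= 0] gives the left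
    side. Here [eta] is the error of the coefficients, which belong to a mean and a strength near
    the limiting ones, and [N] is an envelope of X. *)
Lemma quadratic_lower (X N B q r p2 c2 c1 c0 eta : R) : 0 <= X -> X + 1 <= N -> 1 <= B ->
  0 <= q <= B -> 0 <= p2 ->
  `|c2 - p2| <= eta -> `|c1 - p2 * (r - q)| <= eta -> `|c0 - p2 * (q * r)| <= eta ->
  p2 * r * (X - q) ^+ 2 <= (X - q) * (c2 * X ^+ 2 + c1 * X - c0) + B * eta * N ^+ 4.
Proof.
move=> X0 XN B1 /andP[q0 qB] p20 h2 h1 h0.
have N1 : 1 <= N by lra.
have N0 : 0 <= N by lra.
have e0 : 0 <= eta by exact: le_trans h2.
pose Dl := (c2 - p2) * X ^+ 2 + (c1 - p2 * (r - q)) * X - (c0 - p2 * (q * r)).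
have -> : (X - q) * (c2 * X ^+ 2 + c1 * X - c0) = p2 * (X - q) ^+ 2 * (X + r) + (X - q) * Dl.
  by rewrite /Dl; ring.
have HD : `|Dl| <= eta * N ^+ 2.
  have : `|Dl| <= eta * X ^+ 2 + eta * X + eta.
    rewrite (le_trans (ler_normB _ _))// lerD// (le_trans (ler_normD _ _))//.
    rewrite (normrM _ X) (normrM _ (X ^+ 2)) (ger0_norm X0) (ger0_norm (sqr_ge0 X)).
    by rewrite lerD// ler_wpM2r// sqr_ge0.
  move/le_trans; apply.
  have -> : eta * X ^+ 2 + eta * X + eta = eta * (X ^+ 2 + X + 1) by ring.
  by rewrite ler_wpM2l//; nra.
have HX : `|X - q| <= B * N.
  by rewrite ler_norml; apply/andP; split; nra.
have HP : `|(X - q) * Dl| <= B * eta * N ^+ 4.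
  rewrite normrM; apply: (@le_trans _ _ ((B * N) * (eta * N ^+ 2))); first exact: ler_pM.
  have -> : B * N * (eta * N ^+ 2) = B * eta * N ^+ 3 by ring.
  apply: ler_wpM2l; first by apply: mulr_ge0 => //; lra.
  by rewrite ler_weXn2l.
have := ler_norm (- ((X - q) * Dl)); rewrite normrN => H1.
have : 0 <= p2 * (X - q) ^+ 2 * X by apply: mulr_ge0 => //; apply: mulr_ge0 => //; exact: sqr_ge0.
have -> : p2 * (X - q) ^+ 2 * (X + r) = p2 * (X - q) ^+ 2 * X + p2 * r * (X - q) ^+ 2 by ring.
by lra.
Qed.

(** Every term has a factor [e1], [e2] or [al] that is small in mean square, split off by [young]
    with parameter [tau]. The cofactors have squares at most 1, 1 and 324 = 18^2 times [B^4 N^4],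
    and 163 is half of the sum. *)
Lemma perturbation_upper (X N B D m rho al e1 e2 V tau : R) : 0 < tau -> 1 <= B -> 0 <= N -> 1 <= N ->
  0 <= X <= N -> `|D| <= B * N -> `|m| <= B -> 0 <= rho <= B -> `|V| <= N -> `|al| <= 2 * N ->
  D * (m * e1 + rho * e2 * V) + rho * al ^+ 2 * (4 * X + 2 * al - D) <=
  163 * B ^+ 4 * tau * N ^+ 4 + (e1 ^+ 2 + e2 ^+ 2 + al ^+ 2) / (2 * tau).
Proof.
move=> t0 B1 N0 N1 /andP[X0 XN] HD Hm /andP[r0 rB] HV Ha.
have B0 : 0 <= B by lra.
have HR : `|rho| <= B by rewrite ger0_norm.
have N24 : N ^+ 2 <= N ^+ 4 by rewrite ler_weXn2l.
have H1 := young (D * m) e1 t0.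
have H2 := young (D * rho * V) e2 t0.
have H3 := young (al * rho * (4 * X + 2 * al - D)) al t0.
have K1 : (D * m) ^+ 2 <= B ^+ 4 * N ^+ 4.
  apply: (@le_trans _ _ ((B * N * B) ^+ 2)); first by apply: ler_norm_sqr; rewrite normrM ler_pM.
  have -> : (B * N * B) ^+ 2 = B ^+ 4 * N ^+ 2 by ring.
  by rewrite ler_wpM2l// exprn_ge0.
have K2 : (D * rho * V) ^+ 2 <= B ^+ 4 * N ^+ 4.
  apply: (@le_trans _ _ ((B * N * B * N) ^+ 2)).
    by apply: ler_norm_sqr; rewrite !normrM ler_pM ?mulr_ge0// ler_pM.
  by rewrite le_eqVlt; apply/orP; left; apply/eqP; ring.
have K3 : (al * rho * (4 * X + 2 * al - D)) ^+ 2 <= 324 * (B ^+ 4 * N ^+ 4).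
  apply: (@le_trans _ _ ((2 * N * B * (9 * B * N)) ^+ 2)).
    apply: ler_norm_sqr; rewrite !normrM ler_pM ?mulr_ge0//; first exact: ler_pM.
    have NB : N <= B * N by rewrite ler_peMl.
    move: HD Ha; rewrite !ler_norml => /andP[? ?] /andP[? ?].
    by apply/andP; split; lra.
  by rewrite le_eqVlt; apply/orP; left; apply/eqP; ring.
have T1 := ler_wpM2l (ltW t0) K1; have T2 := ler_wpM2l (ltW t0) K2; have T3 := ler_wpM2l (ltW t0) K3.
have -> : (e1 ^+ 2 + e2 ^+ 2 + al ^+ 2) / (2 * tau) =
  (e1 ^+ 2 / tau + e2 ^+ 2 / tau + al ^+ 2 / tau) / 2 by field; rewrite gt_eqF.
have -> : 163 * B ^+ 4 * tau * N ^+ 4 = 163 * (tau * (B ^+ 4 * N ^+ 4)) by ring.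
have -> : D * (m * e1 + rho * e2 * V) + rho * al ^+ 2 * (4 * X + 2 * al - D) =
   D * m * e1 + D * rho * V * e2 + al * rho * (4 * X + 2 * al - D) * al by ring.
move: H1 H2 H3 T1 T2 T3.
move: (_ ^+ 2) => y1; move: (D * m * e1) => z1 *.
by lra.
Qed.

End RealBounds.

Section Concentration.
Context {R : realType}.
Variables (d : nat) (m a : R).
Hypothesis d0 : (0 < d)%N.

Notation Pu := (gs d (u_mean d m) (u_sd d)).
Notation n := (d * d)%N.
Notation sd := (goe_sd d).
Notation t := (@rank1 R d).
Notation J := (Jt m a d0).
Notation mt := (mom_rank1 m d0).
Notation X p := (pmsq d m a p.2).
Notation Rv p := (ovl d m a p).
Notation al p := (dev d m a p).
Notation S p := (nrm2 d p.1).

(** A common envelope for [X], the squared norm of the signal and the overlap; all errors are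
    compared with its fourth power, whose mean is bounded uniformly in [d]. *)
Definition env p : R := 1 + X p + S p.

Let mX := mom_pmsq m a d0.
Let mR := mom_ovl m a d0.
Let mS := mom_Jnrm2 m a d0.
Let mA := mom_dev m a d0.

Let mdir : mom J (fun p => dir d p.1).
Proof. exact: (mom_joint_fst n sd mt a (mom_dir m d0)). Qed.

Lemma dyson_dev q :
  Ex J (fun p => (X p - q) * (a ^+ 2 * X p ^+ 2 + (1 - a ^+ 2 * (1 + m ^+ 2)) * X p - m ^+ 2)) =
  Ex J (fun p => (X p - q) * (m * (dir d p.1 - m) + a ^+ 2 * (S p - (1 + m ^+ 2)) * Rv p)
     + a ^+ 2 * al p ^+ 2 * (4 * X p + 2 * al p - (X p - q))).
Proof.
(* Writing the overlap as [X + al] in [schwinger_dyson] produces terms linear in [al] whose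
   coefficient depends on the observation only. [f1] is the opposite of this coefficient, so adding
   [f1 * al], of mean 0, cancels them. *)
pose f1 (w : seqR R) : R := (pmsq d m a w - q) * (a ^+ 2 * (1 + m ^+ 2) - 2 * a ^+ 2 * pmsq d m a w)
   + 2 * a ^+ 2 * pmsq d m a w ^+ 2.
have mf1 : mom J (fun p => f1 p.2) by rewrite /f1; mom_tac.
have E0 := Ex_dev0 mf1.
have E1 := schwinger_dyson m a d0 q.
apply/eqP; rewrite -subr_eq0 -ExB; [|by mom_tac..].
move/eqP: E1; rewrite -subr_eq0 -ExZl; last by mom_tac.
pose g1 (p : seqR R * seqR R) := (X p - q) * (X p - m * dir d p.1 - a ^+ 2 * (S p * Rv p) + a ^+ 2 * Rv p ^+ 2).
have mg1 : mom J g1 by rewrite /g1; mom_tac.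
rewrite -[Y in Ex J Y - _]/g1 -ExB; [|by mom_tac..].
rewrite -[Y in Y == 0 -> _]addr0 -E0 -ExD; [|by mom_tac..].
move/eqP => <-; apply/eqP; congr Ex; apply/funext => p.
by rewrite /g1 /f1 /dev; ring.
Qed.

Lemma env_ge1 p : 1 <= env p.
Proof. by have := pmsq_ge0 d m a p.2; have := nrm2_ge0 d p.1; rewrite /env; lra. Qed.

(** [dyson_dev] squeezed between [quadratic_lower] and [perturbation_upper]. The numerator
    [3 + 4 B^2] bounds the sum of [1] and [2 + 4 m^2], the variances of [dir] and [nrm2] multiplied
    by [d]. *)
Lemma concentration_step (B q r p2 eta tau : R) : 0 < tau -> 1 <= B -> 0 <= q <= B -> 0 <= p2 ->
  a ^+ 2 <= B -> `|m| <= B ->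
  `|a ^+ 2 - p2| <= eta -> `|(1 - a ^+ 2 * (1 + m ^+ 2)) - p2 * (r - q)| <= eta ->
  `|m ^+ 2 - p2 * (q * r)| <= eta ->
  p2 * r * Ex J (fun p => (X p - q) ^+ 2) <=
  163 * B ^+ 4 * (tau + eta) * Ex J (fun p => env p ^+ 4) +
    ((3 + 4 * B ^+ 2) / d%:R + Ex J (fun p => al p ^+ 2)) / (2 * tau).
Proof.
move=> t0 B1 qB p20 aB mB h2 h1 h0.
have e0 : 0 <= eta by exact: le_trans h2.
have mE : mom J env by rewrite /env; mom_tac.
pose e1 (u : seqR R) := dir d u - m; pose e2 (u : seqR R) := nrm2 d u - (1 + m ^+ 2).
have me1u : mom Pu e1 by have := mom_dir m d0 => md; rewrite /e1; mom_tac.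
have me2u : mom Pu e2 by have := mom_nrm2 m d0 => md; rewrite /e2; mom_tac.
have me1 : mom J (fun p => e1 p.1) := mom_joint_fst n sd mt a me1u.
have me2 : mom J (fun p => e2 p.1) := mom_joint_fst n sd mt a me2u.
have V1 : Ex J (fun p => e1 p.1 ^+ 2) = d%:R^-1.
  by rewrite (Ex_joint_fst n sd mt a (momX 2 me1u)) Ex_dir_var.
have V2 : Ex J (fun p => e2 p.1 ^+ 2) = (2 + 4 * m ^+ 2) / d%:R.
  by rewrite (Ex_joint_fst n sd mt a (momX 2 me2u)) Ex_nrm2_var.
have d1 : 0 < d%:R^-1 :> R by rewrite invr_gt0 ltr0n.
have m2 : m ^+ 2 <= B ^+ 2 by exact: ler_norm_sqr.
have envP p : [/\ 0 <= X p, X p + 1 <= env p, 1 <= env p & 0 <= S p].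
  have hX := pmsq_ge0 d m a p.2; have hS := nrm2_ge0 d p.1.
  by rewrite /env; split => //; lra.
apply: (@le_trans _ _ (Ex J (fun p => (X p - q) * (a ^+ 2 * X p ^+ 2 + (1 - a ^+ 2 * (1 + m ^+ 2)) * X p - m ^+ 2))
   + B * eta * Ex J (fun p => env p ^+ 4))).
  rewrite -!ExZl; [|by mom_tac..]; rewrite -ExD; [|by mom_tac..].
  apply: le_Ex => [||p]; try by mom_tac.
  by have [X0 X1 _ _] := envP p; exact: quadratic_lower.
rewrite dyson_dev.
have : Ex J (fun p => (X p - q) * (m * (dir d p.1 - m) + a ^+ 2 * (S p - (1 + m ^+ 2)) * Rv p)
     + a ^+ 2 * al p ^+ 2 * (4 * X p + 2 * al p - (X p - q))) <=
   163 * B ^+ 4 * tau * Ex J (fun p => env p ^+ 4) +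
   (2 * tau)^-1 * (Ex J (fun p => e1 p.1 ^+ 2) + Ex J (fun p => e2 p.1 ^+ 2) + Ex J (fun p => al p ^+ 2)).
  rewrite -!ExD; [|by mom_tac..]; rewrite -!ExZl; [|by mom_tac..]; rewrite -ExD; [|by mom_tac..].
  apply: le_Ex => [||p]; try by mom_tac.
  have [X0 X1 N1 S0] := envP p; have [q0 q1] := andP qB.
  have HV : `|Rv p| <= env p.
    have := ovl_le d m a p; rewrite -ler_sqrt ?mulr_ge0// sqrtr_sqr => /le_trans; apply.
    rewrite -(ger0_norm (le_trans ler01 N1)) -sqrtr_sqr ler_sqrt ?sqr_ge0//.
    by rewrite /env; nra.
  rewrite [_^-1 * _]mulrC; apply: perturbation_upper => //.
  - exact: le_trans N1.
  - by rewrite X0/=; lra.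
  - by rewrite ler_norml; apply/andP; split; nra.
  - by rewrite sqr_ge0.
  - rewrite /dev (le_trans (ler_normB _ _))// (ger0_norm X0).
    by lra.
set E1 := Ex J _; set E4 := Ex J _; rewrite V1 V2; set Ea := Ex J _ => H.
have E40 : 0 <= E4 by apply: Ex_ge0 => p; rewrite exprn_ge0// (le_trans ler01 (env_ge1 p)).
have B4 : B * eta * E4 <= 163 * B ^+ 4 * eta * E4.
  rewrite !ler_wpM2r//.
  have : B <= B ^+ 4 by rewrite -[Y in Y <= _]expr1 ler_weXn2l.
  by lra.
have H3 : d%:R^-1 + (2 + 4 * m ^+ 2) / d%:R <= (3 + 4 * B ^+ 2) / d%:R.
  by have := ler_wpM2r (ltW d1) m2; lra.
have t2 : 0 <= (2 * tau)^-1 by rewrite invr_ge0; lra.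
have := ler_wpM2l t2 (lerD H3 (lexx Ea)).
have -> : 163 * B ^+ 4 * (tau + eta) * E4 = 163 * B ^+ 4 * tau * E4 + 163 * B ^+ 4 * eta * E4 by ring.
rewrite [_ / (2 * tau)]mulrC.
by lra.
Qed.

End Concentration.

Section OverlapLimit.
Context {R : realType}.

(** Young's inequality for [sqrt y * |z|], with the square root avoided. *)
Lemma le_young_of_sqr (x y z tau : R) : 0 < tau -> 0 <= y -> x ^+ 2 <= y * z ^+ 2 ->
  x <= (tau * z ^+ 2 + y / tau) / 2.
Proof.
move=> t0 y0 H; have w0 : 0 <= (tau * z ^+ 2 + y / tau) / 2.
  apply: divr_ge0 => //; apply: addr_ge0; last by apply: divr_ge0 => //; exact: ltW.
  by apply: mulr_ge0; [exact: ltW|exact: sqr_ge0].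
apply: (le_trans (ler_norm x)).
rewrite -(ler_pXn2r (n := 2))// ?nnegrE// real_normK ?num_real//.
apply: (le_trans H); rewrite -subr_ge0.
have -> : ((tau * z ^+ 2 + y / tau) / 2) ^+ 2 - y * z ^+ 2 = ((tau * z ^+ 2 - y / tau) / 2) ^+ 2.
  by field; rewrite gt_eqF.
exact: sqr_ge0.
Qed.

Section Bounds.
Variables (d : nat) (m a : R).
Hypothesis d0 : (0 < d)%N.
Notation J := (Jt m a d0).
Notation Pu := (gs d (u_mean d m) (u_sd d)).

(** Squaring [(1 + x + s)^2 <= 3 (1 + x^2 + s^2)] and using the same inequality for squares gives 27
    = 3^3; the 18 is [2 + 4 * 4] from [Ex_nrm2_pow] at exponent 4. *)
Lemma Ex_env_le B : 1 <= B -> `|m| <= B ->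
  Ex J (fun p => env d m a p ^+ 4) <= 27 * (1 + 2 * (B ^+ 2 + 18) ^+ 4).
Proof.
move=> B1 mB.
have mX := mom_pmsq m a d0; have mS := mom_Jnrm2 m a d0.
have K0 : (m ^+ 2 + 18) ^+ 4 <= (B ^+ 2 + 18) ^+ 4.
  rewrite lerXn2r ?nnegrE ?addr_ge0 ?sqr_ge0// lerD2r.
  exact: ler_norm_sqr.
have KX : Ex J (fun p => pmsq d m a p.2 ^+ 4) <= (B ^+ 2 + 18) ^+ 4.
  apply: le_trans K0; have := Ex_pmsq_pow m a d0 2.
  have -> : (m ^+ 2 + 2 + 4 * (2 ^ 2)%N%:R) = m ^+ 2 + 18 by rewrite (_ : (2 ^ 2)%N = 4%N)//; ring.
  by [].
have KS : Ex J (fun p => nrm2 d p.1 ^+ 4) <= (B ^+ 2 + 18) ^+ 4.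
  apply: le_trans K0.
  have mn4 : mom Pu (fun u => nrm2 d u ^+ 4) := momX 4 (mom_nrm2 m d0).
  rewrite (Ex_joint_fst (d * d)%N (goe_sd d) (mom_rank1 m d0) a mn4).
  have := Ex_nrm2_pow m d0 4.
  by have -> : m ^+ 2 + 2 + 4 * 4 = m ^+ 2 + 18 by ring.
have : Ex J (fun p => env d m a p ^+ 4) <=
   27 * Ex J (fun p => (fun=> 1) p + (pmsq d m a p.2 ^+ 4 + nrm2 d p.1 ^+ 4)).
  rewrite -ExZl; last by mom_tac.
  apply: le_Ex => [||p]; try by rewrite /env; mom_tac.
  rewrite /env /=; move: (pmsq _ _ _ _) (nrm2 _ _) => x s.
  rewrite -subr_ge0.
  pose A := 1 + x ^+ 2 + s ^+ 2; pose N := 1 + x + s.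
  have h1 : 0 <= 3 * A - N ^+ 2.
    have -> : 3 * A - N ^+ 2 = (1 - x) ^+ 2 + (1 - s) ^+ 2 + (x - s) ^+ 2 by rewrite /A /N; ring.
    by rewrite !addr_ge0// sqr_ge0.
  have h2 : 0 <= 3 * (1 + (x ^+ 4 + s ^+ 4)) - A ^+ 2.
    have -> : 3 * (1 + (x ^+ 4 + s ^+ 4)) - A ^+ 2 =
      (1 - x ^+ 2) ^+ 2 + (1 - s ^+ 2) ^+ 2 + (x ^+ 2 - s ^+ 2) ^+ 2 by rewrite /A; ring.
    by rewrite !addr_ge0// sqr_ge0.
  have N0 : 0 <= N ^+ 2 by exact: sqr_ge0.
  have : (N ^+ 2) ^+ 2 <= (3 * A) ^+ 2 by rewrite lerXn2r ?nnegrE//; lra.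
  rewrite -exprM -/N (_ : (2 * 2)%N = 4%N)// exprMn => h3.
  by lra.
move/le_trans; apply; rewrite ler_pM2l//.
have mc : mom J (fun=> 1 : R) := mom_cst J 1.
by rewrite ExD; [rewrite ExD; [rewrite (Ex_cst J)|..]|..]; try (by mom_tac); lra.
Qed.

(** Young's inequality with parameter [th^4] for b^T C b <= |C| |b|^2 balances the moment bound
    against E|C|^2 <= [th^8]. *)
Lemma Ex_dev2_le th M : 0 < th -> Ex J (fun p => env d m a p ^+ 4) <= M ->
  Ex J (fun p => cov2 d m a p.2) <= th ^+ 8 ->
  Ex J (fun p => dev d m a p ^+ 2) <= th ^+ 4 * (M + 1) / 2.
Proof.
move=> t0 HM Hy; rewrite Ex_dev2.
have mX := mom_pmsq m a d0; have mS := mom_Jnrm2 m a d0.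
have mC := mom_pmcov m a d0; have mF := mom_cov2 m a d0.
have t4 : 0 < th ^+ 4 by rewrite exprn_gt0.
have H1 : Ex J (fun p => pmcov d m a p.2) <=
  2^-1 * (th ^+ 4 * Ex J (fun p => pmsq d m a p.2 ^+ 2) + (th ^+ 4)^-1 * Ex J (fun p => cov2 d m a p.2)).
  rewrite -!ExZl; [|by mom_tac..]; rewrite -ExD; [|by mom_tac..]; rewrite -ExZl; last by mom_tac.
  apply: le_Ex => [||p]; try by mom_tac.
  rewrite mulrC [_^-1 * cov2 _ _ _ _]mulrC.
  exact: le_young_of_sqr t4 (cov2_ge0 d m a p.2) (pmcov_le d m a p.2).
have H2 : Ex J (fun p => pmsq d m a p.2 ^+ 2) <= M.
  apply: le_trans HM; apply: le_Ex => [||p]; try by rewrite /env; mom_tac.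
  have := env_ge1 d m a p; have := pmsq_ge0 d m a p.2; have := nrm2_ge0 d p.1.
  rewrite /env; move: (pmsq _ _ _ _) (nrm2 _ _) => x s s0 x0 n1.
  apply: (@le_trans _ _ ((1 + x + s) ^+ 2)).
    by rewrite lerXn2r ?nnegrE//; lra.
  by rewrite ler_weXn2l.
have H3 : (th ^+ 4)^-1 * Ex J (fun p => cov2 d m a p.2) <= th ^+ 4.
  rewrite mulrC ler_pdivrMr//; apply: (le_trans Hy).
  by rewrite -exprD.
have := ler_wpM2l (ltW t4) H2; lra.
Qed.

End Bounds.

(** The powers of [th] are set so that all errors match: [th^8] for E|C|^2 gives [th^4] for the mean
    square of [dev]; divided by [tau = th^2] this is [th^2], the size of the coefficient errors.
    Hence E(X - q)^2 is of order [th^2] and E(X - q) of order [th]. *)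
Lemma overlap_limit B kap : 1 <= B -> 0 < kap ->
  exists2 c : R, 0 <= c & forall (d : nat) (m a q r p2 th : R) (d0 : (0 < d)%N),
    0 < th <= 1 -> 0 <= q <= B -> 0 <= p2 -> kap <= p2 * r -> a ^+ 2 <= B -> `|m| <= B ->
    `|a ^+ 2 - p2| <= th ^+ 2 ->
    `|(1 - a ^+ 2 * (1 + m ^+ 2)) - p2 * (r - q)| <= th ^+ 2 ->
    `|m ^+ 2 - p2 * (q * r)| <= th ^+ 2 ->
    d%:R^-1 <= th ^+ 8 -> Ex (Jt m a d0) (fun p => cov2 d m a p.2) <= th ^+ 8 ->
    `|Ex (Jt m a d0) (fun p => pm2sq d m a p.2) - q ^+ 2| <= c * th.
Proof.
move=> B1 k0; pose M := 27 * (1 + 2 * (B ^+ 2 + 18) ^+ 4).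
have M0 : 0 <= M.
  have : 0 <= (B ^+ 2 + 18) ^+ 4 by rewrite exprn_ge0// addr_ge0 ?sqr_ge0.
  by rewrite /M; lra.
have B40 : 0 <= B ^+ 4 by apply: exprn_ge0; lra.
have B4M : 0 <= B ^+ 4 * M by exact: mulr_ge0.
pose c2 := kap^-1 * (326 * (B ^+ 4 * M) + (3 + 4 * B ^+ 2) + (M + 1)).
have c20 : 0 <= c2.
  by apply: mulr_ge0; [rewrite invr_ge0 ltW|have := sqr_ge0 B; lra].
exists (c2 + B * c2 + B + M + 2); first by nra.
move=> d m a q r p2 th d0 /andP[t0 t1] qB p20 kr aB mB h2 h1 h0 hd hy.
set J := Jt m a d0.
have mX := mom_pmsq m a d0; have mS := mom_Jnrm2 m a d0.
have mC := mom_pmcov m a d0; have mF := mom_cov2 m a d0.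
have HM := Ex_env_le a d0 B1 mB; rewrite -/M in HM.
have HA := Ex_dev2_le t0 HM hy.
have t20 : 0 < th ^+ 2 by rewrite exprn_gt0.
have HC := concentration_step d0 t20 B1 qB p20 aB mB h2 h1 h0.
rewrite -/J in HM HA HC.
have le_th k : th ^+ k.+1 <= th by rewrite -[leRHS]expr1 ler_wiXn2l// ltW.
set Dq := Ex J (fun p => (pmsq d m a p.2 - q) ^+ 2) in HC.
have Dq0 : 0 <= Dq by apply: Ex_ge0 => p; exact: sqr_ge0.
set Al := Ex J _ in HA; set E4 := Ex J _ in HM.
rewrite -/Al -/E4 in HC.
have {}HC : Dq <= c2 * th ^+ 2.
  rewrite /c2 -mulrA mulrC ler_pdivlMr// mulrC.
  apply: (@le_trans _ _ (p2 * r * Dq)); first exact: ler_wpM2r.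
  apply: (le_trans HC).
  have F1 : 163 * B ^+ 4 * (th ^+ 2 + th ^+ 2) * E4 <= 326 * (B ^+ 4 * M) * th ^+ 2.
    have : B ^+ 4 * th ^+ 2 * E4 <= B ^+ 4 * th ^+ 2 * M by apply: ler_wpM2l => //; apply: mulr_ge0 => //; exact: ltW.
    by lra.
  have F2 : ((3 + 4 * B ^+ 2) / d%:R + Al) / (2 * th ^+ 2) <= (3 + 4 * B ^+ 2) * th ^+ 2 + (M + 1) * th ^+ 2.
    rewrite ler_pdivrMr; last by lra.
    have -> : ((3 + 4 * B ^+ 2) * th ^+ 2 + (M + 1) * th ^+ 2) * (2 * th ^+ 2) =
       2 * (3 + 4 * B ^+ 2) * th ^+ 4 + 2 * (M + 1) * th ^+ 4 by ring.
    have B30 : 0 <= 3 + 4 * B ^+ 2 by have := sqr_ge0 B; lra.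
    have t48 : th ^+ 8 <= th ^+ 4 by rewrite ler_wiXn2l// ltW.
    have := ler_wpM2l B30 (le_trans hd t48).
    have t4 : 0 <= th ^+ 4 by apply: exprn_ge0; exact: ltW.
    have : 0 <= (M + 1) * th ^+ 4 by apply: mulr_ge0 => //; lra.
    have : 0 <= (3 + 4 * B ^+ 2) * th ^+ 4 by apply: mulr_ge0.
    by move: HA; lra.
  apply: le_trans (lerD F1 F2) _.
  by rewrite [leRHS]mulrDl [in leRHS]mulrDl addrA.
have mDl : mom J (fun p => pmsq d m a p.2 - q) by mom_tac.
pose L := Ex J (fun p => pmsq d m a p.2 - q).
(* The norm of C + b b^T, expanded around [q], with the mean of b^T C b rewritten as the mean square
   of [dev]. *)
have EG : Ex J (fun p => pm2sq d m a p.2) - q ^+ 2 = Dq + 2 * q * L + 2 * Al + Ex J (fun p => cov2 d m a p.2).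
  have -> : (fun p : seqR R * seqR R => pm2sq d m a p.2) = (fun p => (pmsq d m a p.2 - q) ^+ 2 +
     2 * q * (pmsq d m a p.2 - q) + 2 * pmcov d m a p.2 + cov2 d m a p.2 + (fun=> q ^+ 2) p).
    by apply/funext => p; rewrite pm2sqE; ring.
  have mc := mom_cst J (q ^+ 2).
  rewrite ExD; [|by mom_tac..]; rewrite ExD; [|by mom_tac..]; rewrite ExD; [|by mom_tac..].
  rewrite ExD; [|by mom_tac..]; rewrite !ExZl; [|by mom_tac..].
  by rewrite (Ex_cst J) /Al Ex_dev2 addrK.
have HL : `|L| <= (c2 * th + th) / 2.
  apply: (le_trans (normr_Ex mDl)).
  apply: (@le_trans _ _ (2^-1 * (th^-1 * Dq + th))).
    have mc := mom_cst J th.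
    have -> : th^-1 * Dq + th = Ex J (fun p => th^-1 * (pmsq d m a p.2 - q) ^+ 2 + cst th p).
      by rewrite ExD; [rewrite (Ex_cst J) ExZl//|..]; mom_tac.
    rewrite -ExZl; last by mom_tac.
    apply: le_Ex => [||p]; try by (try apply: mom_norm); mom_tac.
    have := young `|pmsq d m a p.2 - q| 1 (_ : 0 < th^-1).
    rewrite invr_gt0 => /(_ t0); rewrite mulr1 invrK expr1n mul1r real_normK ?num_real//.
    by move/le_trans; apply; rewrite /= mulrC.
  rewrite mulrC ler_pM2r ?invr_gt0// lerD2r mulrC ler_pdivrMr//.
  by apply: le_trans HC _; rewrite expr2 mulrA.
have Al0 : 0 <= Al by apply: Ex_ge0 => p; exact: sqr_ge0.
have y0 : 0 <= Ex J (fun p => cov2 d m a p.2) by apply: Ex_ge0 => p; exact: cov2_ge0.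
have [q0 q1] := andP qB.
rewrite EG.
have HqL : `|2 * q * L| <= B * (c2 * th + th).
  rewrite !normrM (ger0_norm q0) ger0_norm//.
  have := ler_pM q0 (normr_ge0 L) q1 HL; lra.
have A2 : 2 * Al <= (M + 1) * th.
  have : (M + 1) * th ^+ 4 <= (M + 1) * th by apply: ler_wpM2l => //; lra.
  by move: HA; lra.
have D2 : Dq <= c2 * th by apply: le_trans HC _; exact: ler_wpM2l.
have Y2 := le_trans hy (le_th 7%N).
move: HqL; rewrite !ler_norml => /andP[L1 L2]; apply/andP; split; lra.
Qed.

End OverlapLimit.

(** * Windows with small posterior covariance *)

Section Noise.
Context {R : realType}.
Variables (d : nat).
Hypothesis d0 : (0 < d)%N.
Notation n := (d * d)%N.
Notation sd := (goe_sd d).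
Notation PW := (gs n (fun=> 0 : R) sd).

Lemma idx_eq (i j k l : 'I_d) :
  (idx d i j == idx d k l) = ((i == k) && (j == l)) || ((i == l) && (j == k)).
Proof.
apply/eqP/idP => [E|/orP[]/andP[/eqP-> /eqP->]//]; last exact: idxC.
have E1 : minn i j = minn k l by rewrite -(idx_div d0 i j) -(idx_div d0 k l) E.
have E2 : maxn i j = maxn k l by rewrite -(idx_mod i j) -(idx_mod k l) E.
rewrite -!(inj_eq val_inj)/=; move: E1 E2; rewrite /minn /maxn.
by case: ifP => _; case: ifP => _ -> ->; rewrite !eqxx ?orbT.
Qed.

(** Covariance of entry (j, l) of the noise with the row sums weighted by [A]. On the diagonal an
    entry meets one row instead of two, but its variance is doubled, so one formula covers both
    cases. *)
Lemma goe_sd2_sum (A : 'I_d -> R) (j l : 'I_d) :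
  sd (idx d j l) ^+ 2 * (\sum_(k < d) A k * \sum_(i < d) (idx d k i == idx d j l)%:R) = (A j + A l) / d%:R.
Proof.
have E (k : 'I_d) : \sum_(i < d) (idx d k i == idx d j l)%:R =
   (k == j)%:R + (k == l)%:R - (k == j)%:R * (k == l)%:R :> R.
  under eq_bigr => i _ do rewrite idx_eq.
  have S0 (i0 : 'I_d) : \sum_(i < d) (i == i0)%:R = 1 :> R.
    by rewrite (bigD1 i0)//= eqxx big1 ?addr0// => i /negbTE ->.
  have [->|kj] := eqVneq k j.
    have [<-|jl] := eqVneq j l.
      under eq_bigr => i _ do rewrite !andTb orbb.
      by rewrite S0 !mulr1n; ring.
    under eq_bigr => i _ do rewrite andTb andFb orbF.
    by rewrite S0 mulr1n mulr0n; ring.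
  have [_|kl] := eqVneq k l.
    under eq_bigr => i _ do rewrite andTb andFb orFb.
    by rewrite S0 mulr1n mulr0n; ring.
  by rewrite big1// !mulr0n; ring.
under eq_bigr => k _ do rewrite E.
have S1 (i : 'I_d) (F : 'I_d -> R) : \sum_(k < d) F k * (k == i)%:R = F i.
  rewrite (bigD1 i)//= eqxx mulr1 big1 ?addr0// => k /negbTE ->; by rewrite mulr0.
have -> : \sum_(k < d) A k * ((k == j)%:R + (k == l)%:R - (k == j)%:R * (k == l)%:R) =
   A j + A l - A j * (j == l)%:R.
  transitivity (\sum_(k < d) A k * (k == j)%:R + \sum_(k < d) A k * (k == l)%:R -
     \sum_(k < d) (A k * (k == l)%:R) * (k == j)%:R).
    by rewrite -big_split/= -sumrB; apply: eq_bigr => k _; ring.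
  by rewrite (S1 j (fun k => A k * (k == l)%:R)) !S1.
rewrite goe_sd2 (idx_div d0) idx_mod.
have -> : (minn j l == maxn j l) = (j == l).
  rewrite -(inj_eq val_inj)/= /minn /maxn; case: ifP => // _; exact: eq_sym.
case: eqVneq => [->|_]; rewrite ?mulr1n ?mulr0n; ring.
Qed.

(** For the unit vector e with equal coordinates, W e has covariance (I + e e^T) / d, at most 2 / d.
    Being centred and independent of [y] and [A], it contributes no cross term. *)
Lemma goe_noise dB (B : measurableType dB) (PB : probability B R) (y : B -> R) (A : 'I_d -> B -> R) :
  mom PB y -> (forall j, mom PB (A j)) ->
  Ex (pprod PB PW) (fun p => (y p.1 - \sum_(j < d) A j p.1 * (\sum_(l < d) p.2 (idx d j l) / Num.sqrt d%:R)) ^+ 2) <=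
  Ex PB (fun b => y b ^+ 2 + 2 / d%:R * \sum_(j < d) A j b ^+ 2).
Proof.
move=> my mA; set PP := pprod PB PW; set s := Num.sqrt d%:R : R.
have s0 : s != 0 by rewrite gt_eqF// sqrtr_gt0 ltr0n.
have s2 : s ^+ 2 = d%:R by rewrite sqr_sqrtr// ler0n.
have my1 : mom PP (fun p => y p.1) := mom_fst PW my.
have mA1 j : mom PP (fun p => A j p.1) := mom_fst PW (mA j).
have mw (j l : 'I_d) : mom PP (fun p => p.2 (idx d j l)).
  exact: (mom_snd PB (@mom_gs_coord _ n _ _ sd (idx_lt d0 j l) (goe_sd_gt0 d0 _))).
pose Z (p : B * seqR R) := \sum_(j < d) A j p.1 * (\sum_(l < d) p.2 (idx d j l) / s).
have mZ : mom PP Z by rewrite /Z; mom_tac.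
pose Z' (k : nat) (p : B * seqR R) := \sum_(j < d) A j p.1 * (s^-1 * \sum_(l < d) (idx d j l == k)%:R).
have dZ k b : dcoord k (fun v => Z (b, v)) (fun v => Z' k (b, v)).
  have := @dcoord_sum R k 'I_d (index_enum 'I_d) _ _ (fun j => dcoordZ (A j b) (dcoordZ s^-1
    (@dcoord_sum R k 'I_d (index_enum 'I_d) _ _ (fun l => dcoord_coord k (idx d j l))))).
  congr dcoord; apply/funext => v; apply: eq_bigr => j _; congr (_ * _).
  by rewrite mulr_sumr; apply: eq_bigr => l _; rewrite mulrC.
have mZ' k : mom PP (Z' k) by rewrite /Z'; mom_tac.
(* The square minus [y^2] is [Z (Z - 2 y)], a sum of noise entries times [F j], to which integration
   by parts applies entry by entry. *)
pose F (j : 'I_d) (p : B * seqR R) := A j p.1 * (s^-1 * (Z p - 2 * y p.1)).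
pose F' (j : 'I_d) (k : nat) (p : B * seqR R) := A j p.1 * (s^-1 * (Z' k p - 0)).
have st (j l : 'I_d) : Ex PP (fun p => p.2 (idx d j l) * F j p) =
    Ex PP (fun p => A j p.1 * (A j p.1 + A l p.1) / (d%:R ^+ 2)).
  have dF b : dcoord (idx d j l) (fun v => F j (b, v)) (fun v => F' j (idx d j l) (b, v)).
    exact: (dcoordZ (A j b) (dcoordZ s^-1 (dcoordB (dZ _ b) (dcoord_cst _ (2 * y b))))).
  have cF b : ccoord (idx d j l) (fun v => F' j (idx d j l) (b, v)).
    by have := @ccoord_cst R (idx d j l) (F' j (idx d j l) (b, fun=> 0)).
  have mF : mom PP (F j) by rewrite /F; mom_tac.
  have mF' : mom PP (F' j (idx d j l)) by rewrite /F'; mom_tac.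
  have := gs_stein (PB := PB) (mean := fun=> 0) (idx_lt d0 j l) (goe_sd_gt0 d0 _) dF cF mF mF'.
  under [X in Ex _ X = _]eq_fun do rewrite subr0.
  move=> ->; rewrite -ExZl//; congr Ex; apply/funext => p.
  transitivity (A j p.1 * s^-1 * s^-1 *
     (sd (idx d j l) ^+ 2 * (\sum_(k < d) A k p.1 * \sum_(i < d) (idx d k i == idx d j l)%:R))).
    rewrite /F' /Z' subr0.
    under eq_bigr => k _ do rewrite mulrCA.
    by rewrite -mulr_sumr; ring.
  by rewrite goe_sd2_sum -s2; field.
have mF j : mom PP (F j) by rewrite /F; mom_tac.
have -> : (fun p : B * seqR R => (y p.1 - \sum_(j < d) A j p.1 * (\sum_(l < d) p.2 (idx d j l) / s)) ^+ 2) =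
   (fun p => y p.1 ^+ 2 + \sum_(j < d) \sum_(l < d) p.2 (idx d j l) * F j p).
  apply/funext => p; rewrite -/(Z p).
  have -> : \sum_(j < d) \sum_(l < d) p.2 (idx d j l) * F j p = Z p * (Z p - 2 * y p.1).
    rewrite {2}/Z mulr_suml; apply: eq_bigr => j _; rewrite mulr_sumr mulr_suml.
    by apply: eq_bigr => l _; rewrite -/(Z p) /F; ring.
  by ring.
rewrite ExD; [|by mom_tac..].
rewrite Ex_sum; last by move=> j _; mom_tac.
under eq_bigr => j _.
  rewrite Ex_sum; last by move=> l _; mom_tac.
  under eq_bigr => l _ do rewrite st.
  rewrite -Ex_sum; last by move=> l _; mom_tac.
  over.
rewrite -Ex_sum; last by move=> j _; mom_tac.
rewrite -ExD; [|by mom_tac..].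
rewrite -(Ex_fst PW (f := fun b => y b ^+ 2 + 2 / d%:R * \sum_(j < d) A j b ^+ 2)); last by mom_tac.
apply: le_Ex => [||p]; try by mom_tac.
rewrite lerD2l.
have -> : \sum_(j < d) \sum_(l < d) A j p.1 * (A j p.1 + A l p.1) / d%:R ^+ 2 =
   (\sum_(j < d) A j p.1 ^+ 2) / d%:R + (\sum_(j < d) A j p.1) ^+ 2 / d%:R ^+ 2.
  rewrite [X in _ = _ + X / _]expr2 -sum2_mul !mulr_suml -big_split/=; apply: eq_bigr => j _.
  rewrite mulr_suml.
  transitivity (\sum_(l < d) (A j p.1 ^+ 2 / d%:R ^+ 2 + A j p.1 * A l p.1 / d%:R ^+ 2)).
    by apply: eq_bigr => l _; ring.
  rewrite big_split/= sum_ord_cst; congr (_ + _); field.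
  by rewrite -s2 expf_neq0.
have := CS_sum (fun j => A j p.1) (fun=> 1 : R).
under eq_bigr => j _ do rewrite mulr1.
under [X in _ <= _ * X -> _]eq_bigr => j _ do rewrite expr1n.
rewrite sum_ord_cst mul1r => H.
have dR : 0 < d%:R :> R by rewrite ltr0n.
have -> : 2 / d%:R * \sum_(j < d) A j p.1 ^+ 2 = (\sum_(j < d) A j p.1 ^+ 2) / d%:R +
    (\sum_(j < d) A j p.1 ^+ 2) * d%:R / d%:R ^+ 2 by field; rewrite gt_eqF.
by rewrite lerD2l ler_pM2r// invr_gt0 exprn_gt0.
Qed.

End Noise.

(** * The gain from one weak additional observation *)

Section Gain.
Context {R : realType}.
Variables (d : nat) (m a1 a2 a : R).
Hypotheses (d0 : (0 < d)%N) (a20 : 0 < a2) (a0 : 0 < a) (aa : a ^+ 2 = a1 ^+ 2 + a2 ^+ 2).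

Notation Pu := (gs d (u_mean d m) (u_sd d)).
Notation n := (d * d)%N.
Notation sd := (goe_sd d).
Notation t := (@rank1 R d).
Notation PW := (gs n (fun=> 0 : R) sd).
Notation J := (Jt m a1 d0).
Notation mt := (mom_rank1 m d0).
Notation pm1 := (pm d m a1).
Notation cov := (cov d m a1).
Notation F2 := (cov2 d m a1).
Notation N := (env d m a1).

Let sd0 k : (k < n)%N -> 0 < sd k :> R. Proof. by move=> _; exact: goe_sd_gt0. Qed.
Let mu := mom_u m d0.
Let mb := mom_pm m a1 d0.
Let mC := mom_cov m a1 d0.
Let mu1 := mom_J1 m a1 d0.
Let mF2 := mom_cov2 m a1 d0.

Let md1 : mom J (fun p => dir d p.1).
Proof. exact: (mom_joint_fst n sd mt a1 (mom_dir m d0)). Qed.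

Let dl (i : nat) (p : seqR R * seqR R) : R := p.1 i - pm1 i p.2.
Let Cd (i : nat) (p : seqR R * seqR R) : R := \sum_(j < d) cov i j p.2 * dl j p.
Let Cu (i : nat) (p : seqR R * seqR R) : R := \sum_(j < d) cov i j p.2 * p.1 j.
Let e1 (p : seqR R * seqR R) : R := dir d p.1 - m.
(** Error of [updated_estimator] without the fresh noise. The projected signal is [a2 * dir * u];
    replacing [dir] by its mean [m] gives the [Cd] term once [a2 * m] times the posterior mean is
    subtracted, and the fluctuation [e1] gives the [Cu] term. *)
Let y (i : nat) (p : seqR R * seqR R) : R := dl i p - a2 * m * Cd i p - a2 * e1 p * Cu i p.

Let mdl (i : 'I_d) : mom J (dl i). Proof. by rewrite /dl; mom_tac. Qed.
Let mCd (i : 'I_d) : mom J (Cd i). Proof. by rewrite /Cd; mom_tac. Qed.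
Let mCu (i : 'I_d) : mom J (Cu i). Proof. by rewrite /Cu; mom_tac. Qed.
Let me1 : mom J e1. Proof. by rewrite /e1; mom_tac. Qed.
Let my (i : 'I_d) : mom J (y i). Proof. by rewrite /y; mom_tac. Qed.

(* One step of gradient flow from the posterior mean: the fresh observation is projected
   onto the prior direction and multiplied by the posterior covariance. *)
Definition updated_estimator (i : nat) (w : seqR R * seqR R) : R :=
  pm1 i w.1 + \sum_(j < d) cov i j w.1 *
    (\sum_(l < d) w.2 (idx d j l) / Num.sqrt d%:R - a2 * m * pm1 j w.1).

Lemma measurable_cov (i j : 'I_d) : measurable_fun setT (cov i j).
Proof.
have muij : mom Pu (fun u => u i * u j) by mom_tac.
apply: measurable_funB; first exact: (measurable_avg sd0 mt a1 muij).
by apply: measurable_funM; exact: (measurable_avg sd0 mt a1 (mu _)).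
Qed.

Lemma measurable_updated_estimator (i : 'I_d) : measurable_fun setT (updated_estimator i).
Proof.
have mp (j : 'I_d) : measurable_fun setT (fun w : seqR R * seqR R => pm1 j w.1).
  by apply: (measurableT_comp _ measurable_fst); exact: (measurable_avg sd0 mt a1 (mu j)).
apply: measurable_funD => //; apply: measurable_sum => j.
apply: measurable_funM; first exact: (measurableT_comp (measurable_cov i j) measurable_fst).
apply: measurable_funB; last by apply: measurable_funM.
apply: measurable_sum => l; apply: measurable_funM => //.
exact: (measurableT_comp (@measurable_coord R _) measurable_snd).
Qed.

Lemma updated_estimator_obs2 (i : nat) (q : (seqR R * seqR R) * seqR R) :
  q.1.1 i - updated_estimator i (q.1.2, addv n q.2 (sig t a2 q.1.1)) =
  y i q.1 - \sum_(j < d) cov i j q.1.2 * (\sum_(l < d) q.2 (idx d j l) / Num.sqrt d%:R).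
Proof.
have E (j : 'I_d) : \sum_(l < d) addv n q.2 (sig t a2 q.1.1) (idx d j l) / Num.sqrt d%:R =
   \sum_(l < d) q.2 (idx d j l) / Num.sqrt d%:R + a2 * q.1.1 j * dir d q.1.1.
  rewrite /dir mulr_sumr -big_split/=; apply: eq_bigr => l _.
  by rewrite /addv (idx_lt d0)/= /sig (rank1_idx d0); ring.
rewrite /updated_estimator /=; under eq_bigr => j _ do rewrite E.
have aux (z : 'I_d -> R) :
   \sum_(j < d) cov i j q.1.2 * (z j + a2 * q.1.1 j * dir d q.1.1 - a2 * m * pm1 j q.1.2) =
   \sum_(j < d) cov i j q.1.2 * z j +
   a2 * dir d q.1.1 * Cu i q.1 - a2 * m * \sum_(j < d) cov i j q.1.2 * pm1 j q.1.2.
  move: (dir d q.1.1) => D.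
  by rewrite /Cu !mulr_sumr -big_split/= -sumrB; apply: eq_bigr => j _; ring.
rewrite (aux (fun j => \sum_(l < d) q.2 (idx d j l) / Num.sqrt d%:R)) {aux}.
have -> : \sum_(j < d) cov i j q.1.2 * pm1 j q.1.2 = Cu i q.1 - Cd i q.1.
  by rewrite /Cu /Cd -sumrB; apply: eq_bigr => j _; rewrite /dl; ring.
by rewrite /y /dl /e1; ring.
Qed.

Lemma mse_updated_estimator (i : 'I_d) :
  Ex Pu (fun u => u i ^+ 2) - Ex (Jt m a d0) (fun p => pm d m a i p.2 ^+ 2) <=
  Ex J (fun p => y i p ^+ 2 + 2 / d%:R * \sum_(j < d) cov i j p.2 ^+ 2).
Proof.
rewrite -(mse_joint sd0 mt a (mu i)).
pose F (p : (seqR R * seqR R) * seqR R) := (p.1.1 i - updated_estimator i (p.1.2, p.2)) ^+ 2.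
have mF : measurable_fun setT F.
  apply: measurable_funX; apply: measurable_funB.
    have mf : measurable_fun setT (fun p : (seqR R * seqR R) * seqR R => p.1.1).
      exact: (measurableT_comp measurable_fst measurable_fst).
    exact: (measurableT_comp (@measurable_coord R i) mf).
  apply: (measurableT_comp (measurable_updated_estimator i)).
  apply: measurable_fun_pair => //.
  exact: (measurableT_comp measurable_snd measurable_fst).
have FE q : F (obs2 n t a2 q) =
    (y i q.1 - \sum_(j < d) cov i j q.1.2 * (\sum_(l < d) q.2 (idx d j l) / Num.sqrt d%:R)) ^+ 2.
  by rewrite -updated_estimator_obs2.
have mw (j l : 'I_d) : mom (pprod J PW) (fun p => p.2 (idx d j l)).
  exact: (mom_snd J (@mom_gs_coord _ n _ _ sd (idx_lt d0 j l) (goe_sd_gt0 d0 _))).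
have my1 : mom (pprod J PW) (fun p => y i p.1) := mom_fst PW (my i).
have mC1 (j : 'I_d) : mom (pprod J PW) (fun p => cov i j p.1.2) := mom_fst PW (mC i j).
have mFo : mom (pprod J PW) (fun q => F (obs2 n t a2 q)).
  have -> : (fun q => F (obs2 n t a2 q)) = (fun q => (y i q.1 -
      \sum_(j < d) cov i j q.1.2 * (\sum_(l < d) q.2 (idx d j l) / Num.sqrt d%:R)) ^+ 2).
    by apply/funext => q; exact: FE.
  by mom_tac.
have mFi : mom (joint2 n sd mt a1 a2) F by exact: mom_image.
apply: (le_trans (bayes_improve sd0 a20 a0 aa (mu i) (measurable_updated_estimator i) mFi)).
apply: le_trans (goe_noise d0 (A := fun j p => cov i j p.2) (my i) (mC i)).
rewrite le_eqVlt; apply/orP; left; apply/eqP.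
apply: (etrans (Ex_image mFi)); congr Ex; apply/funext => q; exact: FE.
Qed.

Let dlsq (p : seqR R * seqR R) : R := \sum_(i < d) dl i p ^+ 2.
Let dlC (p : seqR R * seqR R) : R := \sum_(i < d) dl i p * Cd i p.
Let dlu (p : seqR R * seqR R) : R := \sum_(i < d) dl i p * Cu i p.

Let mdlsq : mom J dlsq. Proof. by rewrite /dlsq; mom_tac. Qed.
Let mdlC : mom J dlC. Proof. by rewrite /dlC; mom_tac. Qed.
Let mdlu : mom J dlu. Proof. by rewrite /dlu; mom_tac. Qed.

(** Given the observation, [dl] has covariance matrix C, so dl^T C dl has conditional mean |C|^2.
    This is the quantity that the update gains. *)
Lemma Ex_dlC : Ex J dlC = Ex J (fun p => F2 p.2).
Proof.
have muij (i j : 'I_d) : mom Pu (fun u => u i * u j) by mom_tac.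
have H (i j : 'I_d) : Ex J (fun p => cov i j p.2 * (dl i p * dl j p)) = Ex J (fun p => cov i j p.2 ^+ 2).
  have N1 := nishi (f := cov i j) (mC i j) (muij i j).
  have m1 : mom J (fun p => cov i j p.2 * pm1 j p.2) by mom_tac.
  have m2 : mom J (fun p => cov i j p.2 * pm1 i p.2) by mom_tac.
  have N2 := nishi (f := fun w => cov i j w * pm1 j w) m1 (mu i).
  have N3 := nishi (f := fun w => cov i j w * pm1 i w) m2 (mu j).
  have -> : (fun p : seqR R * seqR R => cov i j p.2 * (dl i p * dl j p)) =
    (fun p => cov i j p.2 * (p.1 i * p.1 j) - cov i j p.2 * pm1 j p.2 * p.1 i
       - cov i j p.2 * pm1 i p.2 * p.1 j + cov i j p.2 * (pm1 i p.2 * pm1 j p.2)).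
    by apply/funext => p; rewrite /dl; ring.
  rewrite ExD; [|by mom_tac..]; rewrite ExB; [|by mom_tac..]; rewrite ExB; [|by mom_tac..].
  rewrite -N1 -N2 -N3.
  have mp2 := mom_pm2 m a1 d0 i j; rewrite /pm2 in mp2.
  have mpi : mom J (fun p => post d m a1 (fun u => u i) p.2) := mb i.
  have mpj : mom J (fun p => post d m a1 (fun u => u j) p.2) := mb j.
  rewrite -ExB; [|by mom_tac..]; rewrite -ExB; [|by mom_tac..]; rewrite -ExD; [|by mom_tac..].
  by congr Ex; apply/funext => p; rewrite /cov /pm2 /pm; ring.
have -> : dlC = (fun p => \sum_(i < d) \sum_(j < d) cov i j p.2 * (dl i p * dl j p)).
  apply/funext => p; apply: eq_bigr => i _; rewrite /Cd mulr_sumr; apply: eq_bigr => j _; ring.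
rewrite Ex_sum; last by move=> i _; mom_tac.
rewrite [RHS]Ex_sum; last by move=> i _; mom_tac.
apply: eq_bigr => i _.
rewrite Ex_sum; last by move=> j _; mom_tac.
rewrite [RHS]Ex_sum; last by move=> j _; mom_tac.
by apply: eq_bigr => j _; exact: H.
Qed.

(** When the square is expanded, the cross term with [a2 * m * Cd] is the gain. The other cross term
    carries the fluctuation [e1], and what remains is of order [a2^2]. *)
Lemma gain_pointwise B p : 1 <= B -> `|m| <= B ->
  \sum_(i < d) y i p ^+ 2 <= dlsq p - 2 * a2 * m * dlC p + a2 * Num.sqrt d%:R * e1 p ^+ 2
    + (a2 / Num.sqrt d%:R + a2 ^+ 2 * (4 * B ^+ 2 + 2)) * (F2 p.2 ^+ 2 + N p ^+ 4).
Proof.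
move=> B1 mB; set s := Num.sqrt d%:R : R.
have s0 : 0 < s by rewrite sqrtr_gt0 ltr0n.
pose c1 := \sum_(i < d) Cd i p ^+ 2; pose c2 := \sum_(i < d) Cu i p ^+ 2.
pose c3 := \sum_(i < d) (m * Cd i p + e1 p * Cu i p) ^+ 2.
have -> : \sum_(i < d) y i p ^+ 2 = dlsq p - 2 * a2 * m * dlC p - 2 * a2 * e1 p * dlu p + a2 ^+ 2 * c3.
  rewrite /dlsq /dlC /dlu /c3 !mulr_sumr -!sumrB -big_split/=; apply: eq_bigr => i _.
  by rewrite /y; ring.
have hX := pmsq_ge0 d m a1 p.2; have hS := nrm2_ge0 d p.1; have hF := cov2_ge0 d m a1 p.2.
have hN := env_ge1 d m a1 p.
have XN : pmsq d m a1 p.2 + nrm2 d p.1 <= N p by rewrite /env; lra.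
have HS : nrm2 d p.1 <= N p by lra.
have Hdl : dlsq p <= 2 * N p.
  apply: (@le_trans _ _ (2 * (pmsq d m a1 p.2 + nrm2 d p.1))); last by rewrite ler_pM2l.
  rewrite /dlsq /pmsq /nrm2 -big_split/= mulr_sumr; apply: ler_sum => i _.
  by rewrite /dl; have := sqr_ge0 (p.1 i + pm1 i p.2); rewrite sqrrB sqrrD; lra.
have dl0 : 0 <= dlsq p by apply: sumr_ge0 => i _; exact: sqr_ge0.
have m2 : m ^+ 2 <= B ^+ 2 by exact: ler_norm_sqr.
have B2 : 1 <= B ^+ 2 by rewrite exprn_ege1.
have He : e1 p ^+ 2 <= 2 * (1 + B ^+ 2) * N p.
  have := dir_nrm2 d0 p.1; have := sqr_ge0 (dir d p.1 + m); rewrite /e1 sqrrB sqrrD.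
  by move=> h1 h2; nra.
have hc1 : c1 <= F2 p.2 * dlsq p by exact: sqr_sum_mul.
have hc2 : c2 <= F2 p.2 * nrm2 d p.1 by exact: sqr_sum_mul.
have hdu : dlu p ^+ 2 <= dlsq p * c2 by exact: CS_sum.
have hc3 : c3 <= 2 * (m ^+ 2 * c1 + e1 p ^+ 2 * c2).
  rewrite /c3 /c1 /c2 !mulr_sumr -big_split/= mulr_sumr; apply: ler_sum => i _.
  have := sqr_ge0 (m * Cd i p - e1 p * Cu i p); rewrite sqrrB sqrrD !exprMn; lra.
have N0 : 0 <= N p by lra.
have FN : 2 * (F2 p.2 * N p ^+ 2) <= F2 p.2 ^+ 2 + N p ^+ 4.
  have := sqr_ge0 (F2 p.2 - N p ^+ 2); rewrite sqrrB -exprM; lra.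
have FN0 : 0 <= F2 p.2 * N p by exact: mulr_ge0.
have FNN : F2 p.2 * N p <= F2 p.2 * N p ^+ 2.
  by rewrite ler_wpM2l// expr2 ler_peMl.
have c20 : 0 <= c2 by apply: sumr_ge0 => i _; exact: sqr_ge0.
have Hdu : dlu p ^+ 2 <= F2 p.2 ^+ 2 + N p ^+ 4.
  apply: (le_trans hdu); apply: le_trans FN.
  have -> : 2 * (F2 p.2 * N p ^+ 2) = (2 * N p) * (F2 p.2 * N p) by ring.
  apply: ler_pM => //; apply: (le_trans hc2); exact: ler_wpM2l.
have Hc3 : c3 <= (4 * B ^+ 2 + 2) * (F2 p.2 ^+ 2 + N p ^+ 4).
  apply: (@le_trans _ _ ((8 * B ^+ 2 + 4) * (F2 p.2 * N p ^+ 2))); last by nra.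
  have k1 : m ^+ 2 * c1 <= B ^+ 2 * (2 * (F2 p.2 * N p ^+ 2)).
    apply: ler_pM => //; first exact: sqr_ge0.
      by apply: sumr_ge0 => i _; exact: sqr_ge0.
    apply: (le_trans hc1); apply: (@le_trans _ _ (F2 p.2 * (2 * N p))); first exact: ler_wpM2l.
    by lra.
  have k2 : e1 p ^+ 2 * c2 <= 2 * (1 + B ^+ 2) * (F2 p.2 * N p ^+ 2).
    have -> : 2 * (1 + B ^+ 2) * (F2 p.2 * N p ^+ 2) = (2 * (1 + B ^+ 2) * N p) * (F2 p.2 * N p) by ring.
    apply: ler_pM => //; first exact: sqr_ge0.
    by apply: (le_trans hc2); exact: ler_wpM2l.
  by apply: (le_trans hc3); lra.
(* The parameter [sqrt d] is the right balance because [e1^2] has mean [1 / d]: both resulting parts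
   have mean of order [a2 / sqrt d]. *)
have Y := young (e1 p) (- dlu p) s0; rewrite sqrrN in Y.
have Y1 : - 2 * a2 * e1 p * dlu p <= a2 * s * e1 p ^+ 2 + a2 / s * (F2 p.2 ^+ 2 + N p ^+ 4).
  have H1 : e1 p * - dlu p * 2 <= s * e1 p ^+ 2 + s^-1 * (F2 p.2 ^+ 2 + N p ^+ 4).
    have := ler_wpM2l (_ : 0 <= s^-1) Hdu; rewrite invr_ge0 => /(_ (ltW s0)).
    by move: Y; rewrite [_ / s]mulrC; lra.
  by have := ler_wpM2l (ltW a20) H1; lra.
have Y2 := ler_wpM2l (sqr_ge0 a2) Hc3.
by lra.
Qed.

(** The gain is linear in [a2], the square root of the added strength, while the errors are of order
    [a2 / sqrt d], [a2^2] and [1 / d]; this is why many small steps gain more than one large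
    step. *)
Lemma gain_bound B : 1 <= B -> `|m| <= B ->
  2 * a2 * m * Ex J (fun p => F2 p.2) <=
  Ex (Jt m a d0) (fun p => pmsq d m a p.2) - Ex J (fun p => pmsq d m a1 p.2) +
  (4 * B ^+ 2 + 2) * (54 * (1 + 2 * (B ^+ 2 + 18) ^+ 4) + 1) * (a2 / Num.sqrt d%:R + a2 ^+ 2 + d%:R^-1).
Proof.
move=> B1 mB; set s := Num.sqrt d%:R : R.
have s0 : 0 < s by rewrite sqrtr_gt0 ltr0n.
have s2 : s ^+ 2 = d%:R by rewrite sqr_sqrtr// ler0n.
set K := (B ^+ 2 + 18) ^+ 4.
have K0 : 0 <= K by rewrite exprn_ge0// addr_ge0 ?sqr_ge0.
have HN := Ex_env_le a1 d0 B1 mB; rewrite -/K in HN.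
have mn := mom_nrm2 m d0.
have mN : mom J N.
  by have := mom_pmsq m a1 d0; have := mom_Jnrm2 m a1 d0; rewrite /env => h1 h2; mom_tac.
have mn2 : mom Pu (fun u => nrm2 d u ^+ 2) by mom_tac.
have HF : Ex J (fun p => F2 p.2 ^+ 2) <= K.
  apply: (@le_trans _ _ (Ex J (fun p => post d m a1 (fun u => nrm2 d u ^+ 2) p.2 ^+ (2 ^ 1)))).
    apply: le_Ex => [||p].
    - by mom_tac.
    - by apply: momX; exact: (mom_avg sd0 mt a1 mn2).
    - have c0 := cov2_ge0 d m a1 p.2; have c1 := cov2_le m a1 d0 p.2.
      by rewrite expn1 lerXn2r ?nnegrE// (le_trans c0 c1).
  apply: (le_trans (Ex_post_pow a1 d0 1 mn2)).
  have -> : (fun u : seqR R => `|nrm2 d u ^+ 2| ^+ (2 ^ 1)) = (fun u => nrm2 d u ^+ 4).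
    by apply/funext => u; rewrite expn1 ger0_norm ?sqr_ge0// -exprM.
  apply: (le_trans (Ex_nrm2_pow m d0 4)).
  have mm := sqr_ge0 m; have mB2 : m ^+ 2 <= B ^+ 2 by exact: ler_norm_sqr.
  by rewrite /K lerXn2r ?nnegrE; lra.
pose M := Ex J (fun p => F2 p.2 ^+ 2 + N p ^+ 4).
have HM : M <= 54 * (1 + 2 * K).
  by rewrite /M ExD; [|by mom_tac..]; lra.
have M0 : 0 <= M.
  by apply: Ex_ge0 => p; apply: addr_ge0; [exact: sqr_ge0|rewrite exprn_ge0// (le_trans ler01 (env_ge1 _ _ _ _))].
have Hy : Ex J (fun p => F2 p.2) <= M + 1.
  rewrite -[1](Ex_cst J) /M; have m1 := mom_cst J (1 : R).
  rewrite -ExD; [|by mom_tac..]; apply: le_Ex => [||p]; try by mom_tac.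
  have := sqr_ge0 (F2 p.2 - 1); rewrite sqrrB /=.
  have : 0 <= N p ^+ 4 by rewrite exprn_ge0// (le_trans ler01 (env_ge1 _ _ _ _)).
  have := cov2_ge0 d m a1 p.2; lra.
have V1 : Ex J (fun p => e1 p ^+ 2) = d%:R^-1.
  have me1u : mom Pu (fun u => dir d u - m) by have := mom_dir m d0 => md; mom_tac.
  by rewrite /e1 (Ex_joint_fst n sd mt a1 (momX 2 me1u)) Ex_dir_var.
have H1 : Ex Pu (fun u => \sum_(i < d) u i ^+ 2) - Ex (Jt m a d0) (fun p => pmsq d m a p.2) <=
    Ex J (fun p => (\sum_(i < d) y i p ^+ 2) + 2 / d%:R * F2 p.2).
  have mp (i : 'I_d) := mom_pm m a d0 i.
  have E1 : (fun p : seqR R * seqR R => \sum_(i < d) (y i p ^+ 2 + 2 / d%:R * \sum_(j < d) cov i j p.2 ^+ 2)) =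
     (fun p => (\sum_(i < d) y i p ^+ 2) + 2 / d%:R * F2 p.2).
    by apply/funext => p; rewrite big_split/= mulr_sumr.
  have A1 : Ex Pu (fun u => \sum_(i < d) u i ^+ 2) = \sum_(i < d) Ex Pu (fun u => u i ^+ 2).
    by apply: Ex_sum => i _; mom_tac.
  have A2 : Ex (Jt m a d0) (fun p => pmsq d m a p.2) =
      \sum_(i < d) Ex (Jt m a d0) (fun p => pm d m a i p.2 ^+ 2).
    by apply: Ex_sum => i _; mom_tac.
  have A3 : Ex J (fun p => \sum_(i < d) (y i p ^+ 2 + 2 / d%:R * \sum_(j < d) cov i j p.2 ^+ 2)) =
      \sum_(i < d) Ex J (fun p => y i p ^+ 2 + 2 / d%:R * \sum_(j < d) cov i j p.2 ^+ 2).
    by apply: Ex_sum => i _; mom_tac.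
  rewrite -E1 A1 A2 A3 -sumrB.
  by apply: ler_sum => i _; exact: mse_updated_estimator.
rewrite ExD in H1; [|by mom_tac..]; rewrite ExZl in H1; last by mom_tac.
have H2 : Ex J (fun p => \sum_(i < d) y i p ^+ 2) <=
  Ex J dlsq - 2 * a2 * m * Ex J dlC + a2 * s * Ex J (fun p => e1 p ^+ 2)
    + (a2 / s + a2 ^+ 2 * (4 * B ^+ 2 + 2)) * M.
  rewrite /M -!ExZl; [|by mom_tac..]; rewrite -ExB; [|by mom_tac..].
  rewrite -ExD; [|by mom_tac..]; rewrite -ExD; [|by mom_tac..].
  by apply: le_Ex => [||p]; try (by mom_tac); exact: gain_pointwise.
have H3 : Ex J dlsq = Ex Pu (fun u => \sum_(i < d) u i ^+ 2) - Ex J (fun p => pmsq d m a1 p.2).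
  rewrite /dlsq Ex_sum; last by move=> i _; mom_tac.
  under eq_bigr => i _ do rewrite (mse_joint sd0 mt a1 (mu i)).
  rewrite sumrB -Ex_sum; last by move=> i _; mom_tac.
  by rewrite -Ex_sum//; move=> i _; exact: momX (mb i).
rewrite Ex_dlC V1 H3 in H2.
set Y := Ex J (fun p => F2 p.2) in Hy H1 H2 *.
set Qa := Ex (Jt m a d0) (fun p => pmsq d m a p.2).
have {}H1 := le_trans H1 (lerD H2 (lexx _)).
rewrite -/Qa in H1.
have -> : a2 / s = a2 * s / d%:R by rewrite -s2; field; rewrite gt_eqF.
have Es : a2 / s = a2 * s / d%:R by rewrite -s2; field; rewrite gt_eqF.
have Z1 : 0 <= a2 * s / d%:R by rewrite -Es divr_ge0 ?ltW.
rewrite Es in H1.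
set z := a2 * s / d%:R in Z1 H1 *.
have Z2 : 0 <= a2 ^+ 2 by exact: sqr_ge0.
have Z3 : 0 <= d%:R^-1 :> R by rewrite invr_ge0 ler0n.
have B2 : 1 <= B ^+ 2 by rewrite exprn_ege1.
set U := 54 * (1 + 2 * K) + 1.
have U1 : M + 1 <= U by rewrite /U; lra.
have W1 : z + z * M <= (4 * B ^+ 2 + 2) * U * z.
  have -> : z + z * M = (1 + M) * z by ring.
  by apply: ler_wpM2r => //; nra.
have W2 : a2 ^+ 2 * (4 * B ^+ 2 + 2) * M <= (4 * B ^+ 2 + 2) * U * a2 ^+ 2.
  rewrite [leLHS](_ : _ = (4 * B ^+ 2 + 2) * M * a2 ^+ 2); last by ring.
  by apply: ler_wpM2r => //; apply: ler_wpM2l; lra.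
have W3 : 2 / d%:R * Y <= (4 * B ^+ 2 + 2) * U * d%:R^-1.
  rewrite [leLHS](_ : _ = 2 * Y * d%:R^-1); last by ring.
  by apply: ler_wpM2r => //; nra.
move: H1; rewrite mulrDl; lra.
Qed.

End Gain.

Section Window.
Context {R : realType}.

(** [avg2_mono] for each product [u i * u j], the second observation having the missing strength
    [a^2 - a1^2]. *)
Lemma pm2sq_mono (d : nat) (m a1 a : R) (d0 : (0 < d)%N) : 0 <= a1 -> 0 < a -> a1 <= a ->
  Ex (Jt m a1 d0) (fun p => pm2sq d m a1 p.2) <= Ex (Jt m a d0) (fun p => pm2sq d m a p.2).
Proof.
move=> a10 a0; rewrite le_eqVlt => /orP[/eqP->//|a1a].
have sd0 k : (k < d * d)%N -> 0 < goe_sd d k :> R by move=> _; exact: goe_sd_gt0.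
have ga : 0 < a ^+ 2 - a1 ^+ 2 by rewrite subr_gt0 ltrXn2r// nnegrE ltW.
have a20 : 0 < Num.sqrt (a ^+ 2 - a1 ^+ 2) by rewrite sqrtr_gt0.
have aa : a ^+ 2 = a1 ^+ 2 + Num.sqrt (a ^+ 2 - a1 ^+ 2) ^+ 2.
  by rewrite sqr_sqrtr 1?ltW// addrC subrK.
have mu := mom_u m d0.
have muij (i j : 'I_d) : mom (gs d (u_mean d m) (u_sd d)) (fun u => u i * u j) by mom_tac.
have m1 := mom_pm2 m a1 d0; have m2 := mom_pm2 m a d0.
rewrite /pm2sq !Ex_sum; try by move=> i _; mom_tac.
apply: ler_sum => i _; rewrite !Ex_sum; try by move=> j _; mom_tac.
apply: ler_sum => j _.
exact: (avg2_mono sd0 (mom_rank1 m d0) a20 a0 aa (muij i j)).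
Qed.

(* Pigeonhole: by [gain_bound], a step at which the posterior covariance is large increases the
   bounded quantity E|b|^2 by an amount proportional to the square root of the step in the signal
   strength, so that this cannot happen at all steps of a fine subdivision. *)
Lemma thermal_window (B mu e y0 : R) : 1 <= B -> 0 < mu -> 0 < e <= 1 -> 0 < y0 ->
  exists D0 : nat, forall (d : nat) (d0 : (0 < d)%N) (m rs : R), (D0 <= d)%N ->
    mu / 2 <= m -> `|m| <= B -> 0 < rs ->
    exists a1, [/\ 0 < a1, rs <= a1 ^+ 2, a1 ^+ 2 < rs + e ^+ 2 &
      Ex (Jt m a1 d0) (fun p => cov2 d m a1 p.2) <= y0].
Proof.
move=> B1 mu0 /andP[e0 e1] y00.
pose kap := (4 * B ^+ 2 + 2) * (54 * (1 + 2 * (B ^+ 2 + 18) ^+ 4) + 1).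
have B2 := sqr_ge0 B.
have kap0 : 0 <= kap.
  have : 0 <= (B ^+ 2 + 18) ^+ 4 by apply: exprn_ge0; lra.
  by move=> h; apply: mulr_ge0; lra.
(* [B^2 + 6] bounds the mean of [pmsq] by [Ex_pmsq_pow] at exponent 1, and [2 * kap] the accumulated
   errors. N is chosen so that N^2 gains of size [2 t m y0] exceed the sum. *)
pose L := B ^+ 2 + 6 + 2 * kap.
have L0 : 0 <= L by rewrite /L; lra.
have emy : 0 < e * mu * y0 by rewrite !mulr_gt0.
have [N NL N00] : exists2 N : nat, L < N%:R * (e * mu * y0) & (0 < N)%N.
  exists (Num.bound (L / (e * mu * y0))).+1 => //.
  rewrite -ltr_pdivrMr//; apply: (@lt_le_trans _ _ (Num.bound (L / (e * mu * y0)))%:R).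
    by apply: archi_boundP; rewrite divr_ge0// ltW.
  by rewrite ler_nat.
have N0 : 0 < N%:R :> R by rewrite ltr0n.
(* This gives [2 N^2 <= sqrt d], so that over N^2 steps the errors [t / sqrt d] and [1 / d] each add
   up to at most 1/2. *)
exists (4 * N ^ 4)%N => d d0 m rs Dd mm mB rs0.
(* N^2 steps of strength [t^2] exactly fill a window of width [e^2]. *)
pose t := e / N%:R.
have t0 : 0 < t by rewrite divr_gt0.
have Nt : N%:R * t = e by rewrite /t mulrC divfK// gt_eqF.
have Nt2 : N%:R ^+ 2 * t ^+ 2 = e ^+ 2 by rewrite -exprMn Nt.
apply: contrapT => H.
have {}H a1 : 0 < a1 -> rs <= a1 ^+ 2 -> a1 ^+ 2 < rs + e ^+ 2 ->
    y0 < Ex (Jt m a1 d0) (fun p => cov2 d m a1 p.2).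
  move=> h1 h2 h3; rewrite ltNge; apply/negP => h4; apply: H; by exists a1.
pose al k := Num.sqrt (rs + k%:R * t ^+ 2).
have kt0 k : 0 <= k%:R * t ^+ 2 by rewrite mulr_ge0 ?ler0n ?sqr_ge0.
have al2 k : al k ^+ 2 = rs + k%:R * t ^+ 2 by rewrite sqr_sqrtr// addr_ge0// ltW.
have al0 k : 0 < al k by rewrite sqrtr_gt0 ltr_pwDl.
pose Q k := Ex (Jt m (al k) d0) (fun p => pmsq d m (al k) p.2).
pose s := t / Num.sqrt d%:R + t ^+ 2 + d%:R^-1.
have step k : (k < N ^ 2)%N -> 2 * t * m * y0 <= Q k.+1 - Q k + kap * s.
  move=> kN; have aa : al k.+1 ^+ 2 = al k ^+ 2 + t ^+ 2 by rewrite !al2 -natr1; ring.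
  apply: le_trans (gain_bound d0 t0 (al0 k.+1) aa B1 mB).
  rewrite ler_wpM2l//; first by apply: mulr_ge0; lra.
  apply/ltW/H => //; rewrite al2; first by rewrite lerDl.
  by rewrite ltrD2l -Nt2 ltr_pM2r ?exprn_gt0// -natrX ltr_nat.
have : \sum_(k < N ^ 2) (2 * t * m * y0) <= \sum_(k < N ^ 2) (Q k.+1 - Q k + kap * s).
  by apply: ler_sum => k _; exact: step.
rewrite big_split/= !sum_ord_cst -(big_mkord xpredT (fun k => Q k.+1 - Q k)) telescope_sumr//.
have QN : Q (N ^ 2)%N <= B ^+ 2 + 6.
  have m2 : m ^+ 2 <= B ^+ 2 by exact: ler_norm_sqr.
  have E : (fun p : seqR R * seqR R => pmsq d m (al (N ^ 2)%N) p.2 ^+ (2 ^ 0)) =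
     (fun p => pmsq d m (al (N ^ 2)%N) p.2) by apply/funext => p; exact: expr1.
  have := Ex_pmsq_pow m (al (N ^ 2)%N) d0 0; rewrite E -/(Q _) expn0 mulr1 expr1.
  by lra.
have Q0 : 0 <= Q 0%N by apply: Ex_ge0 => p; exact: pmsq_ge0.
have dR : 0 < d%:R :> R by rewrite ltr0n.
have s0 : 0 < Num.sqrt d%:R :> R by rewrite sqrtr_gt0.
have N1 : 1 <= N%:R :> R by rewrite ler1n.
have sN : 2 * N%:R ^+ 2 <= Num.sqrt d%:R :> R.
  have n0 : 0 <= 2 * N%:R ^+ 2 :> R by apply: mulr_ge0 => //; exact: sqr_ge0.
  rewrite -(ger0_norm n0) -sqrtr_sqr ler_sqrt//.
  have -> : (2 * N%:R ^+ 2) ^+ 2 = 4 * N%:R ^+ 4 :> R by ring.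
  by rewrite -natrX -natrM ler_nat.
have dN : N%:R ^+ 2 * 2 <= d%:R :> R.
  rewrite -natrX -natrM ler_nat; apply: leq_trans Dd.
  by rewrite mulnC leq_mul// leq_pexp2l.
have S1 : N%:R ^+ 2 * (t / Num.sqrt d%:R) <= 2^-1.
  rewrite mulrA ler_pdivrMr//.
  have t1 : t <= 1 by rewrite -(ler_pM2l N0) Nt mulr1 (le_trans e1).
  apply: (le_trans (ler_wpM2l (sqr_ge0 (N%:R : R)) t1)).
  by rewrite mulr1 ler_pdivlMl.
have S2 : N%:R ^+ 2 * d%:R^-1 <= 2^-1 :> R by rewrite ler_pdivrMr// ler_pdivlMl// mulrC.
have S3 : s * N%:R ^+ 2 <= 2.
  have e2 : N%:R ^+ 2 * t ^+ 2 <= 1 by rewrite Nt2 expr_le1// ltW.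
  rewrite /s; move: S1 S2 e2; move: (N%:R ^+ 2) (t / _) (t ^+ 2) (d%:R^-1).
  by clear; move=> ? ? ? ? ? ? ?; lra.
have S4 : kap * s * (N ^ 2)%:R <= 2 * kap.
  by rewrite natrX -mulrA [leRHS]mulrC; exact: ler_wpM2l.
have S5 : N%:R * (e * mu * y0) <= 2 * t * m * y0 * (N ^ 2)%:R.
  have -> : 2 * t * m * y0 * (N ^ 2)%:R = N%:R * (N%:R * t * (2 * m) * y0).
    by rewrite natrX; ring.
  rewrite Nt; apply: ler_wpM2l; first exact: ltW.
  apply: ler_wpM2r; first exact: ltW.
  apply: ler_wpM2l; first exact: ltW.
  by rewrite mulrC -ler_pdivrMr.
rewrite leNgt => /negP; apply; apply: (@lt_le_trans _ _ (N%:R * (e * mu * y0))) S5.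
apply: le_lt_trans NL; rewrite /L; move: S4 QN Q0.
move: (kap) (B ^+ 2) (Q _) (Q _) (kap * s * _); clear=> *; lra.
Qed.

End Window.

(** * The fixed point, and the limit uniformly in the prior mean *)

Section UniformLimit.
Context {R : realType}.
Variables rho mu : R.
Hypotheses (rho1 : 1 <= rho) (mu0 : 0 < mu).

(** Sum [q - r] of the two roots of the quadratic, that is, minus its linear coefficient after
    division by [rho]. *)
Definition fixpt_lin : R := 1 + mu ^+ 2 - rho^-1.
(* The positive root of rho x^2 + (1 - rho (1 + mu^2)) x - mu^2. *)
Definition fixpt : R := (fixpt_lin + Num.sqrt (fixpt_lin ^+ 2 + 4 * (mu ^+ 2 / rho))) / 2.

Let rho0 : 0 < rho. Proof. exact: lt_le_trans rho1. Qed.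
Let mr0 : 0 < mu ^+ 2 / rho. Proof. by rewrite divr_gt0// exprn_gt0. Qed.

(** The condition [rho >= 1] matters here; the sign is needed for the estimate of the square root in
    [fixpt_le]. *)
Lemma fixpt_lin_ge0 : 0 <= fixpt_lin.
Proof.
have : rho^-1 <= 1 by rewrite invf_le1.
by have := sqr_ge0 mu; rewrite /fixpt_lin; lra.
Qed.

Lemma fixpt_prod : fixpt * (fixpt - fixpt_lin) = mu ^+ 2 / rho.
Proof.
have aux (l s : R) : s ^+ 2 = l ^+ 2 + 4 * (mu ^+ 2 / rho) ->
    (l + s) / 2 * ((l + s) / 2 - l) = mu ^+ 2 / rho.
  move=> E; have -> : (l + s) / 2 * ((l + s) / 2 - l) = (s ^+ 2 - l ^+ 2) / 4 by field.
  by rewrite E; field; rewrite gt_eqF.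
apply: aux; rewrite sqr_sqrtr// addr_ge0 ?sqr_ge0//.
by have := mr0; lra.
Qed.

Lemma fixpt_gt : fixpt_lin < fixpt.
Proof.
have : fixpt_lin < Num.sqrt (fixpt_lin ^+ 2 + 4 * (mu ^+ 2 / rho)).
  rewrite -{1}(ger0_norm fixpt_lin_ge0) -sqrtr_sqr ltr_sqrt; first by have := mr0; lra.
  by have := mr0; have := sqr_ge0 fixpt_lin; lra.
by rewrite /fixpt; lra.
Qed.

Lemma fixpt_ge0 : 0 <= fixpt.
Proof. exact: le_trans fixpt_lin_ge0 (ltW fixpt_gt). Qed.

(** From [sqrt (l^2 + 4 v^2) <= l + 2 v] for nonnegative l and v, with [v = mu / sqrt rho]. *)
Lemma fixpt_le : fixpt <= fixpt_lin + mu / Num.sqrt rho.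
Proof.
have s0 : 0 < Num.sqrt rho by rewrite sqrtr_gt0.
have s2 : Num.sqrt rho ^+ 2 = rho by rewrite sqr_sqrtr// ltW.
have v0 : 0 <= mu / Num.sqrt rho by rewrite divr_ge0// ltW.
have E : (mu / Num.sqrt rho) ^+ 2 = mu ^+ 2 / rho by rewrite expr_div_n s2.
have l0 := fixpt_lin_ge0.
have : Num.sqrt (fixpt_lin ^+ 2 + 4 * (mu ^+ 2 / rho)) <= fixpt_lin + 2 * (mu / Num.sqrt rho).
  have w0 : 0 <= fixpt_lin + 2 * (mu / Num.sqrt rho) by lra.
  rewrite -[leRHS](ger0_norm w0) -sqrtr_sqr ler_sqrt ?sqr_ge0// -E.
  have -> : (fixpt_lin + 2 * (mu / Num.sqrt rho)) ^+ 2 = fixpt_lin ^+ 2 + 4 * (mu / Num.sqrt rho) ^+ 2 +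
    4 * (fixpt_lin * (mu / Num.sqrt rho)) by ring.
  by rewrite lerDl mulr_ge0// mulr_ge0.
by rewrite /fixpt; lra.
Qed.

Lemma coef_close (B e x m : R) : 1 <= B -> rho <= B -> mu <= B -> `|m| <= B ->
  `|x - rho| <= e -> `|m - mu| <= e ->
  `|(1 - x * (1 + m ^+ 2)) - (1 - rho * (1 + mu ^+ 2))| <= 4 * B ^+ 2 * e /\
  `|m ^+ 2 - mu ^+ 2| <= 4 * B ^+ 2 * e.
Proof.
move=> B1 rB muB mB xe me.
have e0 : 0 <= e := le_trans (normr_ge0 _) xe.
have B2 : B <= B ^+ 2 by rewrite expr2 ler_peMl// (le_trans ler01).
have eB : 0 <= e * B ^+ 2 by rewrite mulr_ge0 ?sqr_ge0.
have m2 : `|1 + m ^+ 2| <= 1 + B ^+ 2.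
  rewrite ger0_norm; last by have := sqr_ge0 m; lra.
  by rewrite lerD2l; exact: ler_norm_sqr.
have mm : `|m + mu| <= 2 * B.
  by rewrite (le_trans (ler_normD _ _))// (ger0_norm (ltW mu0)); lra.
have H1 : `|m ^+ 2 - mu ^+ 2| <= e * (2 * B).
  by rewrite subr_sqr normrM ler_pM.
split; last first.
  by apply: (le_trans H1); have := ler_wpM2l e0 B2; lra.
have -> : 1 - x * (1 + m ^+ 2) - (1 - rho * (1 + mu ^+ 2)) =
  - ((x - rho) * (1 + m ^+ 2) + rho * (m ^+ 2 - mu ^+ 2)) by ring.
rewrite normrN (le_trans (ler_normD _ _))// !normrM (ger0_norm (ltW rho0)).
have K1 : `|x - rho| * `|1 + m ^+ 2| <= e * (1 + B ^+ 2) by rewrite ler_pM.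
have K2 : rho * `|m ^+ 2 - mu ^+ 2| <= B * (e * (2 * B)) by rewrite ler_pM// ltW.
have K3 := ler_wpM2l e0 (le_trans B1 B2).
by lra.
Qed.

Lemma pm2sq_limit (eta : R) : 0 < eta -> exists2 dlt : R, 0 < dlt &
  exists D0 : nat, forall (d : nat) (d0 : (0 < d)%N) (m : R), (D0 <= d)%N -> `|m - mu| <= dlt ->
    `|Ex (Jt m (Num.sqrt rho) d0) (fun p => pm2sq d m (Num.sqrt rho) p.2) - fixpt ^+ 2| <= eta.
Proof.
move=> eta0; have r1 := rho1; have m0 := mu0; have := fixpt_gt; have := fixpt_prod; have := fixpt_ge0.
move: (fixpt) => q q0 qprod qgt.
pose B := 2 + rho + mu + q.
have B1 : 1 <= B by rewrite /B; lra.
pose r := q - fixpt_lin.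
have r0 : 0 < r by rewrite subr_gt0.
have [c c0 Hc] := overlap_limit B1 (mulr_gt0 rho0 r0).
(* The bound by [mu] ensures [mu / 2 <= m] for every m considered, and the last bound makes the
   final error [c * th] at most [eta]. *)
pose th := Num.min 1 (Num.min mu (eta / (c + 1))).
have th0 : 0 < th by rewrite !lt_min ltr01 mu0 divr_gt0//; lra.
have th1 : th <= 1 by rewrite ge_min lexx.
have thm : th <= mu by rewrite !ge_min lexx orbT.
have thc : c * th <= eta.
  have : th <= eta / (c + 1) by rewrite !ge_min lexx !orbT.
  rewrite ler_pdivlMr; last by lra.
  by apply: le_trans; rewrite mulrC ler_wpM2l ?ltW//; lra.
(* Makes the error [4 B^2 e^2] from [coef_close] equal to [th^2], the error that [overlap_limit]
   admits. *)
pose e := th / (2 * B).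
have B20 : 0 < 2 * B by lra.
have e0 : 0 < e by rewrite divr_gt0.
have ee : 4 * B ^+ 2 * e ^+ 2 = th ^+ 2 by rewrite /e; field; lra.
have e12 : e <= 2^-1 by rewrite ler_pdivrMr//; lra.
have em : e <= mu / 2.
  rewrite ler_pdivrMr// (le_trans thm)//.
  by rewrite mulrA divfK ?gt_eqF// ler_peMr// ltW.
have e2e : e ^+ 2 <= e / 2 by rewrite expr2 ler_wpM2l// ltW.
have y0 : 0 < th ^+ 8 by rewrite exprn_gt0.
have e01 : 0 < e <= 1 by rewrite e0/=; lra.
have [D1 HD] := thermal_window B1 mu0 e01 y0.
exists (e ^+ 2); first by rewrite exprn_gt0.
exists (maxn D1 (Num.bound (th ^+ 8)^-1)) => d d0 m; rewrite geq_max => /andP[dD1 dD2] mmu.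
have dth : d%:R^-1 <= th ^+ 8.
  rewrite -[leRHS]invrK lef_pV2 ?posrE ?invr_gt0 ?ltr0n//.
  apply: le_trans (ltW (archi_boundP _)) _; first by rewrite invr_ge0 ltW.
  by rewrite ler_nat.
have mB : `|m| <= B.
  have := ler_normD (m - mu) mu; rewrite subrK (ger0_norm (ltW mu0)) /B; lra.
have m2 : mu / 2 <= m by move: mmu; rewrite ler_norml => /andP[]; lra.
have G a : 0 < a -> rho - e ^+ 2 <= a ^+ 2 -> a ^+ 2 <= rho + e ^+ 2 ->
    Ex (Jt m a d0) (fun p => cov2 d m a p.2) <= th ^+ 8 ->
    `|Ex (Jt m a d0) (fun p => pm2sq d m a p.2) - q ^+ 2| <= eta.
  move=> a0 h1 h2 hy; apply: le_trans thc.
  have xe : `|a ^+ 2 - rho| <= e ^+ 2 by rewrite ler_norml; apply/andP; split; lra.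
  have rB : rho <= B by rewrite /B; lra.
  have muB : mu <= B by rewrite /B; lra.
  have [C1 C2] := coef_close B1 rB muB mB xe mmu; rewrite !ee in C1 C2.
  have B2 : 1 <= B ^+ 2 by rewrite exprn_ege1.
  have E1 : rho * (r - q) = 1 - rho * (1 + mu ^+ 2).
    by rewrite /r /fixpt_lin; field; rewrite gt_eqF.
  have E2 : rho * (q * r) = mu ^+ 2 by rewrite qprod mulrC divfK// gt_eqF.
  apply: (Hc d m a q r rho th d0) => //.
  - by rewrite th0.
  - by rewrite q0 /B; lra.
  - by rewrite ltW.
  - by rewrite /B; lra.
  - by apply: (le_trans xe); rewrite -ee ler_peMl ?sqr_ge0//; lra.
  - by rewrite E1.
  - by rewrite E2.
pose G0 := Ex (Jt m (Num.sqrt rho) d0) (fun p => pm2sq d m (Num.sqrt rho) p.2).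
have s0 : 0 < Num.sqrt rho by rewrite sqrtr_gt0.
have s2 : Num.sqrt rho ^+ 2 = rho by rewrite sqr_sqrtr// ltW.
have sq_le a b : 0 < a -> 0 < b -> a ^+ 2 <= b ^+ 2 -> a <= b :> R.
  by move=> a0 b0; rewrite ler_pXn2r// nnegrE ltW.
have re : 0 < rho - e ^+ 2 by lra.
(* One good strength lies in [[rho, rho + e^2)] and another in [[rho - e^2, rho)]; by monotonicity
   the value at [rho] lies between theirs. *)
have [a1 [a10 a1l a1u y1]] := HD d d0 m rho dD1 m2 mB rho0.
have [a2 [a20 a2l a2u y2]] := HD d d0 m (rho - e ^+ 2) dD1 m2 mB re.
rewrite subrK in a2u.
have e20 := sqr_ge0 e.
have le1 : rho - e ^+ 2 <= rho by rewrite lerBlDr lerDl.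
have le2 : rho <= rho + e ^+ 2 by rewrite lerDl.
have U := G a1 a10 (le_trans le1 a1l) (ltW a1u) y1.
have L := G a2 a20 a2l (le_trans (ltW a2u) le2) y2.
have M1 : G0 <= Ex (Jt m a1 d0) (fun p => pm2sq d m a1 p.2).
  by apply: pm2sq_mono => //; apply: sq_le => //; rewrite s2.
have M2 : Ex (Jt m a2 d0) (fun p => pm2sq d m a2 p.2) <= G0.
  by apply: pm2sq_mono => //; [exact: ltW|apply: sq_le => //; rewrite s2 ltW].
have [_ u] := ler_normlP _ _ U; have [l _] := ler_normlP _ _ L.
apply/ler_normlP; split.
  by apply: le_trans l; rewrite lerN2; exact: (lerB M2 (lexx _)).
exact: (le_trans (lerB M1 (lexx _)) u).
Qed.

End UniformLimit.

(** * The limit *)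

Section CrossCheck.
Context {R : realType}.
Variables (d : nat) (m rho : R).
Hypothesis d0 : (0 < d)%N.

Notation Pu := (gs d (u_mean d m) (u_sd d)).
Notation n := (d * d)%N.
Notation sd := (goe_sd d).
Notation t := (@rank1 R d).
Notation PW := (gs n (fun=> 0 : R) sd).
Notation a := (Num.sqrt rho).
Notation J := (Jt m a d0).

Let sd0 k : (k < n)%N -> 0 < sd k :> R. Proof. by move=> _; exact: goe_sd_gt0. Qed.

Lemma normal_pdf_shift (s x c : R) : 0 < s ->
  normal_pdf 0 s (x - c) = normal_pdf 0 s x * expR (x * c / s ^+ 2 - c ^+ 2 / (s ^+ 2 *+ 2)).
Proof.
move=> s0; rewrite !normal_pdf_gt0E// !subr0 -[RHS]mulrA -expRD; congr (_ * expR _).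
by rewrite -mulr_natr; field; rewrite gt_eqF.
Qed.

Lemma lik_prod (v w : seqR R) : lik n sd t a v w =
  \prod_(i < d) \prod_(j < d | (i <= j)%N) expR (w (idx d i j) * (a * (v i * v j)) / sd (idx d i j) ^+ 2 -
    (a * (v i * v j)) ^+ 2 / (sd (idx d i j) ^+ 2 *+ 2)).
Proof.
rewrite /lik /llr (@sum_mul_ord R d d (fun k => w k * sig t a v k / sd k ^+ 2 -
   sig t a v k ^+ 2 / (sd k ^+ 2 *+ 2))) expR_sum; apply: eq_bigr => i _.
rewrite expR_sum [RHS]big_mkcond; apply: eq_bigr => j _.
have q1 : ((i * d + j) %/ d)%N = i by rewrite divnMDl// divn_small ?addn0.
have q2 : ((i * d + j) %% d)%N = j by rewrite modnMDl modn_small.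
case: (leqP i j) => ij.
  have -> : (i * d + j)%N = idx d i j by rewrite /idx (minn_idPl ij) (maxn_idPr ij).
  by rewrite /sig (rank1_idx d0).
have -> : sig t a v (i * d + j)%N = 0 by rewrite /sig /rank1 q1 q2 [(i <= j)%N]leqNgt ij andbF mulr0.
rewrite !mulr0 mul0r expr0n/= mul0r subrr.
exact: expR0.
Qed.

(** The first factor does not depend on [v] and cancels in Bayes' quotient, which thus becomes a
    posterior average with weight [lik]. *)
Lemma goe_density_spike (u v w : seqR R) :
  goe_density d (goe_of d w + spike d rho u - spike d rho v) =
  goe_density d (goe_of d (addv n w (sig t a u))) * lik n sd t a v (addv n w (sig t a u)).
Proof.
set w' := addv n w (sig t a u).
rewrite lik_prod /goe_density -big_split/=; apply: eq_bigr => i _.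
rewrite -big_split/=; apply: eq_bigr => j ij.
have E : w (idx d i j) + a * (u i * u j) = w' (idx d i j).
  by rewrite /w' /addv (idx_lt d0)/= /sig (rank1_idx d0).
have S : (if i == j then Num.sqrt (2 / d%:R) else Num.sqrt (1 / d%:R)) = sd (idx d i j) :> R.
  rewrite /goe_sd (idx_div d0) idx_mod (minn_idPl ij) (maxn_idPr ij).
  by rewrite -(inj_eq val_inj).
rewrite !mxE -/(idx d i j) S -normal_pdf_shift ?goe_sd_gt0//; congr normal_pdf.
by rewrite -E; ring.
Qed.

Lemma goe_density_gt0 (w : seqR R) : 0 < goe_density d (goe_of d w).
Proof.
apply: prodr_gt0 => i _; apply: prodr_gt0 => j _.
have s0 : 0 < (if i == j then Num.sqrt (2 / d%:R) else Num.sqrt (1 / d%:R)) :> R.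
  by case: ifP => _; rewrite sqrtr_gt0 divr_gt0// ltr0n.
rewrite normal_pdf_gt0E// mulr_gt0 ?expR_gt0// invr_gt0 mulr_gt0// sqrtr_gt0.
by rewrite mulrn_wgt0// pi_gt0.
Qed.

Lemma gauss_iter_lik (h : seqR R -> R) (D : R) (w : seqR R) : mom Pu h ->
  gauss_iter d (u_mean d m) (u_sd d) (fun v => h v * (D * lik n sd t a v w)) =
  D * num Pu n sd t a h w.
Proof.
move=> mh; have ml := mom_lik sd0 (mom_rank1 m d0) a w mh.
have mD : mom Pu (fun v => D * (h v * lik n sd t a v w)) := momM (mom_cst Pu D) ml.
have -> : (fun v => h v * (D * lik n sd t a v w)) = (fun v => D * (h v * lik n sd t a v w)).
  by apply/funext => v; rewrite mulrCA.
by rewrite (gauss_iterE (mom_integrable mD)) -/(Ex Pu _) ExZl.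
Qed.

Lemma frob2_post_mean (u w : seqR R) :
  frob2 d (post_mean d rho m (goe_of d w + spike d rho u)) =
  pm2sq d m a (addv n w (sig t a u)).
Proof.
have mu := mom_u m d0.
apply: eq_bigr => i _; apply: eq_bigr => j _; rewrite mxE; congr (_ ^+ 2).
set w' := addv n w (sig t a u).
have muij : mom Pu (fun u => u i * u j) by mom_tac.
under [X in gauss_iter _ _ _ X / _]eq_fun do rewrite goe_density_spike -/w'.
under [X in _ / gauss_iter _ _ _ X]eq_fun do rewrite goe_density_spike -/w'.
have D0 := goe_density_gt0 w'; set D := goe_density _ _ in D0 *.
rewrite (gauss_iter_lik D w' muij).
have -> : (fun v => D * lik n sd t a v w') = (fun v => cst 1 v * (D * lik n sd t a v w')).
  by apply/funext => v; rewrite mul1r.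
rewrite (gauss_iter_lik D w' (mom_cst Pu 1)) -Zn_num /pm2 /post /avg.
by rewrite -mulf_div divff ?mul1r// gt_eqF.
Qed.

Lemma cross_checkE : cross_check d rho m = Ex J (fun p => pm2sq d m a p.2).
Proof.
have mG := mom_pm2sq m a d0.
have mGo := mom_imageP mG.
rewrite (Ex_image mG) (Ex_prod1 mGo).
have iG := mom_integrable mGo.
rewrite /cross_check.
have -> : (fun u => gauss_iter n (fun=> 0) sd
     (fun w => frob2 d (post_mean d rho m (goe_of d w + spike d rho u)))) =
   (fun u => gauss_iter n (fun=> 0) sd (fun w => pm2sq d m a (addv n w (sig t a u)))).
  by apply/funext => u; congr gauss_iter; apply/funext => w; exact: frob2_post_mean.
(* The inner iterated integral is known to equal the expectation only for almost every [u]. *)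
apply: (gauss_iter_ae (psi := fun u => Ex PW (fun w => pm2sq d m a (addv n w (sig t a u))))).
  have mf : measurable_fun setT (fun u => Ex PW (fun w => pm2sq d m a (addv n w (sig t a u)))).
    exact: (measurableT_comp (fine_measurable measurableT) (measurable_fubini_F iG)).
  apply: le_integrable (integrable_fubini_F iG) => //; first by apply/measurable_EFinP.
  move=> u _; rewrite /= /Ex /Rintegral /fubini_F /=.
  by case: (integral _ _ _) => [r| |] /=; rewrite ?normr0 ?leey ?lexx.
apply: filterS (ae_integrable1 iG) => u iu.
by rewrite (gauss_iterE iu).
Qed.

End CrossCheck.

(** * The truncated average over the radius *)

Section Truncation.
Context {R : realType}.

(** The hypothesis says that [(|x|^2 - 1)^2] is below [d^(-1/2)], the square of the threshold, and
    [|al - 1| <= |al^2 - 1|] for nonnegative [al]. *)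
Lemma radius_close (d : nat) (x : nat -> R) : (0 < d)%N ->
  Num.sqrt d%:R * (nrm2 d x - 1) ^+ 2 < 1 ->
  `|Num.sqrt (\sum_(i < d) x i ^+ 2) - 1| <= powR d%:R (- (1 / 4)).
Proof.
move=> d0; rewrite -/(nrm2 d x); set b := powR _ _; set al := Num.sqrt (nrm2 d x) => H.
have dR : 0 < d%:R :> R by rewrite ltr0n.
have b0 : 0 < b by exact: powR_gt0.
have b4 : b ^+ 4 * d%:R = 1.
  rewrite -powR_mulrn ?ltW// /b -powRrM (_ : - (1 / 4) * 4%:R = -1); last by field.
  by rewrite powR_inv1 ?ltW// mulVf// gt_eqF.
have s0 : 0 < Num.sqrt d%:R :> R by rewrite sqrtr_gt0.
have b2 : b ^+ 2 * Num.sqrt d%:R = 1.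
  have p0 : 0 <= b ^+ 2 * Num.sqrt d%:R by rewrite mulr_ge0 ?sqr_ge0 ?ltW.
  by apply/eqP; rewrite -(eqrXn2 (n := 2))// expr1n exprMn -exprM sqr_sqrtr ?ltW// b4.
have al0 : 0 <= al by exact: sqrtr_ge0.
have al2 : al ^+ 2 = nrm2 d x by rewrite sqr_sqrtr// nrm2_ge0.
have H2 : (nrm2 d x - 1) ^+ 2 < b ^+ 2.
  by rewrite -(ltr_pM2l s0) [ltRHS]mulrC b2.
have H3 : `|nrm2 d x - 1| <= b.
  by rewrite -(ler_pXn2r (n := 2))// ?nnegrE ?(ltW b0)// real_normK ?num_real// ltW.
apply: le_trans H3.
have -> : nrm2 d x - 1 = (al - 1) * (al + 1) by rewrite -al2; ring.
by rewrite normrM ler_peMr// ger0_norm ?addr_ge0// lerDr.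
Qed.

Lemma cross_check_ge0 (d : nat) (rho m : R) : 0 <= cross_check d rho m.
Proof.
apply: gauss_iter_ge0 => u; apply: gauss_iter_ge0 => w.
by apply: sumr_ge0 => i _; apply: sumr_ge0 => j _; exact: sqr_ge0.
Qed.

(** Measurability of [cross_check] in the mean is never established. The lower bound therefore goes
    through a measurable minorant, [c] times the positive part of a polynomial [k] that is positive
    only where the indicator is 1. *)
Lemma truncated_cross_bounds (d : nat) (rho mu c C : R) : (0 < d)%N -> 0 <= c -> 0 <= C ->
  (forall al, `|al - 1| <= powR d%:R (- (1 / 4)) -> c <= cross_check d rho (mu * al) <= C) ->
  c * (1 - 2 / Num.sqrt d%:R) <= truncated_cross rho mu d <= C.
Proof.
move=> d0 c0 C0 H; set s := Num.sqrt d%:R : R.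
have s0 : 0 < s by rewrite sqrtr_gt0 ltr0n.
have s2 : s ^+ 2 = d%:R by rewrite sqr_sqrtr// ler0n.
(* By [Ex_nrm2_var] at mean 0, [k] has expectation [1 - 2 / sqrt d]; the form [1 + 0 ^+ 2] is the
   one in which that lemma applies. *)
pose k (x : seqR R) : R := 1 - s * (nrm2 d x - (1 + 0 ^+ 2)) ^+ 2.
pose f0 (x : seqR R) : R := c * Num.max 0 (k x).
pose f (x : seqR R) : R := let alpha := Num.sqrt (\sum_(i < d) x i ^+ 2) in
    (if `|alpha - 1| <= powR (d%:R) (- (1 / 4)) then 1 else 0) * cross_check d rho (mu * alpha).
have f0f x : 0 <= f0 x <= f x.
  rewrite /f0 mulr_ge0 ?le_max ?lexx//= /f /=; set al := Num.sqrt _.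
  have [kx|kx] := lerP (k x) 0.
    by rewrite mulr0 mulr_ge0 ?cross_check_ge0//; case: ifP.
  have ha : `|al - 1| <= powR d%:R (- (1 / 4)).
    apply: (radius_close d0); move: kx; rewrite /k expr0n/= addr0 subr_gt0; exact.
  rewrite ha mul1r; have /andP[h1 _] := H al ha.
  apply: le_trans h1; rewrite ler_piMr// /k lerBlDr lerDl.
  by rewrite mulr_ge0 ?sqr_ge0// ltW.
have fC x : f x <= C.
  rewrite /f /=; case: ifP => ha; last by rewrite mul0r.
  by rewrite mul1r; have /andP[] := H _ ha.
have /andP[G1 G2] : gauss_iter d (fun=> 0) (u_sd d) f0 <= truncated_cross rho mu d <= C.
  exact: gauss_iter_le f0f fC.
rewrite G2 andbT; apply: le_trans G1.
have uE : u_mean d 0 = (fun=> 0) :> (nat -> R) by apply/funext => i; rewrite /u_mean mul0r.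
rewrite -uE.
have mn := mom_nrm2 0 d0.
pose Pu := gs d (u_mean d (0 : R)) (u_sd d).
have mk : mom Pu k by have := mom_cst Pu (1 + 0 ^+ 2 : R); have := mom_cst Pu (1 : R); rewrite /k => ? ?; mom_tac.
have k1 x : k x <= 1 by rewrite /k lerBlDr lerDl mulr_ge0 ?sqr_ge0// ltW.
have mf0 : mom Pu f0.
  apply: (@mom_bounded _ _ _ _ _ c).
    by apply: measurable_funM => //; apply: measurable_maxr => //; exact: mom_meas mk.
  move=> x; have /andP[h0 _] := f0f x; rewrite ger0_norm// /f0 ler_piMr// ge_max ler01 k1//.
rewrite (gauss_iterE (mom_integrable mf0)) -/(Ex Pu f0).
have Ek : Ex Pu k = 1 - 2 / s.
  rewrite /k; have m2 : mom Pu (fun u => (nrm2 d u - (1 + 0 ^+ 2)) ^+ 2) by mom_tac.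
  have m1 := mom_cst Pu (1 : R).
  rewrite (ExB m1 (momM (mom_cst Pu s) m2)) (Ex_cst Pu) ExZl// (Ex_nrm2_var 0 d0) -s2.
  by field; rewrite gt_eqF.
rewrite -Ek -ExZl//; apply: le_Ex => //; first by apply: momM => //; exact: mom_cst.
by move=> x; rewrite /f0 ler_wpM2l// le_max lexx orbT.
Qed.

Lemma sqrtr_nat_cvgr (e : R) : 0 < e -> exists D : nat, forall d, (D <= d)%N -> (0 < d)%N ->
  2 / Num.sqrt d%:R <= e.
Proof.
move=> e0; exists (Num.bound (4 / e ^+ 2)) => d dD d0.
have dR : 0 < d%:R :> R by rewrite ltr0n.
have s0 : 0 < Num.sqrt d%:R :> R by rewrite sqrtr_gt0.
have hd : 4 / e ^+ 2 <= d%:R.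
  apply: le_trans (ltW (archi_boundP _)) _; first by rewrite divr_ge0// sqr_ge0.
  by rewrite ler_nat.
have e2 : 0 <= 2 / e by rewrite divr_ge0// ltW.
rewrite ler_pdivrMr// mulrC -ler_pdivrMr//.
rewrite -(ger0_norm e2) -sqrtr_sqr ler_sqrt// expr_div_n.
by rewrite (_ : 2 ^+ 2 = 4 :> R)//; ring.
Qed.

Lemma powR_quarter_cvg (e : R) : 0 < e -> exists D : nat, forall d, (D <= d)%N -> (0 < d)%N ->
  powR d%:R (- (1 / 4)) <= e.
Proof.
move=> e0; exists (Num.bound (e ^- 4)) => d dD d0.
have dR : 0 < d%:R :> R by rewrite ltr0n.
have b0 : 0 < powR d%:R (- (1 / 4)) :> R by exact: powR_gt0.
rewrite -(ler_pXn2r (n := 4))// ?nnegrE ?(ltW b0) ?(ltW e0)//.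
rewrite -powR_mulrn ?(ltW b0)// -powRrM (_ : - (1 / 4) * 4%:R = -1); last by field.
rewrite powR_inv1 ?(ltW dR)// -[leRHS]invrK lef_pV2 ?posrE ?invr_gt0 ?exprn_gt0//.
apply: le_trans (ltW (archi_boundP _)) _; first by rewrite invr_ge0 exprn_ge0// ltW.
by rewrite ler_nat.
Qed.

Lemma truncated_cross_cvg (rho mu : R) : 1 <= rho -> 0 < mu ->
  truncated_cross rho mu @ \oo --> fixpt rho mu ^+ 2.
Proof.
move=> rho1 mu0; set q2 := fixpt rho mu ^+ 2.
have q20 : 0 <= q2 by exact: sqr_ge0.
apply/cvgrPdist_le => e e0.
have e20 : 0 < e / 2 by rewrite divr_gt0.
have [dlt dlt0 [D0 HD]] := pm2sq_limit rho1 mu0 e20.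
have em0 : 0 < dlt / mu by rewrite divr_gt0.
have [D1 H1] := powR_quarter_cvg em0.
have eq0 : 0 < e / 2 / (q2 + 1) by rewrite !divr_gt0// ltr_wpDl.
have [D2 H2] := sqrtr_nat_cvgr eq0.
exists (maxn 1 (maxn D0 (maxn D1 D2))) => // d /=.
rewrite !geq_max => /andP[d0 /andP[dD0 /andP[dD1 dD2]]].
have K al : `|al - 1| <= powR d%:R (- (1 / 4)) ->
    `|cross_check d rho (mu * al) - q2| <= e / 2.
  move=> ha; rewrite (cross_checkE _ _ d0); apply: HD => //.
  rewrite -[X in _ - X]mulr1 -mulrBr normrM gtr0_norm// mulrC -ler_pdivlMr//.
  exact: le_trans ha (H1 _ dD1 d0).
(* The lower constant has to be nonnegative; [cross_check] is, so truncating at 0 keeps it a lower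
   bound. *)
pose c := Num.max 0 (q2 - e / 2).
have c0 : 0 <= c by rewrite le_max lexx.
have cq : c <= q2 by rewrite ge_max q20/= lerBlDr lerDl ltW.
have C0 : 0 <= q2 + e / 2 by rewrite addr_ge0// ltW.
have /andP[B1 B2] : c * (1 - 2 / Num.sqrt d%:R) <= truncated_cross rho mu d <= q2 + e / 2.
  apply: truncated_cross_bounds => // al ha; have := K al ha.
  rewrite ler_norml => /andP[k1 k2]; apply/andP; split.
    by rewrite ge_max cross_check_ge0/=; lra.
  by rewrite -lerBlDl.
have h2 := H2 _ dD2 d0.
have h3 : c * (2 / Num.sqrt d%:R) <= e / 2.
  apply: (@le_trans _ _ (q2 * (e / 2 / (q2 + 1)))).
    by apply: ler_pM => //; rewrite divr_ge0// sqrtr_ge0.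
  rewrite mulrA ler_pdivrMr; last by rewrite ltr_wpDl.
  by rewrite mulrC ler_pM2l// lerDl.
have h4 : q2 - e / 2 <= c by rewrite le_max lexx orbT.
rewrite ler_distlC; apply/andP; split; first by move: B1 h3 h4; rewrite mulrBr mulr1; lra.
by move: B2; lra.
Qed.

End Truncation.

Theorem theorem5 (R : realType) (rho mu : R) :
  1 <= rho -> 0 < mu ->
  cvgn (truncated_cross rho mu) /\
  limn (truncated_cross rho mu)
    <= (1 + mu ^+ 2 - 1 / rho + `|mu| / Num.sqrt rho) ^+ 2.
Proof.
move=> rho1 mu0; have C := truncated_cross_cvg rho1 mu0.
split; first exact: (cvgP _ C).
have -> : limn (truncated_cross rho mu) = fixpt rho mu ^+ 2.
  exact: (cvg_lim (@Rhausdorff R) C).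
have q0 := fixpt_ge0 rho1 mu0; have := fixpt_le rho1 mu0.
rewrite /fixpt_lin gtr0_norm// div1r => h.
by rewrite lerXn2r// nnegrE// (le_trans q0).
Qed.
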